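(* Consider a local super spectral curve consisting of $r$ formal super disks, with local Ramond coordinates $\mathbb{z}_a=(z_a|\theta_a)$ on the $a$-th disk, centred at the Ramond puncture $p_a$, such that the superconformal map is $\mathbb{x}=(x|\phi)=(z_a^2\,|\,\sqrt2z_a\theta_a)$, with involution $\sigma_a:\mathbb{z}_a\mapsto-\mathbb{z}_a$ acting trivially on the other disks, with section $\omega_{0,1}$ of $\mathcal{Q}'$ and bidifferential $\mathbb{B}$. Let $Z$ be a partition function of the associated partial Airy structure with $F_{g,n}=0$ for all $g\in\mathbb{Z}+\frac12$, and let $\omega_{g,n}$ ($g\in\mathbb{Z}_{\ge0}$, $n\ge1$, $2g-2+n\ge0$) be the associated semi-stable correlators (all of these are defined in the context). For each $a\in[r]$ define $$\mathcal{E}^{1,a}_{g,n}(\mathbb{x};\mathbb{z}_{[n]}):=\omega_{g,n+1}(\mathbb{z},\mathbb{z}_{[n]})+\omega_{g,n+1}(\sigma_a(\mathbb{z}),\mathbb{z}_{[n]}),$$ $$\mathcal{E}^{2,a}_{g,n}(\mathbb{x};\mathbb{z}_{[n]}):=\mathcal{C}^{\sigma_a}(\omega_{g-1,n+2})(\mathbb{z};\mathbb{z}_{[n]})+\mathcal{C}^{\sigma_a}\Big(\sum_{\substack{g_1+g_2=g\\ I\sqcup J=[n]}}\omega_{g_1,|I|+1}\otimes\omega_{g_2,|J|+1}\Big)(\mathbb{z};\mathbb{z}_I;\mathbb{z}_J),$$ where $\mathcal{C}^{\sigma_a}$ acts on the first two entries of $\omega_{g-1,n+2}$, respectively on the first entries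 of $\omega_{g_1,|I|+1}$ and $\omega_{g_2,|J|+1}$. Then for all $g,n\geq 0$, $i\in\{1,2\}$ and $a\in[r]$ the abstract loop equations hold: $$\mathcal{E}^{i,a}_{g,n}(\mathbb{x};\mathbb{z}_{[n]})=[d\phi]^{2i-1}\,\mathcal{O}\big(x^{\frac{(s_a-3)(i-1)}{2}}\big)$$ as $\mathbb{z}$ tends to $p_a$.
   Context: Base ring: $R=\mathbb{C}[u_1,\dots,u_k,\upsilon_1,\dots,\upsilon_l]$, freely generated supercommutative. Near a Ramond puncture with Ramond coordinates $(z|\theta)$: $D^*_\theta=\partial_\theta+\theta z\partial_z$ generates the superconformal distribution; $\mathcal{Q}$ is the quotient of one-forms by the annihilator of the distribution; $[dz]=z[d\theta]\theta$, $[d\theta]\theta=-\theta[d\theta]$; $\mathcal{Q}'$ is the sheaf of residueless sections, locally $[dz]f(z)+[d\theta]g(z)$. Here $[d\phi]=\sqrt2z_a[d\theta_a]$. Multidifferentials are meromorphic sections of $\mathcal{Q}'^{\boxtimes n}$; ''symmetric'' means graded-symmetric, with $[d\theta_1][d\theta_2]$ exchanged to $-[d\theta_2][d\theta_1]$. Casimir. For a symmetric bidifferential $[d\theta_1][d\theta_2]g(\mathbb{z}_1,\mathbb{z}_2)$, $\mathcal{C}^{\sigma}(\omega)(\mathbb{z}):=\frac12[d\theta]^3\big(D^*_{\theta_1}g|_{\mathbb{z}_1=\mathbb{z},\mathbb{z}_2=\sigma(\mathbb{z})}-D^*_{\theta_1}g|_{\mathbb{z}_1=\sigma(\mathbb{z}),\mathbb{z}_2=\mathbb{z}}\big)$.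 Spectral curve data. $\omega_{0,1}=\sum_k[dz_a]t_{a,k}z_a^{k-1}+[d\theta_a]\tau_{a,k}z_a^k$ on disk $a$, with $t_{a,k}\in R$ even, $\tau_{a,k}\in R$ odd, $t_{a,0}=0$, $t_{a,k}=\tau_{a,k}=0$ for $k\ll0$. Put $s_a=\min\{k\text{ odd}\mid t_{a,k}\text{ invertible}\}$. It is assumed that $s_a\in\{1,3\}$, $\omega_{0,1}(\mathbb{z}_a)+\omega_{0,1}(-\mathbb{z}_a)=[d\theta_a]\mathcal{O}(z_a)$ and $\mathcal{C}^{\sigma_a}(\omega_{0,1}\boxtimes\omega_{0,1})=[d\theta_a]^3\mathcal{O}(z_a^{s_a})$. The symmetric bidifferential $\mathbb{B}$, for $\mathbb{z}_1$ on disk $a$ and $\mathbb{z}_2$ on disk $b$, is $$\mathbb{B}=\delta_{ab}\mathbb{B}^{\mathrm R}+\sum_{k,l>0}[dz_{a1}][dz_{b2}]B^{ab}_{kl}z_{a1}^{k-1}z_{b2}^{l-1}+\sum_{k>0,l\ge0}[dz_{a1}][d\theta_{b2}](1-\tfrac{\delta_{0l}}2)\phi^{ab}_{kl}z_{a1}^{k-1}z_{b2}^l$$ $$+\sum_{k\ge0,l>0}[d\theta_{a1}][dz_{b2}](1-\tfrac{\delta_{k0}}2)\phi^{ba}_{lk}z_{a1}^kz_{b2}^{l-1}+\sum_{k,l\ge0}[d\theta_{a1}][d\theta_{b2}](1-\tfrac{\delta_{k0}}2-\tfrac{\delta_{l0}}2)V^{ab}_{kl}z_{a1}^kz_{b2}^l,$$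 $$\mathbb{B}^{\mathrm R}(\mathbb{z}_1,\mathbb{z}_2)=[d\theta_1][d\theta_2]\Big(-\frac{\theta_1\theta_2z_1z_2}{(z_1-z_2)^2}-\frac{z_1+z_2}{2(z_1-z_2)}\Big),$$ with constants $B,V\in R$ even and $\phi\in R$ odd satisfying $B^{ab}_{0l}=B^{ab}_{k0}=\phi^{ab}_{0l}=V^{ab}_{00}=0$, $B^{ab}_{kl}=B^{ba}_{lk}$, $V^{ab}_{kl}=-V^{ba}_{lk}$. Airy structure. Variables: even $x^{a,k}=x^{(a,B,k)}$ ($k\ge1$), odd $\theta^{a,k}=x^{(a,F,k)}$ ($k\ge0$), $a\in[r]$. Let $A_r$ be the set of all these indices. $J_{a,k}=\hbar\partial_{x^{a,k}}$ ($k>0$), $0$ ($k=0$), $-k\hbar x^{a,-k}$ ($k<0$); $\Gamma_{a,k}=\hbar\partial_{\theta^{a,k}}$ ($k>0$), $\hbar(\frac12\theta^{a,0}+\partial_{\theta^{a,0}})$ ($k=0$), $\hbar\theta^{a,-k}$ ($k<0$). With $:\!XY\!:\;=XY-\langle0|XY|0\rangle$ ($|0\rangle=1$, $\langle0|$ evaluation at $0$), $L_{a,2n}=\frac12\sum_j(-1)^{j-1}:\!J_{a,-j}J_{a,2n+j}\!:+\frac12\sum_j(-1)^j(j+n):\!\Gamma_{a,-j}\Gamma_{a,2n+j}\!:+\frac{\hbar^2}4\delta_{n,0}$, $G_{a,2n+1}=\sum_j(-1)^{j-1}J_{a,-j}\Gamma_{a,2n+1+j}$. $T=\exp\big(\hbar^{-2}\sum_{a,k}J_{a,k}\frac{t_{a,k}}k-\Gamma_{a,k}\tau_{a,k}\big)$,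 $\Phi=\exp\big(\frac1{2\hbar^2}\sum_{a,b}\sum_{k,l\ge0}\frac{J_{a,k}J_{b,l}}{kl}B^{ab}_{kl}-2\frac{J_{a,k}\Gamma_{b,l}}k\phi^{ab}_{kl}+\Gamma_{a,k}\Gamma_{b,l}V^{ab}_{kl}\big)$ (terms with $J_{a,0}/0$ omitted), and $\tilde L=\Phi TLT^{-1}\Phi^{-1}$, $\tilde G=\Phi TGT^{-1}\Phi^{-1}$. A partition function is $$Z=\exp\Big(\sum_{g\in\frac12\mathbb{N},\,n\ge1,\,2g-2+n\ge0}\frac{\hbar^{2g-2+n}}{n!}\sum_{i_1,\dots,i_n\in A_r}x^{i_1}\cdots x^{i_n}F_{g,n}[i_1,\dots,i_n]\Big),$$ with even exponent and $F_{g,n}[i_1,\dots,i_n]\in R$ graded-symmetric, such that $J_{a,2j}$, $\Gamma_{a,2j-1}$, $\tilde L_{a,2j-s_a-1}$, $\tilde G_{a,2j-s_a}$ annihilate $Z$ for all $a\in[r]$, $j\ge1$. (The $F_{g,n}$ with all indices of the form $(a,F,0)$ are not determined by this condition.) Basis of forms (the $z_b,\theta_b$ terms are the local expression on disk $b$). For $k>0$: $d\xi_{a,k}=[dz_a]z_a^{k-1}$, $d\eta_{a,k}=[d\theta_a]z_a^k$, and $d\xi_{a,-k}=\frac{[dz_a]}{z_a^{k+1}}+\frac1k\sum_b\Big(\sum_{l>0}[dz_b]\big(B^{ab}_{kl}+\tfrac12\sum_c\phi^{bc}_{l0}\phi^{ac}_{k0}\big)z_b^{l-1}+\sum_{l\ge0}[d\theta_b]\big(\phi^{ab}_{kl}+\tfrac12\sum_cV^{cb}_{0l}\phi^{ac}_{k0}\big)z_b^l\Big)$,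 $d\eta_{a,0}=[d\theta_a]+\sum_b\sum_{l>0}\big([dz_b]\phi^{ba}_{l0}z_b^{l-1}+[d\theta_b]V^{ab}_{0l}z_b^l\big)$, $d\eta_{a,-k}=\frac{[d\theta_a]}{z_a^k}+\sum_b\Big(\sum_{l>0}[dz_b]\big(\phi^{ba}_{lk}+\tfrac12\sum_cV^{ac}_{k0}\phi^{bc}_{l0}\big)z_b^{l-1}+\sum_{l\ge0}[d\theta_b]\big(V^{ab}_{kl}+\tfrac12\sum_cV^{ac}_{k0}V^{cb}_{0l}\big)z_b^l\Big)$. Write $d\xi_{-i}=d\xi_{a,-k}$ for $i=(a,B,k)$ and $d\xi_{-i}=d\eta_{a,-k}$ for $i=(a,F,k)$. Semi-stable correlators: $\omega_{g,n}(\mathbb{z}_{[n]})=\sum_{i_1,\dots,i_n\in A_r}\prod_{k=1}^nd\xi_{-i_k}(\mathbb{z}_k)\,F_{g,n}[i_1,\dots,i_n]$ for $2g-2+n\ge0$, $(g,n)\ne(0,2)$, and $\omega_{0,2}=\mathbb{B}+\sum_{i,j\in A_r}d\xi_{-i}(\mathbb{z}_1)d\xi_{-j}(\mathbb{z}_2)F_{0,2}[i,j]$; the sums in $\mathcal{E}^{2,a}$ include $\omega_{0,1}$, and $\omega_{g,n}=0$ for $g<0$. *)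

(* Defs.v *)
From HB Require Import structures.
From mathcomp Require Import all_boot all_order all_algebra.
From mathcomp Require Import mpoly complex.

Set Implicit Arguments.
Unset Strict Implicit.
Unset Printing Implicit Defensive.

Import Order.TTheory GRing.Theory Num.Theory.
Local Open Scope ring_scope.

(* The exterior algebra on [l] odd generators over a commutative ring [A]:
   [x S] is the coefficient of the product of the generators indexed by [S],
   taken in increasing order. *)
Definition grassmann (l : nat) (A : Type) := {ffun {set 'I_l} -> A}.

(* Number of transpositions needed to sort the concatenation of [S] and [T]. *)
Definition inversions (l : nat) (S T : {set 'I_l}) : nat :=
  #|[set p : 'I_l * 'I_l | [&& p.1 \in S, p.2 \in T & (p.2 < p.1)%N]]|.

Section GrassmannRing.
Variables (l : nat) (A : comNzRingType).
Implicit Types (x y z : grassmann l A) (S T U : {set 'I_l}).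

HB.instance Definition _ :=
  GRing.Zmodule.copy (grassmann l A) {ffun {set 'I_l} -> A}.

Definition grassmann_one : grassmann l A := [ffun S => (S == set0)%:R].

Definition grassmann_mul x y : grassmann l A :=
  [ffun U : {set 'I_l} =>
     \sum_(S : {set 'I_l} | S \subset U)
        (-1) ^+ inversions S (U :\: S) * x S * y (U :\: S)].

Lemma inversionsUl S T U : [disjoint S & T] ->
  inversions (S :|: T) U = (inversions S U + inversions T U)%N.
Proof.
move=> dST; rewrite /inversions -cardsUI.
set X := [set _ | _]; set Y := [set _ | _]; set Z := [set _ | _].
have -> : Y :&: Z = set0.
  apply/setP=> p; rewrite !inE.
  case pS: (p.1 \in S) => //=; rewrite (disjointFr dST pS) /=.
  by rewrite andbF.
rewrite cards0 addn0; apply: eq_card => p; rewrite !inE.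
by case: (p.1 \in S); case: (p.1 \in T); rewrite /= ?orbF ?orbb.
Qed.

Lemma inversionsUr S T U : [disjoint T & U] ->
  inversions S (T :|: U) = (inversions S T + inversions S U)%N.
Proof.
move=> dTU; rewrite /inversions -cardsUI.
set X := [set _ | _]; set Y := [set _ | _]; set Z := [set _ | _].
have -> : Y :&: Z = set0.
  apply/setP=> p; rewrite !inE.
  case pS: (p.2 \in T) => //=; rewrite ?(disjointFr dTU pS) /= ?andbF //.
rewrite cards0 addn0; apply: eq_card => p; rewrite !inE.
by case: (p.1 \in S); case: (p.2 \in T); case: (p.2 \in U);
  rewrite /= ?orbF ?orbb.
Qed.

Lemma inversions0l T : inversions set0 T = 0%N.
Proof. by apply: eq_card0 => p; rewrite !inE. Qed.

Lemma inversions0r S : inversions S set0 = 0%N.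
Proof. by apply: eq_card0 => p; rewrite !inE andbF. Qed.

Lemma setUDK S T : S :|: T :\: S = S :|: T.
Proof. by apply/setP=> i; rewrite !inE; case: (i \in S). Qed.

Lemma grassmann_mulA : associative grassmann_mul.
Proof.
move=> x y z; apply/ffunP=> U; rewrite !ffunE.
under eq_bigr do rewrite ffunE big_distrr /=.
under [in RHS]eq_bigr do rewrite ffunE big_distrr big_distrl /=.
rewrite [RHS](exchange_big_dep (fun S : {set 'I_l} => S \subset U)) /=; last first.
  by move=> P S PU /subset_trans; apply.
apply: eq_bigr => S SU.
rewrite (reindex_onto (fun P : {set 'I_l} => P :\: S) (fun Q => S :|: Q)) /=;
  last first.
  move=> Q; rewrite subsetD => /andP[_ dQS].
  by rewrite setDUl setDv set0U; apply/setDidPl.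
apply: eq_big => [P|P /andP[PU /eqP PE]].
  rewrite setUDK (sameP eqP setUidPr).
  case SP: (S \subset P); rewrite ?andbF ?andbT //.
  rewrite subDset; suff -> : S :|: U :\: S = U by [].
  by rewrite setUDK (setUidPr SU).
move: PE; rewrite setUDK => PE.
have SP : S \subset P by rewrite -PE subsetUl.
have PU' : P \subset U.
  by rewrite -PE -setUDK subUset SU (subset_trans PU) ?subsetDl.
have -> : (U :\: S) :\: (P :\: S) = U :\: P.
  by rewrite setDDl setUDK (setUidPr SP).
have dPU : [disjoint P & U :\: P].
  by rewrite disjoint_sym disjoints_subset subsetDr.
have d1 : [disjoint S & P :\: S].
  by rewrite disjoint_sym disjoints_subset subsetDr.
have d2 : [disjoint P :\: S & U :\: P].
  by apply: disjointWl dPU; apply: subsetDl.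
have -> : inversions S (U :\: S)
    = (inversions S (P :\: S) + inversions S (U :\: P))%N.
  rewrite -inversionsUr //; congr inversions.
  apply/setP=> i; rewrite !inE.
  have := subsetP SP i; have := subsetP PU' i.
  by case: (i \in S); case: (i \in P); case: (i \in U) => // a b;
     rewrite ?(a isT) ?(b isT) //; have := b isT; have := a isT.
have -> : inversions P (U :\: P)
    = (inversions S (U :\: P) + inversions (P :\: S) (U :\: P))%N.
  by rewrite -inversionsUl // setUDK (setUidPr SP).
rewrite !exprD.
by rewrite !mulrA [RHS](ACl (3*1*4*2*5*6)).
Qed.

Lemma grassmann_mul1x : left_id grassmann_one grassmann_mul.
Proof.
move=> x; apply/ffunP=> U; rewrite ffunE (bigD1 set0) ?sub0set //=.
rewrite ffunE eqxx inversions0l expr0 !mul1r setD0 big1 ?addr0 // => S.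
by case/andP=> _ /negPf S0; rewrite ffunE S0 mulr0 mul0r.
Qed.

Lemma grassmann_mulx1 : right_id grassmann_one grassmann_mul.
Proof.
move=> x; apply/ffunP=> U; rewrite ffunE (bigD1 U) //=.
rewrite ffunE setDv eqxx inversions0r expr0 mul1r mulr1 big1 ?addr0 // => S.
case/andP=> SU SnU; rewrite ffunE setD_eq0.
suff -> : (U \subset S) = false by rewrite mulr0.
by apply/negP => US; case/eqP: SnU; apply/eqP; rewrite eqEsubset SU.
Qed.

Lemma grassmann_mulDl : left_distributive grassmann_mul +%R.
Proof.
move=> x y z; apply/ffunP=> U; rewrite !ffunE -big_split /=.
by apply: eq_bigr => S _; rewrite ffunE mulrDr mulrDl.
Qed.

Lemma grassmann_mulDr : right_distributive grassmann_mul +%R.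
Proof.
move=> x y z; apply/ffunP=> U; rewrite !ffunE -big_split /=.
by apply: eq_bigr => S _; rewrite ffunE mulrDr.
Qed.

Lemma grassmann_oner_neq0 : grassmann_one != 0.
Proof.
apply/eqP => /ffunP/(_ set0); rewrite !ffunE eqxx => /eqP.
by rewrite oner_eq0.
Qed.

HB.instance Definition _ := GRing.Zmodule_isNzRing.Build (grassmann l A)
  grassmann_mulA grassmann_mul1x grassmann_mulx1 grassmann_mulDl
  grassmann_mulDr grassmann_oner_neq0.

End GrassmannRing.

(* C[u_1, ..., u_k, v_1, ..., v_l] with the u's even and the v's odd *)
Definition superpoly (C : comNzRingType) (k l : nat) :=
  grassmann l {mpoly C[k]}.

Section SuperPoly.
Variables (C : comNzRingType) (k l : nat).

HB.instance Definition _ := GRing.NzRing.on (superpoly C k l).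
HB.instance Definition _ :=
  GRing.Lmodule.copy (superpoly C k l) {ffun {set 'I_l} -> {mpoly C[k]}}.

Lemma superpoly_scaleAl (c : C) (x y : superpoly C k l) :
  c *: (x * y) = c *: x * y.
Proof.
apply/ffunP=> U; rewrite !ffunE scaler_sumr; apply: eq_bigr => S _.
by rewrite !ffunE scalerAl scalerAr.
Qed.
HB.instance Definition _ :=
  GRing.Lmodule_isLalgebra.Build C (superpoly C k l) superpoly_scaleAl.

Lemma superpoly_scaleAr (c : C) (x y : superpoly C k l) :
  c *: (x * y) = x * (c *: y).
Proof.
apply/ffunP=> U; rewrite !ffunE scaler_sumr; apply: eq_bigr => S _.
by rewrite !ffunE scalerAr.
Qed.
HB.instance Definition _ :=
  GRing.Lalgebra_isAlgebra.Build C (superpoly C k l) superpoly_scaleAr.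

End SuperPoly.

From mathcomp Require Import boolp classical_sets functions cardinality fsbigop reals.
Local Open Scope classical_set_scope.
Local Open Scope ring_scope.

Section Parity.
Variables (C : comNzRingType) (p q : nat).
Implicit Types x : superpoly C p q.

(* the automorphism that is 1 on even elements and -1 on odd elements *)
Definition parity_inv x : superpoly C p q :=
  [ffun S : {set 'I_q} => (-1) ^+ #|S| * x S].

Definition parity_exp (b : bool) x := if b then parity_inv x else x.

(* [has_parity false x]: [x] is even; [has_parity true x]: [x] is odd *)
Definition has_parity (b : bool) x : Prop :=
  forall S : {set 'I_q}, odd #|S| != b -> x S = 0.

Definition invertible x : Prop := exists y, x * y = 1 /\ y * x = 1.

End Parity.

Section Words.
Variables (T : Type) (par : T -> bool).

Definition wpar (w : seq T) : bool := odd (count par w).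

(* parity of the number of transpositions of odd letters needed to sort
   [mask b w ++ mask (map negb b) w] into [w] *)
Fixpoint shuffle_sign (b : bitseq) (w : seq T) : bool :=
  match b, w with
  | c :: b', x :: w' =>
      (~~ c && par x && wpar (mask b' w')) (+) shuffle_sign b' w'
  | _, _ => false
  end.

End Words.

(* [B], [phi], [V] are indexed as in B^{ab}_{kl} *)
Record spectral_data (C : comNzRingType) (p q r : nat) := SpectralData {
  sd_t : 'I_r -> int -> superpoly C p q;
  sd_tau : 'I_r -> int -> superpoly C p q;
  sd_s : 'I_r -> int;
  sd_B : 'I_r -> 'I_r -> nat -> nat -> superpoly C p q;
  sd_phi : 'I_r -> 'I_r -> nat -> nat -> superpoly C p q;
  sd_V : 'I_r -> 'I_r -> nat -> nat -> superpoly C p q }.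

(* Local basis of one-forms, all coefficients being written on the right:
   [(a, false, k)] stands for [dz_a] z_a^(k-1) and [(a, true, k)] for
   [dtheta_a] z_a^k.  Since [dz] = z [dtheta] theta, the form [(a, e, k)] is
   [dtheta_a] theta_a^(~~ e) z_a^k in both cases.  It has parity [e]. *)
Definition oneform (r : nat) := ('I_r * bool * int)%type.

Definition fpar (r : nat) (s : oneform r) : bool := s.1.2.

(* Indices of the variables: [inl (a, k)] is (a, B, k+1), [inr (a, k)] is
   (a, F, k). *)
Definition idx (r : nat) := ('I_r * nat + 'I_r * nat)%type.

Definition ipar (r : nat) (i : idx r) : bool := if i is inr _ then true else false.

Definition imode (r : nat) (i : idx r) : nat :=
  match i with inl (_, k) => k.+1 | inr (_, k) => k end.

Section TwoPoints.
Variables (C : numClosedFieldType) (p q : nat).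
Local Notation R := (superpoly C p q).

(* [g d e1 e2 k l] is the coefficient of
   theta_1^e1 theta_2^e2 z_1^k z_2^l / (z_1 - z_2)^d
   in a function that is Laurent in z_1 and z_2 up to poles on the diagonal. *)
Definition bifun := nat -> bool -> bool -> int -> int -> R.

(* D*_theta = d/dtheta + theta z d/dz in the first point, using
   z_1 d/dz_1 (z_1 - z_2)^-d = - d z_1 (z_1 - z_2)^-(d+1) *)
Definition Dstar1 (g : bifun) : bifun := fun d e1 e2 k l =>
  if e1 then
    k%:~R *: g d false e2 k l
      - (if d is d'.+1 then d'%:R *: g d' false e2 (k - 1) l else 0)
  else g d true e2 k l.

(* Coefficient of theta^e z^m after the substitution (z_1 | theta_1) =
   (c1 z | c1 theta), (z_2 | theta_2) = (c2 z | c2 theta), with [c1 != c2].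
   Sums over a set [A], written [\sum_(x \in A)], are 0 by convention if
   infinitely many terms are nonzero; the families summed in this file are
   finitely supported in their intended uses. *)
Definition restrict2 (c1 c2 : C) (g : bifun) (e : bool) (m : int) : R :=
  \sum_(ee : bool * bool | (ee.1 + ee.2 == e :> nat)%N)
    \sum_(dk \in [set: nat * int])
      (let: (d, k) := dk in let l : int := m + d%:Z - k in
       (c1 ^ (k + ee.1%:Z) * c2 ^ (l + ee.2%:Z) / (c1 - c2) ^+ d)
         *: g d ee.1 ee.2 k l).

(* [casimir g e m] is the coefficient of [dtheta]^3 theta^e z^m in the Casimir
   of [dtheta_1] [dtheta_2] g, for the involution (z | theta) -> (-z | -theta) *)
Definition casimir (g : bifun) (e : bool) (m : int) : R :=
  2^-1 *: (restrict2 1 (-1) (Dstar1 g) e m - restrict2 (-1) 1 (Dstar1 g) e m).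

(* Coefficient of theta_1^e1 theta_2^e2 z_1^k z_2^l in the expansion of [g] at
   z_1 = 0 for fixed z_2 (that is, for |z_1| < |z_2|), using
   (z_1 - z_2)^-d = (-1)^d \sum_j 'C(d + j - 1, j) z_1^j z_2^(-d-j) *)
Definition expand (g : bifun) (e1 e2 : bool) (k l : int) : R :=
  \sum_(dj \in [set: nat * nat])
    (let: (d, j) := dj in
     ((-1) ^+ d * 'C((d + j).-1, j)%:R) *:
       g d e1 e2 (k - j%:Z) (l + d%:Z + j%:Z)).

(* the function g such that B^R = [dtheta_1] [dtheta_2] g *)
Definition BR : bifun := fun d e1 e2 k l =>
  if [&& d == 2%N, e1, e2, k == 1 & l == 1] then -1
  else if [&& d == 1%N, ~~ e1, ~~ e2 & (k, l) \in [:: (1, 0); (0, 1)]]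
       then - (2^-1)%:A
  else 0.

(* The function g such that [dtheta_1] [dtheta_2] g is the bidifferential on
   the disks [a] and [b] with coefficients [w]; moving theta_1^e1 past
   [dtheta_2] gives a sign. *)
Definition bifun_of (r : nat) (w : oneform r -> oneform r -> R) (a b : 'I_r) : bifun :=
  fun d e1 e2 k l =>
    if d == 0%N then (-1) ^+ e1 * w (a, ~~ e1, k) (b, ~~ e2, l) else 0.

(* The involution acts by -1 on z, theta and [dtheta]; [f e m] is the
   coefficient of [dtheta] theta^e z^m. *)
Definition sigma_pull (f : bool -> int -> R) (e : bool) (m : int) : R :=
  (-1) ^+ (~~ e) *: ((-1 : C) ^ m *: f e m).

(* [f] is O(z^m) *)
Definition is_Oz (m : int) (f : bool -> int -> R) : Prop :=
  forall e m', m' < m -> f e m' = 0.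

(* [f] is the family of coefficients of [dtheta]^j theta^e z^m of a section of
   the form [dphi]^j O(x^n), where x = z^2, phi = sqrt 2 z theta and
   [dphi] = sqrt 2 z [dtheta]: it is [dphi]^j x^n (h_0(x) + phi h_1(x)) for
   power series h_0 and h_1 in x. *)
Definition is_Ophi (j : nat) (n : int) (f : bool -> int -> R) : Prop :=
  exists h : bool -> nat -> R, forall e m,
    f e m = \sum_(i \in [set i : nat | m = j%:Z + e%:Z + 2 * (n + i%:Z)])
              (sqrtC 2 ^+ (j + e)) *: h e i.

End TwoPoints.

Section Forms.
Variables (C : numClosedFieldType) (p q r : nat) (D : spectral_data C p q r).
Local Notation R := (superpoly C p q).
Local Notation B := (sd_B D).
Local Notation phi := (sd_phi D).
Local Notation V := (sd_V D).

Definition omega01 (s : oneform r) : R :=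
  let: (a, e, k) := s in if e then sd_tau D a k else sd_t D a k.

(* coefficients of the bidifferential minus its singular part *)
Definition Breg (s1 s2 : oneform r) : R :=
  match s1, s2 with
  | (a, e1, Posz k), (b, e2, Posz l) =>
      match e1, e2 with
      | false, false => if (0 < k)%N && (0 < l)%N then B a b k l else 0
      | false, true =>
          if (0 < k)%N then (1 - (l == 0)%:R / 2) *: phi a b k l else 0
      | true, false =>
          if (0 < l)%N then (1 - (k == 0)%:R / 2) *: phi b a l k else 0
      | true, true =>
          (1 - (k == 0)%:R / 2 - (l == 0)%:R / 2) *: V a b k l
      end
  | _, _ => 0
  end.

(* coefficients of d xi_{-i} *)
Definition dxi (i : idx r) (s : oneform r) : R :=
  let: (b, e, m) := s in
  match i with
  | inl (a, k') => let k := k'.+1 in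
      (if e then 0 else ((b == a) && (m == - k%:Z))%:R)
      + (k%:R)^-1 *:
        match m with
        | Posz l =>
            if e then phi a b k l + 2^-1 *: \sum_c V c b 0%N l * phi a c k 0%N
            else if (0 < l)%N then
              B a b k l + 2^-1 *: \sum_c phi b c l 0%N * phi a c k 0%N
            else 0
        | _ => 0
        end
  | inr (a, 0%N) =>
      (if e then ((b == a) && (m == 0))%:R else 0)
      + match m with
        | Posz l =>
            if (0 < l)%N then if e then V a b 0%N l else phi b a l 0%N else 0
        | _ => 0
        end
  | inr (a, k) =>
      (if e then ((b == a) && (m == - k%:Z))%:R else 0)
      + match m with
        | Posz l =>
            if e then V a b k l + 2^-1 *: \sum_c V a c k 0%N * V c b 0%N l
            else if (0 < l)%N then
              phi b a l k + 2^-1 *: \sum_c V a c k 0%N * phi b c l 0%N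
            else 0
        | _ => 0
        end
  end.

(* coefficients of d xi_{-i_1}(z_1) ... d xi_{-i_n}(z_n) *)
Fixpoint dxi_prod (I : seq (idx r)) (s : seq (oneform r)) : R :=
  match I, s with
  | [::], [::] => 1
  | i :: I', x :: s' =>
      parity_exp (wpar (@fpar r) s') (dxi i x) * dxi_prod I' s'
  | _, _ => 0
  end.

(* Coefficients, as a multidifferential in z, z', z_1, ..., z_n, of
   \sum_{I |_| J = [n]} w1(z, z_I) w2(z', z_J) *)
Definition tensor (w1 w2 : seq (oneform r) -> R) (s1 s2 : oneform r)
    (T : seq (oneform r)) : R :=
  \sum_(b : (size T).-tuple bool)
    (let TI := mask b T in let TJ := mask (map negb b) T in
     (-1) ^+ (shuffle_sign (@fpar r) b T (+) (wpar (@fpar r) TI && fpar s2))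
     * parity_exp (fpar s2 (+) wpar (@fpar r) TJ) (w1 (s1 :: TI))
     * w2 (s2 :: TJ)).

Record is_local_super_spectral_curve : Prop := {
  t_even : forall a k, has_parity false (sd_t D a k);
  tau_odd : forall a k, has_parity true (sd_tau D a k);
  t_a0 : forall a, sd_t D a 0 = 0;
  t_tau_meromorphic : exists N : int, forall a k, k < N ->
    sd_t D a k = 0 /\ sd_tau D a k = 0;
  s_odd_invertible : forall a,
    ~~ (2 %| sd_s D a)%Z /\ invertible (sd_t D a (sd_s D a));
  s_min : forall a k, ~~ (2 %| k)%Z -> invertible (sd_t D a k) -> sd_s D a <= k;
  s_13 : forall a, sd_s D a = 1 \/ sd_s D a = 3;
  omega01_sigma : forall a, is_Oz 1 (fun e m =>
    let w := fun e m => omega01 (a, ~~ e, m) in w e m + sigma_pull w e m);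
  omega01_casimir : forall a, is_Oz (sd_s D a) (casimir (bifun_of
    (fun s1 s2 => parity_exp (fpar s2) (omega01 s1) * omega01 s2) a a));
  B_even : forall a b k l, has_parity false (B a b k l);
  phi_odd : forall a b k l, has_parity true (phi a b k l);
  V_even : forall a b k l, has_parity false (V a b k l);
  B_k0 : forall a b k, B a b k 0 = 0;
  B_0l : forall a b l, B a b 0 l = 0;
  phi_0l : forall a b l, phi a b 0 l = 0;
  V_00 : forall a b, V a b 0 0 = 0;
  B_sym : forall a b k l, B a b k l = B b a l k;
  V_antisym : forall a b k l, V a b k l = - V b a l k }.

End Forms.

Section Airy.
Variables (C : numClosedFieldType) (p q r : nat) (D : spectral_data C p q r).
Local Notation R := (superpoly C p q).

(* Formal series in hbar^{+-1} and the variables: [f m I] is the Taylor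
   coefficient f[i_1, ..., i_n] of
   \sum_m hbar^m \sum_n 1/n! \sum_{i_1, ..., i_n} x^{i_1} ... x^{i_n}
     f[i_1, ..., i_n]. *)
Definition fock := int -> seq (idx r) -> R.

Definition op := fock -> fock.

Local Notation ip := (@ipar r).
Local Notation wp := (wpar (@ipar r)).

Definition hbar (j : int) : op := fun f m I => f (m - j) I.

(* left multiplication by a constant, moved past the variables *)
Definition cst (c : R) : op := fun f m I => parity_exp (wp I) c * f m I.

Definition scale (c : C) : op := fun f m I => c *: f m I.

Definition addop (X Y : op) : op := fun f m I => X f m I + Y f m I.

Definition zeroop : op := fun _ _ _ => 0.

(* left derivative with respect to x^i *)
Definition der (i : idx r) : op := fun f m I => f m (i :: I).

(* Left multiplication by x^i, computed by means of
   d_j (x^i f) = delta_{ij} f + (-1)^{|i||j|} x^i d_j f. *)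
Fixpoint mulx_word (i : idx r) (f : seq (idx r) -> R) (I : seq (idx r)) : R :=
  if I is j :: I' then
    (i == j)%:R * f I' + (-1) ^+ (ip i && ip j) * mulx_word i (fun K => f (j :: K)) I'
  else 0.

Definition mulx (i : idx r) : op := fun f m I => mulx_word i (f m) I.

Definition Jop (a : 'I_r) (k : int) : op :=
  match k with
  | Posz 0 => zeroop
  | Posz k'.+1 => hbar 1 \o der (inl (a, k'))
  | Negz k' => scale (k'.+1)%:R \o hbar 1 \o mulx (inl (a, k'))
  end.

Definition Gammaop (a : 'I_r) (k : int) : op :=
  match k with
  | Posz 0 => hbar 1 \o addop (scale 2^-1 \o mulx (inr (a, 0%N))) (der (inr (a, 0%N)))
  | Posz k => hbar 1 \o der (inr (a, k))
  | Negz k' => hbar 1 \o mulx (inr (a, k'.+1))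
  end.

Definition vacuum : fock := fun m I => ((m == 0) && (I == [::]))%:R.

(* coefficient of hbar^m in <0| X Y |0> *)
Definition vev (X Y : op) (m : int) : R := X (Y vacuum) m [::].

(* : X Y : *)
Definition nord (X Y : op) : op := fun f m I =>
  X (Y f) m I
  - \sum_(j \in [set: int]) cst (vev X Y j) (hbar j f) m I.

(* L_{a,2n} *)
Definition Lop (a : 'I_r) (n : int) : op := fun f m I =>
  2^-1 *: (\sum_(j \in [set: int])
     (-1) ^ (j - 1) *: nord (Jop a (- j)) (Jop a (2 * n + j)) f m I)
  + 2^-1 *: (\sum_(j \in [set: int])
     ((-1) ^ j * (j + n)%:~R) *:
        nord (Gammaop a (- j)) (Gammaop a (2 * n + j)) f m I)
  + ((n == 0)%:R / 4) *: hbar 2 f m I.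

(* G_{a,2n+1} *)
Definition Gop (a : 'I_r) (n : int) : op := fun f m I =>
  \sum_(j \in [set: int])
     (-1) ^ (j - 1) *: Jop a (- j) (Gammaop a (2 * n + 1 + j) f) m I.

(* T = exp logT and Phi = exp logPhi; the terms with a division by 0 vanish *)
Definition logT : op := fun f m I =>
  \sum_a \sum_(k \in [set: int])
    hbar (-2) (fun m I =>
       (k%:~R)^-1 *: Jop a k (cst (sd_t D a k) f) m I
       - Gammaop a k (cst (sd_tau D a k) f) m I) m I.

Definition logPhi : op := fun f m I =>
  2^-1 *: \sum_a \sum_b \sum_(kl \in [set: nat * nat])
    (let: (k, l) := kl in
     hbar (-2) (fun m I =>
       (k%:R * l%:R)^-1 *: Jop a k (Jop b l (cst (sd_B D a b k l) f)) m I
       - (2 / k%:R) *: Jop a k (Gammaop b l (cst (sd_phi D a b k l) f)) m I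
       + Gammaop a k (Gammaop b l (cst (sd_V D a b k l) f)) m I) m I).

(* exp(A) X exp(-A) = \sum_n ad_A^n(X) / n!, for A even *)
Definition ad (A X : op) : op := fun f m I => A (X f) m I - X (A f) m I.

Definition exp_conj (A X : op) : op := fun f m I =>
  \sum_(n \in [set: nat]) (n`!%:R)^-1 *: iter n (ad A) X f m I.

Definition Ltilde (a : 'I_r) (n : int) : op :=
  exp_conj logPhi (exp_conj logT (Lop a n)).

Definition Gtilde (a : 'I_r) (n : int) : op :=
  exp_conj logPhi (exp_conj logT (Gop a n)).

(* product of series; the sum is over the ways to split a word in two *)
Definition fock_mul (f g : fock) : fock := fun m I =>
  \sum_(j \in [set: int]) \sum_(b : (size I).-tuple bool)
    (let I1 := mask b I in let I2 := mask (map negb b) I in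
     (-1) ^+ shuffle_sign ip b I * parity_exp (wp I2) (f j I1) * g (m - j) I2).

Definition fock_exp (f : fock) : fock := fun m I =>
  \sum_(n \in [set: nat]) (n`!%:R)^-1 *: iter n (fock_mul f) vacuum m I.

(* [F h] is F_{g,n} for g = h/2 *)
Implicit Type F : nat -> seq (idx r) -> R.

Definition logZ F : fock := fun m I =>
  match m with
  | Posz m => if (0 < size I <= m.+2)%N then F (m.+2 - size I)%N I else 0
  | Negz _ => 0
  end.

Definition annihilates (X : op) (f : fock) : Prop := forall m I, X f m I = 0.

(* [F] is only used on nonempty words [I] such that [h + size I >= 2] *)
Record is_partition_function F : Prop := {
  F_even : forall h I, has_parity (wp I) (F h I);
  F_symmetric : forall h I1 i j I2, F h (I1 ++ [:: i, j & I2]) =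
    (-1) ^+ (ip i && ip j) * F h (I1 ++ [:: j, i & I2]);
  F_finite : forall h n, exists N, forall I, size I = n ->
    F h I != 0 -> all (fun i => imode i <= N)%N I;
  Z_J : forall a (j : nat), (1 <= j)%N ->
    annihilates (Jop a (2 * j%:Z)) (fock_exp (logZ F));
  Z_Gamma : forall a (j : nat), (1 <= j)%N ->
    annihilates (Gammaop a (2 * j%:Z - 1)) (fock_exp (logZ F));
  Z_L : forall a (j : nat) (n : int), (1 <= j)%N ->
    2 * n = 2 * j%:Z - sd_s D a - 1 ->
    annihilates (Ltilde a n) (fock_exp (logZ F));
  Z_G : forall a (j : nat) (n : int), (1 <= j)%N ->
    2 * n + 1 = 2 * j%:Z - sd_s D a ->
    annihilates (Gtilde a n) (fock_exp (logZ F)) }.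

Section Correlators.
Variable F : nat -> seq (idx r) -> R.

(* coefficients of \sum_{i_1, ..., i_n} d xi_{-i_1} ... d xi_{-i_n} F_{g,n} *)
Definition omegaF (g : nat) (S : seq (oneform r)) : R :=
  \sum_(I \in [set I : seq (idx r) | size I = size S])
     dxi_prod D I S * F g.*2 I.

(* omega_{0,2} = [dtheta_1] [dtheta_2] omega02 for points on disks [a] and [b] *)
Definition omega02 (a b : 'I_r) : bifun C p q := fun d e1 e2 k l =>
  (a == b)%:R * BR C p q d e1 e2 k l
  + bifun_of (fun s1 s2 => Breg D s1 s2 + omegaF 0 [:: s1; s2]) a b d e1 e2 k l.

(* Coefficients of omega_{g,n}, [n = size S]; for omega_{0,2} those of the
   expansion for |z_1| < |z_2|. *)
Definition omega (g : nat) (S : seq (oneform r)) : R :=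
  match g, S with
  | 0%N, [:: s] => omega01 D s
  | 0%N, [:: (a, e1, k); (b, e2, l)] =>
      (-1) ^+ (~~ e1) * expand (omega02 a b) (~~ e1) (~~ e2) k l
  | _, _ => omegaF g S
  end.

(* omega_{g,n+2} at two points of disk [a], for fixed [T] in the other n *)
Definition omega_pair (g : nat) (a : 'I_r) (T : seq (oneform r)) : bifun C p q :=
  if (g == 0%N) && nilp T then omega02 a a
  else bifun_of (fun s1 s2 => omega g [:: s1, s2 & T]) a a.

(* [E1 a g T e m]: coefficient of [dtheta] theta^e z^m T *)
Definition E1 (a : 'I_r) (g : nat) (T : seq (oneform r)) (e : bool) (m : int) : R :=
  let w := fun e m => omega g ((a, ~~ e, m) :: T) in
  w e m + sigma_pull w e m.

(* [E2 a g T e m]: coefficient of [dtheta]^3 theta^e z^m T *)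
Definition E2 (a : 'I_r) (g : nat) (T : seq (oneform r)) (e : bool) (m : int) : R :=
  (if g is g'.+1 then casimir (omega_pair g' a T) e m else 0)
  + casimir (bifun_of (fun s1 s2 =>
      \sum_(g1 < g.+1) tensor (omega g1) (omega (g - g1)) s1 s2 T) a a) e m.

Definition loopE (i : nat) := if i == 1%N then E1 else E2.

End Correlators.
End Airy.

(* Main.v *)
(* Conjugation by T and Phi turns every mode J_{a,-k}, Gamma_{a,-k} into the sum
   of the constant [omega01 s] and hbar times a combination of the x^i and d/dx^i
   whose derivative coefficients are the coefficients of the d xi_{-i} on the
   one-form [s]: the iterated commutators with log T and log Phi vanish from
   the third on.  Applied to Z = exp W such an operator multiplies Z by a series G_s.
   As Z is invertible, a quadratic operator annihilating Z gives an identity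
   between the G_s and W alone.  Replacing x^i by d xi_{-i} is compatible with
   products and sends G_s to the generating series of the correlators with first
   entry [s], the terms in x^i becoming the expansion of the bidifferential.
   Hence L_{2n} and G_{2n+1} become the coefficients of the Casimir of the
   correlators at theta z^(-2n) and z^(-2n-1); those of the other parity vanish
   because the Casimir is antisymmetrised under sigma, and hbar^2/4 is the
   contribution of B^R.  The first loop equation is the vanishing of
   J_{a,2j} and Gamma_{a,2j-1} on Z. *)
Require Import Defs.
From mathcomp Require Import all_boot all_order all_algebra.
From mathcomp Require Import mpoly complex.
From mathcomp Require Import zify.
From mathcomp Require Import ring.

Set Implicit Arguments.
Unset Strict Implicit.
Unset Printing Implicit Defensive.

Import Order.TTheory GRing.Theory Num.Theory.
Local Open Scope ring_scope.

(** A sum with infinitely many nonzero terms is 0 by convention, so no rearrangement is free. Hence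
    locality: series have finite support in bounded degree ([good]), operators compute a bounded
    degree from a bounded degree ([lop]), and identities are claimed on good series ([eqop]). On Z
    all sums are cut at a mode N, chosen after the degree and after the range of modes. The delicate
    point is the zero mode Gamma_{a,0}: it contains both x and d/dx and pairs with itself. Because
    of it a second commutator with log Phi survives; V_{00} = 0 excludes a third. The corrections
    with 1/2 in d xi_{-i} and the weights 1 - delta/2 in the bidifferential both originate here.
    Normal ordering subtracts exactly the expansion coefficients of B^R, leaving the part of
    omega_{0,2} that can be restricted to z_2 = -z_1 term by term; B^R itself is restricted
    separately. With integral genus the power of hbar determines g, so each order yields one loop
    equation. The weight j + n in L exceeds the weight j of the Casimir by a multiple of an
    alternating sum that vanishes by graded symmetry. *)

(** Each pair with distinct entries is inverted in exactly one of the two orders. This is where the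
    sign of supercommutativity comes from. *)
Lemma inversionsC (l : nat) (S T : {set 'I_l}) : [disjoint S & T] ->
  (inversions S T + inversions T S = #|S| * #|T|)%N.
Proof.
move=> dST; rewrite -cardsX /inversions.
rewrite -[RHS](cardsID [set p : 'I_l * 'I_l | (p.2 < p.1)%N]).
congr addn; first by apply: eq_card => p; rewrite !inE -andbA.
pose sw (x : 'I_l * 'I_l) := (x.2, x.1).
have sw_inj : injective sw by case=> a b [c d] [-> ->].
rewrite -(card_imset _ sw_inj); apply: eq_card => -[a b]; rewrite !inE /=.
apply/imsetP/idP => [[[c d]]|].
  rewrite inE /= => /and3P[cT dS lt] [-> ->].
  by rewrite cT dS -leqNgt (ltnW lt).
case/andP=> nlt /andP[aS bT]; exists (b, a) => //.
rewrite !inE /= aS bT /= ltn_neqAle leqNgt nlt andbT.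
apply: contraTneq aS => ab; have -> : a = b by apply: val_inj.
by rewrite (disjointFl dST bT).
Qed.

(** * Parity of superpolynomials *)

Section Parity.
Variables (C : numClosedFieldType) (p q : nat).
Local Notation R := (superpoly C p q).
Implicit Types (x y z : R) (b e : bool).

Lemma parity_expE b x S : parity_exp b x S = (-1) ^+ (b * #|S|) * x S.
Proof. by case: b; rewrite /= ?mul1n ?mul0n ?expr0 ?mul1r // ffunE. Qed.

Lemma parity_expD b x y : parity_exp b (x + y) = parity_exp b x + parity_exp b y.
Proof. by apply/ffunP=> S; rewrite parity_expE !ffunE !parity_expE mulrDr. Qed.

Lemma parity_expZ b (c : C) x : parity_exp b (c *: x) = c *: parity_exp b x.
Proof. by apply/ffunP=> S; rewrite parity_expE !ffunE !parity_expE scalerAr. Qed.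

Lemma parity_exp_addb b e x : parity_exp b (parity_exp e x) = parity_exp (b (+) e) x.
Proof.
case: b e => [] [] //=; apply/ffunP=> S.
by rewrite !ffunE mulrA -exprD addnn -mul2n exprM sqrrN !expr1n mul1r.
Qed.

Lemma parity_expM b x y : parity_exp b (x * y) = parity_exp b x * parity_exp b y.
Proof.
case: b => //=; apply/ffunP=> U; rewrite !ffunE mulr_sumr.
apply: eq_bigr => S SU; rewrite !ffunE.
have -> : #|U| = (#|S| + #|U :\: S|)%N by rewrite cardsD (setIidPr SU) subnKC // subset_leq_card.
rewrite exprD !mulrA; congr (_ * _).
by rewrite [LHS](ACl (3*1*4*2)).
Qed.

Lemma parity_exp1 b : parity_exp b (1 : R) = 1.
Proof.
apply/ffunP=> S; rewrite parity_expE !ffunE; case: eqP => [->|]; last by rewrite mulr0.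
by rewrite cards0 muln0 expr0 mul1r.
Qed.

Lemma has_parity_exp b e x : has_parity b x -> parity_exp e x = (-1) ^+ (e && b) * x.
Proof.
move=> hx; apply/ffunP=> S; rewrite parity_expE mulr_sign.
have -> : (if e && b then - x else x) S = (-1) ^+ (e && b) * x S.
  by rewrite mulr_sign; case: (e && b); rewrite ?ffunE.
case: (boolP (odd #|S| != b)) => [/hx ->|]; first by rewrite !mulr0.
rewrite negbK => /eqP <-; rewrite -signr_odd oddM; by case: e.
Qed.

Lemma has_parityD b x y : has_parity b x -> has_parity b y -> has_parity b (x + y).
Proof. by move=> hx hy S hS; rewrite ffunE hx ?hy ?addr0. Qed.

Lemma has_parity0 b : has_parity b (0 : R).
Proof. by move=> S _; rewrite ffunE. Qed.

Lemma has_parityZ b (c : C) x : has_parity b x -> has_parity b (c *: x).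
Proof. by move=> hx S hS; rewrite ffunE hx // scaler0. Qed.

Lemma has_parityM b e x y :
  has_parity b x -> has_parity e y -> has_parity (b (+) e) (x * y).
Proof.
move=> hx hy U hU; rewrite ffunE big1 // => S SU.
have E : #|U| = (#|S| + #|U :\: S|)%N by rewrite cardsD (setIidPr SU) subnKC // subset_leq_card.
case: (boolP (odd #|S| != b)) => [/hx ->|]; first by rewrite mulr0 mul0r.
rewrite negbK => /eqP Sb; case: (boolP (odd #|U :\: S| != e)) => [/hy ->|].
  by rewrite mulr0.
by rewrite negbK => /eqP Se; move: hU; rewrite E oddD Sb Se eqxx.
Qed.

Lemma has_parity1 : has_parity false (1 : R).
Proof. by move=> S; rewrite ffunE; have [->|] := eqVneq S set0; rewrite ?cards0. Qed.

(** Passing to complements in the Grassmann product exchanges the two factors; by [inversionsC] the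
    signs differ by the parity of the product of the two cardinals. *)
Lemma supercomm b x y : has_parity b x -> x * y = parity_exp b y * x.
Proof.
move=> hx; apply/ffunP=> U; rewrite !ffunE.
rewrite (reindex_onto (fun S => U :\: S) (fun S => U :\: S)) /=; last first.
  by move=> S SU; rewrite setDDr setDv set0U (setIidPr SU).
apply: eq_big => [S|S /andP[_ /eqP SE]].
  rewrite subsetDl /=; apply/eqP/idP => [<-|SU]; first exact: subsetDl.
  by rewrite setDDr setDv set0U (setIidPr SU).
rewrite SE parity_expE.
have d : [disjoint U :\: S & S] by rewrite disjoints_subset subsetDr.
case: (boolP (odd #|U :\: S| != b)) => [/hx ->|]; first by rewrite !(mulr0, mul0r).
rewrite negbK => /eqP Ub.
have -> : (-1) ^+ inversions (U :\: S) S = (-1) ^+ inversions S (U :\: S) * (-1) ^+ (b * #|S|) :> {mpoly C[p]}.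
  rewrite -exprD -signr_odd -[RHS]signr_odd; congr (_ ^+ (nat_of_bool _)).
  have := congr1 odd (inversionsC d); rewrite !oddD !oddM Ub oddb => <-.
  by case: (odd _); case: (odd _).
by rewrite -!mulrA; congr (_ * (_ * _)); rewrite mulrC.
Qed.

End Parity.

From mathcomp Require Import boolp classical_sets functions cardinality fsbigop reals.
Local Open Scope classical_set_scope.
Local Open Scope ring_scope.

Lemma fsum_seq (V : nmodType) (T : choiceType) (s : seq T) (F : T -> V) :
  uniq s -> (forall i, i \notin s -> F i = 0) ->
  \sum_(i \in [set: T]) F i = \sum_(i <- s) F i.
Proof.
move=> us F0; rewrite (fsbigE s) //; last by move=> i _ /F0.
by apply: eq_bigl => i; rewrite in_setT.
Qed.

(** * Finitely supported sums *)

Section FiniteSums.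
Variables (C : nzRingType) (V : lmodType C) (T : choiceType).
Implicit Types F G : T -> V.

Definition finsum F := exists s : seq T, forall t, t \notin s -> F t = 0.

Lemma fsum_undup F (s : seq T) : (forall t, t \notin s -> F t = 0) ->
  \sum_(t \in [set: T]) F t = \sum_(t <- undup s) F t.
Proof. by move=> h; apply: fsum_seq (undup_uniq s) _ => t; rewrite mem_undup; apply: h. Qed.

Lemma fsumD F G : finsum F -> finsum G ->
  \sum_(t \in [set: T]) (F t + G t) = \sum_(t \in [set: T]) F t + \sum_(t \in [set: T]) G t.
Proof.
move=> [s hs] [s' hs'].
have h1 t : t \notin s ++ s' -> F t = 0 by rewrite mem_cat negb_or => /andP[/hs].
have h2 t : t \notin s ++ s' -> G t = 0 by rewrite mem_cat negb_or => /andP[_ /hs'].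
rewrite (fsum_undup h1) (fsum_undup h2) (@fsum_undup _ (s ++ s')) ?big_split // => t ts.
by rewrite h1 // h2 // addr0.
Qed.

Lemma fsumZ (c : C) F : finsum F ->
  \sum_(t \in [set: T]) (c *: F t) = c *: \sum_(t \in [set: T]) F t.
Proof.
move=> [s hs]; rewrite (fsum_undup hs) (@fsum_undup _ s) ?scaler_sumr // => t /hs ->.
by rewrite scaler0.
Qed.

Lemma finsumZ (c : C) F : finsum F -> finsum (fun t => c *: F t).
Proof. by move=> [s hs]; exists s => t /hs ->; rewrite scaler0. Qed.

Lemma finsum_sum (U : Type) (s : seq U) (P : pred U) (F : U -> T -> V) : (forall u, finsum (F u)) ->
  finsum (fun t => \sum_(u <- s | P u) F u t).
Proof.
move=> hF; elim: s => [|u s [S hS]]; first by exists [::] => t _; rewrite big_nil.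
have [S' hS'] := hF u; exists (S' ++ S) => t; rewrite mem_cat negb_or => /andP[t1 t2].
by rewrite big_cons hS' // hS // addr0; case: ifP.
Qed.

Lemma fsum_sum (U : Type) (s : seq U) (P : pred U) (F : U -> T -> V) : (forall u, finsum (F u)) ->
  \sum_(t \in [set: T]) \sum_(u <- s | P u) F u t = \sum_(u <- s | P u) \sum_(t \in [set: T]) F u t.
Proof.
move=> hF; elim: s => [|u s IH].
  by rewrite big_nil fsbig1 // => t _; rewrite big_nil.
rewrite big_cons -IH; case: ifP => Pu.
  rewrite -fsumD //; last exact: finsum_sum.
  by apply: eq_fsbigr => t _; rewrite big_cons Pu.
by apply: eq_fsbigr => t _; rewrite big_cons Pu.
Qed.

Lemma fsum1 F t0 : (forall t, t != t0 -> F t = 0) -> \sum_(t \in [set: T]) F t = F t0.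
Proof.
move=> h; rewrite (@fsum_undup _ [:: t0]) ?big_seq1 // => t; rewrite inE; exact: h.
Qed.

End FiniteSums.

Section FinitePairSums.
Variables (C : nzRingType) (V : lmodType C) (U T : choiceType).

Lemma fsum_pair_seq (F : U * T -> V) (s : seq U) (s' : seq T) : uniq s -> uniq s' ->
  (forall u t, (u \notin s) || (t \notin s') -> F (u, t) = 0) ->
  \sum_(p \in [set: U * T]) F p = \sum_(u <- s) \sum_(t <- s') F (u, t).
Proof.
move=> us us' h; rewrite (@fsum_seq _ _ [seq (u, t) | u <- s, t <- s']).
- by rewrite big_allpairs_dep.
- by apply: allpairs_uniq => // -[a b] [c d] _ _ [-> ->].
move=> [u t] nin; apply: h; rewrite -negb_and; apply: contra nin => /andP[us1 ts1].
by apply: allpairs_f.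
Qed.

Lemma finsum_pair (F : U * T -> V) : finsum F ->
  exists (s : seq U) (s' : seq T), [/\ uniq s, uniq s' &
    forall u t, (u \notin s) || (t \notin s') -> F (u, t) = 0].
Proof.
move=> [S hS]; exists (undup (map fst S)), (undup (map snd S)); split; rewrite ?undup_uniq //.
move=> u t; rewrite !mem_undup => h; apply: hS; apply: contraL h => uS.
by rewrite negb_or !negbK (map_f fst uS) (map_f snd uS).
Qed.

Lemma fsum_pair_fst (F : U * T -> V) : finsum F ->
  \sum_(p \in [set: U * T]) F p = \sum_(u \in [set: U]) \sum_(t \in [set: T]) F (u, t).
Proof.
move=> /finsum_pair[s [s' [us us' h]]]; rewrite (fsum_pair_seq us us' h).
rewrite (fsum_seq us) => [|u hu]; last by apply: fsbig1 => t _; apply: h; rewrite hu.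
by apply: eq_bigr => u _; rewrite (fsum_seq us') // => t ht; apply: h; rewrite ht orbT.
Qed.

Lemma fsum_pair_snd (F : U * T -> V) : finsum F ->
  \sum_(p \in [set: U * T]) F p = \sum_(t \in [set: T]) \sum_(u \in [set: U]) F (u, t).
Proof.
move=> /finsum_pair[s [s' [us us' h]]]; rewrite (fsum_pair_seq us us' h) exchange_big /=.
rewrite (fsum_seq us') => [|t ht]; last by apply: fsbig1 => u _; apply: h; rewrite ht orbT.
by apply: eq_bigr => t _; rewrite (fsum_seq us) // => u hu; apply: h; rewrite hu.
Qed.

End FinitePairSums.

Lemma fsum_fin (V : nmodType) (U : finType) (F : U -> V) :
  \sum_(u \in [set: U]) F u = \sum_u F u.
Proof.
rewrite (@fsum_seq _ _ (enum U)) ?enum_uniq ?big_enum // => u; by rewrite mem_enum.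
Qed.

(* Only these properties of the coefficient ring matter; keeping it abstract
   stops unification from unfolding Grassmann products.  Definitions of [Defs]
   are restated over a [supalg] under the same name with the prefix "o". *)
Record supalg (C : numClosedFieldType) := SupAlg {
  sa_ring :> algType C;
  pexp : bool -> sa_ring -> sa_ring;
  hpar : bool -> sa_ring -> Prop;
  pexp_false : forall x, pexp false x = x;
  pexpD : forall b x y, pexp b (x + y) = pexp b x + pexp b y;
  pexpZ : forall b c x, pexp b (c *: x) = c *: pexp b x;
  pexpM : forall b x y, pexp b (x * y) = pexp b x * pexp b y;
  pexp1 : forall b, pexp b 1 = 1;
  pexp_addb : forall b e x, pexp b (pexp e x) = pexp (b (+) e) x;
  hpar_pexpE : forall b e x, hpar b x -> pexp e x = (-1) ^+ (e && b) * x;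
  hparD : forall b x y, hpar b x -> hpar b y -> hpar b (x + y);
  hpar0 : forall b, hpar b 0;
  hparZ : forall b c x, hpar b x -> hpar b (c *: x);
  hparM : forall b e x y, hpar b x -> hpar e y -> hpar (b (+) e) (x * y);
  hpar1 : hpar false 1;
  supcomm : forall b x y, hpar b x -> x * y = pexp b y * x }.

Definition superpoly_supalg (C : numClosedFieldType) (p q : nat) : supalg C :=
  @SupAlg C (superpoly C p q) (@parity_exp C p q) (@has_parity C p q)
    (fun=> erefl) (@parity_expD C p q) (@parity_expZ C p q) (@parity_expM C p q)
    (@parity_exp1 C p q) (@parity_exp_addb C p q) (@has_parity_exp C p q)
    (@has_parityD C p q) (@has_parity0 C p q) (@has_parityZ C p q)
    (@has_parityM C p q) (@has_parity1 C p q) (@supercomm C p q).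

(** * Sign rules in a super algebra *)

Section SuperAlgebra.
Variables (C : numClosedFieldType) (S : supalg C).
Implicit Types (x y z : S) (b e : bool).

Lemma pexp0 b : pexp b (0 : S) = 0.
Proof. by rewrite -(scale0r (1 : S)) pexpZ !scale0r. Qed.

Lemma pexpN b x : pexp b (- x) = - pexp b x.
Proof. by rewrite -scaleN1r pexpZ scaleN1r. Qed.

Lemma pexp_sum b I (s : seq I) (P : pred I) (F : I -> S) :
  pexp b (\sum_(i <- s | P i) F i) = \sum_(i <- s | P i) pexp b (F i).
Proof.
elim: s => [|i s IH]; rewrite ?big_nil ?pexp0 // !big_cons.
by case: ifP; rewrite ?pexpD IH.
Qed.

Lemma pexp_sign b n : pexp b ((-1) ^+ n : S) = (-1) ^+ n.
Proof.
elim: n => [|n IH]; first by rewrite expr0 pexp1.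
by rewrite exprS pexpM IH pexpN pexp1.
Qed.

Lemma hparN b x : hpar b x -> hpar b (- x).
Proof. by move=> hx; rewrite -scaleN1r; apply: hparZ. Qed.

Lemma hpar_sum b I (s : seq I) (P : pred I) (F : I -> S) :
  (forall i, hpar b (F i)) -> hpar b (\sum_(i <- s | P i) F i).
Proof.
move=> hF; elim: s => [|i s IH]; rewrite ?big_nil ?big_cons; first exact: hpar0.
by case: ifP => // _; apply: hparD.
Qed.

Lemma hpar_sign b n x : hpar b x -> hpar b ((-1) ^+ n * x).
Proof. by move=> hx; rewrite -signr_odd mulr_sign; case: odd => //; apply: hparN. Qed.

Lemma hpar_pexp b e x : hpar b x -> hpar b (pexp e x).
Proof. by move=> hx; rewrite (hpar_pexpE _ hx); apply: hpar_sign. Qed.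

Lemma supcommE b e x y : hpar b x -> hpar e y -> x * y = (-1) ^+ (b && e) * (y * x).
Proof. by move=> hx hy; rewrite (supcomm _ hx) (hpar_pexpE _ hy) mulrA. Qed.

Lemma signM_comm n x y : x * ((-1) ^+ n * y) = (-1) ^+ n * (x * y).
Proof. by rewrite mulrA commr_sign mulrA. Qed.

Lemma scale_sign n x : ((-1) ^+ n : C) *: x = (-1) ^+ n * x.
Proof. by rewrite -signr_odd scaler_sign -[in RHS]signr_odd mulr_sign. Qed.

End SuperAlgebra.
(** * Products of series in the variables *)

Section Convolution.
Variables (C : numClosedFieldType) (R : supalg C) (A : Type) (par : A -> bool).
Local Notation wp := (wpar par).
Implicit Types (f g h : seq A -> R) (I K : seq A).

(** The product of two series whose Taylor coefficients stand to the right of the variables: [f I1]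
    has to cross the variables of [I2], hence [pexp]. The letters are abstract because the same
    product is used on words of one-forms. *)
Definition wconv f g I : R :=
  \sum_(b : (size I).-tuple bool)
    (let I1 := mask b I in let I2 := mask (map negb b) I in
     (-1) ^+ shuffle_sign par b I * pexp (wp I2) (f I1) * g I2).

(** Homogeneity of total parity [e]: the variables of [K] carry the parity [wp K], the coefficient
    carries the rest. *)
Definition whom (e : bool) f := forall K, hpar (e (+) wp K) (f K).

Definition sder (i : A) f : seq A -> R := fun K => f (i :: K).

Definition unitw (c : R) : seq A -> R := fun K => if K is [::] then c else 0.

Lemma wpar_nil : wp [::] = false. Proof. by []. Qed.

Lemma wpar_cons i K : wp (i :: K) = par i (+) wp K.
Proof. by rewrite /wpar /= oddD oddb. Qed.

Lemma whom_sder e i f : whom e f -> whom (e (+) par i) (sder i f).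
Proof. by move=> hf K; rewrite -addbA -wpar_cons; apply: hf. Qed.

Lemma whom_unitw e c : hpar e c -> whom e (unitw c).
Proof. by move=> hc [|i K] /=; [rewrite addbF|apply: hpar0]. Qed.

Lemma whom_nil e f : whom e f -> hpar e (f [::]).
Proof. by move=> hf; have := hf [::]; rewrite addbF. Qed.

Lemma sum_tupleS n (F : seq bool -> R) :
  \sum_(b : n.+1.-tuple bool) F b =
  \sum_(b : n.-tuple bool) F (true :: b) + \sum_(b : n.-tuple bool) F (false :: b).
Proof.
rewrite (reindex (fun xb : bool * n.-tuple bool => cons_tuple xb.1 xb.2)) /=; last first.
  exists (fun b => (thead b, behead_tuple b)) => [[x b] _|b _] /=.
    by congr pair; apply: val_inj.
  by rewrite [b in RHS]tuple_eta; apply: val_inj.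
rewrite -(pair_big xpredT xpredT (fun x (b : n.-tuple bool) => F (x :: b))) /=.
by rewrite big_bool.
Qed.

Lemma wconv_nil f g : wconv f g [::] = f [::] * g [::].
Proof.
rewrite /wconv (bigD1 [tuple]) //= big1 ?addr0; last by move=> b; rewrite tuple0.
by rewrite mul1r /wpar pexp_false.
Qed.

Lemma eq_wconv f f' g g' I : (forall K, (size K <= size I)%N -> f K = f' K) ->
  (forall K, (size K <= size I)%N -> g K = g' K) ->
  wconv f g I = wconv f' g' I.
Proof.
move=> ff gg; apply: eq_bigr => b _ /=; rewrite ff ?gg //.
  by rewrite size_mask ?size_map ?size_tuple // (leq_trans (count_size _ _)) ?size_map ?size_tuple.
by rewrite size_mask ?size_tuple // (leq_trans (count_size _ _)) ?size_tuple.
Qed.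

(* Graded Leibniz rule; with [wconv_nil] it determines [wconv]. *)
Lemma wconv_cons e f g i I : whom e f ->
  wconv f g (i :: I) = wconv (sder i f) g I + (-1) ^+ (e && par i) * wconv f (sder i g) I.
Proof.
move=> hf; rewrite /wconv.
have := sum_tupleS (size I) (fun b => let I1 := mask b (i :: I) in
    let I2 := mask (map negb b) (i :: I) in
     (-1) ^+ shuffle_sign par b (i :: I) * pexp (wp I2) (f I1) * g I2).
move=> /= ->; congr (_ + _).
rewrite mulr_sumr; apply: eq_bigr => b _.
rewrite wpar_cons (addbC (par i) (wp _)) -pexp_addb !mulrA; congr (_ * _).
have hb := hf (mask b I); rewrite (hpar_pexpE (par i) hb) pexpM pexp_sign mulrA; congr (_ * _).
rewrite -!signr_addb; congr (_ ^+ (nat_of_bool _)).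
by case: (par i); case: (e); case: (wpar _ _); case: (shuffle_sign _ _ _).
Qed.

Lemma wconvDl f f' g I : wconv (fun K => f K + f' K) g I = wconv f g I + wconv f' g I.
Proof. by rewrite -big_split; apply: eq_bigr => b _ /=; rewrite pexpD mulrDr mulrDl. Qed.

Lemma wconvDr f g g' I : wconv f (fun K => g K + g' K) I = wconv f g I + wconv f g' I.
Proof. by rewrite -big_split; apply: eq_bigr => b _ /=; rewrite mulrDr. Qed.

Lemma wconvZl (c : C) f g I : wconv (fun K => c *: f K) g I = c *: wconv f g I.
Proof.
by rewrite scaler_sumr; apply: eq_bigr => b _ /=; rewrite pexpZ -scalerAr -scalerAl.
Qed.

Lemma wconvZr (c : C) f g I : wconv f (fun K => c *: g K) I = c *: wconv f g I.
Proof. by rewrite scaler_sumr; apply: eq_bigr => b _ /=; rewrite -scalerAr. Qed.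

Lemma wconv_suml (T : Type) (s : seq T) (P : pred T) (f : T -> seq A -> R) g I :
  wconv (fun K => \sum_(t <- s | P t) f t K) g I = \sum_(t <- s | P t) wconv (f t) g I.
Proof.
rewrite [RHS]exchange_big; apply: eq_bigr => b _ /=.
by rewrite pexp_sum mulr_sumr mulr_suml.
Qed.

Lemma wconv_sumr (T : Type) (s : seq T) (P : pred T) f (g : T -> seq A -> R) I :
  wconv f (fun K => \sum_(t <- s | P t) g t K) I = \sum_(t <- s | P t) wconv f (g t) I.
Proof.
by rewrite [RHS]exchange_big; apply: eq_bigr => b _ /=; rewrite mulr_sumr.
Qed.

Lemma wconv_signr n f g I : wconv f (fun K => (-1) ^+ n * g K) I = (-1) ^+ n * wconv f g I.
Proof. by rewrite mulr_sumr; apply: eq_bigr => b _ /=; rewrite signM_comm. Qed.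

Lemma wconv_signl n f g I : wconv (fun K => (-1) ^+ n * f K) g I = (-1) ^+ n * wconv f g I.
Proof.
by rewrite mulr_sumr; apply: eq_bigr => b _ /=; rewrite pexpM pexp_sign signM_comm mulrA.
Qed.

Lemma wconv_eq0l f g I : (forall K, (size K <= size I)%N -> f K = 0) -> wconv f g I = 0.
Proof.
move=> f0; rewrite (@eq_wconv f (fun=> 0) g g) // /wconv big1 // => b _ /=.
by rewrite pexp0 mulr0 mul0r.
Qed.

Lemma wconv_eq0r f g I : (forall K, (size K <= size I)%N -> g K = 0) -> wconv f g I = 0.
Proof.
by move=> f0; rewrite (@eq_wconv f f g (fun=> 0)) // /wconv big1 // => b _ /=; rewrite mulr0.
Qed.

(** Every splitting of [I] other than the trivial one hands [f] a shorter word. *)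
Lemma wconv_low f g I : (forall K, (size K < size I)%N -> f K = 0) ->
  wconv f g I = f I * g [::].
Proof.
move=> f0; have hb : size (nseq (size I) true) == size I by rewrite size_nseq.
rewrite /wconv (bigD1 (Tuple hb)) //= map_nseq mask_true // mask_false.
have -> : shuffle_sign par (nseq (size I) true) I = false by elim: (I) => //= i K ->.
rewrite mul1r wpar_nil pexp_false big1 ?addr0 // => b bt; rewrite f0 ?pexp0 ?mulr0 ?mul0r //.
have := count_size id b; rewrite size_tuple size_mask ?size_tuple // ltn_neqAle => ->; rewrite andbT.
apply: contraNneq bt => ct; apply/eqP/val_inj => /=.
have /all_pred1P -> : all (pred1 true) b.
  have : all id b by rewrite all_count ct size_tuple.
  by apply: sub_all => x /= ->.
by rewrite size_tuple.
Qed.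

Lemma sder_wconv e i f g : whom e f ->
  sder i (wconv f g) = fun K => wconv (sder i f) g K + (-1) ^+ (e && par i) * wconv f (sder i g) K.
Proof. by move=> hf; apply: funext => K; apply: wconv_cons. Qed.

Lemma wconv_unitl e c g I : hpar e c ->
  wconv (unitw c) g I = pexp (wp I) c * g I.
Proof.
move=> hc; elim: I g => [|i I IH] g; first by rewrite wconv_nil wpar_nil pexp_false.
rewrite (wconv_cons _ _ _ (whom_unitw hc)) wconv_eq0l // add0r IH mulrA; congr (_ * _).
rewrite wpar_cons -pexp_addb (hpar_pexpE (par i) (hpar_pexp (wp I) hc)).
by rewrite andbC.
Qed.

Lemma wconv1l g I : wconv (unitw 1) g I = g I.
Proof. by rewrite (wconv_unitl _ _ (hpar1 _)) pexp1 mul1r. Qed.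

Lemma wconv1r e f I : whom e f -> wconv f (unitw 1) I = f I.
Proof.
elim: I e f => [|i I IH] e f hf; first by rewrite wconv_nil mulr1.
rewrite (wconv_cons _ _ _ hf) (IH _ _ (whom_sder _ hf)) wconv_eq0r // mulr0 addr0 //.
Qed.

Lemma whom_wconv e1 e2 f g : whom e1 f -> whom e2 g -> whom (e1 (+) e2) (wconv f g).
Proof.
move=> hf hg K; elim: K e1 e2 f g hf hg => [|i K IH] e1 e2 f g hf hg.
  by rewrite wconv_nil wpar_nil addbF; apply: hparM; [apply: whom_nil hf|apply: whom_nil hg].
rewrite (wconv_cons _ _ _ hf) wpar_cons; apply: hparD.
  rewrite (_ : _ (+) _ = (e1 (+) par i) (+) e2 (+) wp K); first by apply: IH => //; apply: whom_sder.
  by case: (e1); case: (e2); case: (par i); case: (wp K).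
apply: hpar_sign; rewrite (_ : _ (+) _ = e1 (+) (e2 (+) par i) (+) wp K).
  by apply: IH => //; apply: whom_sder.
by case: (e1); case: (e2); case: (par i); case: (wp K).
Qed.

(** Both sides obey the same Leibniz recursion in the word. The third factor is kept because it is
    usually a power or the exponential of W; plain commutativity is the case [h = unitw 1]. *)
Lemma wconv_leftC e1 e2 f g h I : whom e1 f -> whom e2 g ->
  wconv f (wconv g h) I = (-1) ^+ (e1 && e2) * wconv g (wconv f h) I.
Proof.
elim: I e1 e2 f g h => [|i I IH] e1 e2 f g h hf hg.
  rewrite !wconv_nil !mulrA; congr (_ * _).
  by rewrite (supcommE (whom_nil hf) (whom_nil hg)) mulrA.
rewrite (wconv_cons _ _ _ hf) (wconv_cons _ _ _ hg).
rewrite (sder_wconv _ _ hf) (sder_wconv _ _ hg) !wconvDr !wconv_signr.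
rewrite (IH _ _ _ _ _ (whom_sder i hf) hg) (IH _ _ _ _ (sder i h) hf hg).
rewrite (IH _ _ _ _ _ (whom_sder i hg) hf) !mulrDr !mulrA -!signr_addb.
rewrite addrCA; congr (_ * _ + (_ * _ + _ * _)); congr (_ ^+ (nat_of_bool _));
  by case: (e1); case: (e2); case: (par i).
Qed.

Lemma wconvA e1 e2 f g h I : whom e1 f -> whom e2 g ->
  wconv f (wconv g h) I = wconv (wconv f g) h I.
Proof.
elim: I e1 e2 f g h => [|i I IH] e1 e2 f g h hf hg.
  by rewrite !wconv_nil mulrA.
have hfg : whom (e1 (+) e2) (wconv f g) by apply: whom_wconv.
rewrite (wconv_cons _ _ _ hf) (wconv_cons _ _ _ hfg).
rewrite (sder_wconv _ _ hf) (sder_wconv _ _ hg) !wconvDr !wconv_signr wconvDl wconv_signl.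
rewrite (IH _ _ _ _ _ (whom_sder i hf) hg) (IH _ _ _ _ _ hf (whom_sder i hg)) (IH _ _ _ _ _ hf hg).
rewrite mulrDr !mulrA -signr_addb addrA; congr (_ + _ + _ * _); congr (_ ^+ (nat_of_bool _)).
by case: (e1); case: (e2); case: (par i).
Qed.

Lemma wconvC e1 e2 f g I : whom e1 f -> whom e2 g ->
  wconv f g I = (-1) ^+ (e1 && e2) * wconv g f I.
Proof.
move=> hf hg; rewrite -(@eq_wconv f _ (wconv g (unitw 1)) g) //; last first.
  by move=> K _; apply: wconv1r hg.
rewrite (wconv_leftC _ _ hf hg) (@eq_wconv g g _ f) // => K _.
exact: wconv1r hf.
Qed.

Lemma sum_triangle (V : nmodType) M (F : nat -> nat -> V) :
  \sum_(j < M.+1) \sum_(k < (M - j).+1) F j k =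
  \sum_(k < M.+1) \sum_(j < (M - k).+1) F j k.
Proof.
have E (G : nat -> nat -> V) : \sum_(j < M.+1) \sum_(k < (M - j).+1) G j k =
    \sum_(j < M.+1) \sum_(k < M.+1 | (j + k <= M)%N) G j k.
  apply: eq_bigr => j _; rewrite (big_ord_widen M.+1) ?ltnS ?leq_subr //.
  by apply: eq_bigl => k; rewrite ltnS leq_subRL // -ltnS.
rewrite E (E (fun j k => F k j)) [RHS](exchange_big_dep xpredT) //=.
by apply: eq_bigr => j _; apply: eq_bigl => k; rewrite addnC.
Qed.

Lemma sum_triangle_diag (V : nmodType) M (F : nat -> nat -> V) :
  \sum_(j < M.+1) \sum_(k < (M - j).+1) F j k =
  \sum_(l < M.+1) \sum_(j < l.+1) F j (l - j)%N.
Proof.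
rewrite [RHS](eq_bigr (fun l : 'I_M.+1 => \sum_(j < M.+1 | (j <= l)%N) F j (l - j)%N)); last first.
  move=> l _; rewrite (big_ord_widen M.+1 (fun j => F j (l - j)%N)) ?ltn_ord //.
rewrite [RHS](exchange_big_dep xpredT) //=; apply: eq_bigr => j _.
rewrite -(big_mkord xpredT (fun k => F j k)).
rewrite -(big_mkord (fun l => (j <= l)%N) (fun l => F j (l - j)%N)).
rewrite [RHS](@big_cat_nat _ _ _ j 0 M.+1) //=; last exact/ltnW/ltn_ord.
rewrite [X in _ = X + _]big_nat_cond [X in _ = X + _]big1 ?add0r; last first.
  by move=> l; case: (leqP j l); rewrite ?(andbF, andbT).
rewrite -(subSn (_ : j <= M)%N) -1?ltnS ?ltn_ord //.
have := big_addn 0 M.+1 j (fun l => j <= l)%N (fun l => F j (l - j)%N).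
rewrite add0n => ->; rewrite [RHS]big_mkcond; apply: eq_bigr => l _.
by rewrite leq_addl addnK.
Qed.

(* A function [nat -> seq A -> R] is a power series in hbar. *)
Definition gwhom e (f : nat -> seq A -> R) := forall M, whom e (f M).

Definition nconv (f g : nat -> seq A -> R) : nat -> seq A -> R :=
  fun M I => \sum_(j < M.+1) wconv (f j) (g (M - j)%N) I.

Implicit Types (X Y U : nat -> seq A -> R).

Lemma nconv_cons e X Y M i I : gwhom e X ->
  nconv X Y M (i :: I) = nconv (fun M => sder i (X M)) Y M I
    + (-1) ^+ (e && par i) * nconv X (fun M => sder i (Y M)) M I.
Proof.
move=> hX; rewrite mulr_sumr -big_split; apply: eq_bigr => j _.
exact: wconv_cons.
Qed.

Lemma gwhom_sder e i X : gwhom e X -> gwhom (e (+) par i) (fun M => sder i (X M)).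
Proof. by move=> hX M; apply: whom_sder. Qed.

Lemma nconv_leftC e1 e2 X Y U M I : gwhom e1 X -> gwhom e2 Y ->
  nconv X (nconv Y U) M I = (-1) ^+ (e1 && e2) * nconv Y (nconv X U) M I.
Proof.
move=> hX hY; rewrite /nconv.
under eq_bigr => j _ do rewrite wconv_sumr.
rewrite [in RHS](eq_bigr (fun k : 'I_M.+1 =>
  \sum_(j < (M - k).+1) wconv (Y k) (wconv (X j) (U (M - k - j)%N)) I)); last first.
  by move=> k _; rewrite wconv_sumr.
rewrite (sum_triangle M (fun j k => wconv (X j) (wconv (Y k) (U (M - j - k)%N)) I)).
rewrite mulr_sumr; apply: eq_bigr => k _; rewrite mulr_sumr; apply: eq_bigr => j _.
by rewrite (wconv_leftC _ _ (hX j) (hY k)) subnAC.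
Qed.

Lemma nconvA e1 e2 X Y U M I : gwhom e1 X -> gwhom e2 Y ->
  nconv X (nconv Y U) M I = nconv (nconv X Y) U M I.
Proof.
move=> hX hY; rewrite /nconv.
under eq_bigr => j _ do rewrite wconv_sumr.
rewrite (sum_triangle_diag M (fun j k => wconv (X j) (wconv (Y k) (U (M - j - k)%N)) I)).
apply: eq_bigr => l _; rewrite wconv_suml; apply: eq_bigr => j _.
rewrite (wconvA _ _ (hX j) (hY _)) -subnDA subnKC //.
by have := ltn_ord j; lia.
Qed.

Lemma eq_nconv X X' Y Y' M I :
  (forall N K, (N <= M)%N -> (size K <= size I)%N -> X N K = X' N K) ->
  (forall N K, (N <= M)%N -> (size K <= size I)%N -> Y N K = Y' N K) ->
  nconv X Y M I = nconv X' Y' M I.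
Proof.
move=> hX hY; apply: eq_bigr => j _; apply: eq_wconv => K hK.
  by apply: hX => //; rewrite -ltnS ltn_ord.
by apply: hY => //; apply: leq_subr.
Qed.

Lemma nconvDl X X' Y M I :
  nconv (fun M K => X M K + X' M K) Y M I = nconv X Y M I + nconv X' Y M I.
Proof. by rewrite -big_split; apply: eq_bigr => j _; apply: wconvDl. Qed.

Lemma nconvZl (c : C) X Y M I : nconv (fun M K => c *: X M K) Y M I = c *: nconv X Y M I.
Proof. by rewrite scaler_sumr; apply: eq_bigr => j _; apply: wconvZl. Qed.

Lemma nconv_suml (T : Type) (s : seq T) (P : pred T) (X : T -> nat -> seq A -> R) Y M I :
  nconv (fun M K => \sum_(t <- s | P t) X t M K) Y M I = \sum_(t <- s | P t) nconv (X t) Y M I.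
Proof. by rewrite [RHS]exchange_big; apply: eq_bigr => j _ /=; apply: wconv_suml. Qed.

Lemma nconv_sumr (T : Type) (s : seq T) (P : pred T) X (Y : T -> nat -> seq A -> R) M I :
  nconv X (fun M K => \sum_(t <- s | P t) Y t M K) M I = \sum_(t <- s | P t) nconv X (Y t) M I.
Proof. by rewrite [RHS]exchange_big; apply: eq_bigr => j _ /=; apply: wconv_sumr. Qed.

Lemma nconvZr (c : C) X Y M I : nconv X (fun M K => c *: Y M K) M I = c *: nconv X Y M I.
Proof. by rewrite scaler_sumr; apply: eq_bigr => j _; apply: wconvZr. Qed.

(* A series with constant term 1 in the variables is invertible. *)
Lemma nconv_inj X U k : (forall M, U M [::] = (M == 0)%N%:R) ->
  (forall M I, (M <= k)%N -> (size I <= k)%N -> nconv X U M I = 0) ->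
  forall M I, (M <= k)%N -> (size I <= k)%N -> X M I = 0.
Proof.
move=> U1 XU M I Mk; have [n] := ubnP (size I); elim: n I M Mk => // n IH I M Mk In Ik.
have := XU M I Mk Ik; rewrite /nconv big_ord_recr /= subnn.
(* By induction [X j] vanishes on shorter words, so only the constant term of [U (M - j)] meets
   [X j I], and it is nonzero for [j = M] alone. *)
have low j : (j <= M)%N -> wconv (X j) (U (M - j)%N) I = X j I * (M == j)%:R.
  move=> jM; rewrite wconv_low => [|K KI]; last by apply: IH; lia.
  by rewrite U1; congr (_ * _%:R); rewrite subn_eq0; have : true by []; lia.
rewrite big1 => [|j _]; last by rewrite low ?gtn_eqF ?mulr0 // ltnW.
by have := low M (leqnn M); rewrite subnn => ->; rewrite eqxx mulr1 add0r.
Qed.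

End Convolution.

(** * The exponential of a series without constant term *)

Section Exponential.
Variables (C : numClosedFieldType) (R : supalg C) (A : Type) (par : A -> bool).
Variable W : nat -> seq A -> R.
Hypotheses (Wev : gwhom par false W) (W0 : forall M, W M [::] = 0).
Local Notation nconv := (@nconv C R A par).

Definition nunit : nat -> seq A -> R := fun M I => if M is 0%N then unitw 1 I else 0.

Definition npow n := iter n (nconv W) nunit.

Lemma npowS n : npow n.+1 = nconv W (npow n). Proof. by []. Qed.

(** An even series commutes with its derivative, so the derivative of a power consists of equal
    terms. *)
Lemma npow_cons n M i I :
  npow n.+1 M (i :: I) = n.+1%:R *: nconv (fun M => sder i (W M)) (npow n) M I.
Proof.
elim: n M I => [|n IH] M I; rewrite npowS (nconv_cons _ _ _ _ Wev) mul1r.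
  rewrite scale1r [X in _ + X]big1 ?addr0 // => j _; apply: wconv_eq0r => K _.
  by rewrite /sder; case: (M - j)%N.
rewrite (_ : (fun M => sder i (npow n.+1 M)) = fun M K =>
  n.+1%:R *: nconv (fun M => sder i (W M)) (npow n) M K); last first.
  by apply: funext => M'; apply: funext => K; rewrite /sder IH.
rewrite nconvZr (nconv_leftC _ _ _ Wev (gwhom_sder i Wev)) mul1r -npowS.
by rewrite -[X in X + _]scale1r -scalerDl -(natrD _ 1).
Qed.

(** As [W] has no constant term, a product of n factors needs words of length at least n. Hence the
    exponential series is finite on each word. *)
Lemma npow_low n M I : (size I < n)%N -> npow n M I = 0.
Proof.
have [k] := ubnP (size I); elim: k n M I => // k IH [//|n] M [|i I] Ik In.
  by rewrite npowS /nconv big1 // => j _; rewrite wconv_nil W0 mul0r.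
rewrite npow_cons [nconv _ _ _ _]big1 ?scaler0 // => j _.
by apply: wconv_eq0r => K KI; apply: IH; move: Ik In => /=; lia.
Qed.

Definition nexp : nat -> seq A -> R :=
  fun M I => \sum_(n < (size I).+1) (n`!%:R)^-1 *: npow n M I.

Lemma nexpE k M I : (size I < k)%N -> nexp M I = \sum_(n < k) (n`!%:R)^-1 *: npow n M I.
Proof.
move=> Ik; rewrite /nexp (big_ord_widen k (fun n => (n`!%:R)^-1 *: npow n M I)) //.
rewrite big_mkcond; apply: eq_bigr => n _; case: ifPn => //.
by rewrite -leqNgt => /npow_low ->; rewrite scaler0.
Qed.

Lemma nexp_nil M : nexp M [::] = (M == 0)%N%:R.
Proof.
by rewrite /nexp big_ord_recl big_ord0 addr0 fact0 invr1 scale1r /npow /= /nunit; case: M.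
Qed.

(** The equation dZ = dW Z. Through it every derivative of Z becomes a multiplication. *)
Lemma nexp_cons M i I : nexp M (i :: I) = nconv (fun M => sder i (W M)) nexp M I.
Proof.
rewrite /nexp /= big_ord_recl.
have -> : npow 0 M (i :: I) = 0 by rewrite /npow /= /nunit; case: M.
rewrite scaler0 add0r.
rewrite (@eq_nconv _ _ _ _ _ (fun M => sder i (W M)) _
   (fun M K => \sum_(n < (size I).+1) (n`!%:R)^-1 *: npow n M K)) //; last first.
  by move=> N K _ KI; apply: nexpE; lia.
rewrite nconv_sumr; apply: eq_bigr => n _.
rewrite lift0 npow_cons nconvZr scalerA factS natrM invfM mulrAC mulVf ?mul1r //.
by rewrite pnatr_eq0.
Qed.

End Exponential.
(** * Operators on Fock space *)

Section Operators.
Variables (C : numClosedFieldType) (R : supalg C) (r : nat).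

Local Notation word := (seq (idx r)).
Local Notation ip := (@ipar r).
Local Notation wp := (wpar (@ipar r)).
Local Notation fock := (int -> word -> R).
Local Notation op := (fock -> fock).

Implicit Types (f g : fock) (X Y A P Q : op) (I : word) (m : int) (i j : idx r).

Definition ohbar (n : int) : op := fun f m I => f (m - n) I.
Definition ocst (c : R) : op := fun f m I => pexp (wp I) c * f m I.
Definition oscale (c : C) : op := fun f m I => c *: f m I.
Definition oadd X Y : op := fun f m I => X f m I + Y f m I.
Definition ozero : op := fun _ _ _ => 0.
Definition oder i : op := fun f m I => f m (i :: I).

Fixpoint omulx_word i (f : word -> R) I : R :=
  if I is j :: I' then
    (i == j)%:R * f I' + (-1) ^+ (ip i && ip j) * omulx_word i (fun K => f (j :: K)) I'
  else 0.

Definition omulx i : op := fun f m I => omulx_word i (f m) I.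

Definition ofsum (T : choiceType) (Y : T -> op) : op :=
  fun f m I => \sum_(t \in [set: T]) Y t f m I.

Definition oad A X : op := fun f m I => A (X f) m I - X (A f) m I.

Definition oexp_conj A X : op := fun f m I =>
  \sum_(n \in [set: nat]) (n`!%:R)^-1 *: iter n (oad A) X f m I.

Definition inbox (N : nat) m I := (- N%:Z <= m) && all (fun i => imode i <= N)%N I.

Definition gsym f := forall m I1 i j I2,
  f m (I1 ++ [:: i, j & I2]) = (-1) ^+ (ip i && ip j) * f m (I1 ++ [:: j, i & I2]).

(* Operators are applied to series with finitely many nonzero coefficients
   in each degree; all infinite sums of operators are then finite. *)
Definition good f := gsym f /\ forall k : nat, exists N : nat, forall m I,
  m <= k%:Z -> (size I <= k)%N -> ~~ inbox N m I -> f m I = 0.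

Definition agree (k : nat) f g := forall m I, m <= k%:Z -> (size I <= k)%N -> f m I = g m I.

Definition lincomb (T : Type) (s : seq T) (c : T -> C) (F : T -> fock) : fock :=
  fun m I => \sum_(t <- s) c t *: F t m I.

(** Locality with loss [c], together with finite linearity, lets [X] pass through sums that are
    finite in each degree. Linearity is asked on good series only, where the sums defining the
    operators are genuine. *)
Record lop (c : nat) X : Prop := Lop_ {
  lop_local : forall k f g, agree (k + c) f g -> agree k (X f) (X g);
  lop_good : forall f, good f -> good (X f);
  lop_lin : forall (T : Type) (s : seq T) (a : T -> C) (F : T -> fock),
    (forall t, good (F t)) -> X (lincomb s a F) = lincomb s a (fun t => X (F t)) }.

(** Outside the good series the convention for infinite sums breaks the algebra of operators, so
    equality is restricted to them. *)
Definition eqop X Y := forall f, good f -> X f = Y f.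

Definition summable (T : choiceType) (F : T -> fock) := forall k : nat,
  exists s : seq T, forall t, t \notin s -> forall m I,
    m <= k%:Z -> (size I <= k)%N -> F t m I = 0.

Lemma inbox_le N N' m I : (N <= N')%N -> inbox N m I -> inbox N' m I.
Proof.
move=> NN /andP[h1 h2]; apply/andP; split; first by lia.
by apply: sub_all h2 => i /leq_trans; apply.
Qed.

Lemma inbox_leN N N' m I : (N <= N')%N -> ~~ inbox N' m I -> ~~ inbox N m I.
Proof. by move=> NN; apply: contra; apply: inbox_le. Qed.

Lemma agree_le k k' f g : (k <= k')%N -> agree k' f g -> agree k f g.
Proof. by move=> kk h m I mk Ik; apply: h; [lia|apply: leq_trans Ik _]. Qed.

Definition rng m I : nat := maxn `|m| (size I).

Lemma rng_m m I : m <= (rng m I)%:Z. Proof. rewrite /rng; lia. Qed.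
Lemma rng_I m I : (size I <= rng m I)%N. Proof. exact: leq_maxr. Qed.

Lemma good_lincomb (T : Type) (s : seq T) (a : T -> C) (F : T -> fock) :
  (forall t, good (F t)) -> good (lincomb s a F).
Proof.
move=> gF; split=> [m I1 i j I2|k].
  rewrite /lincomb mulr_sumr; apply: eq_bigr => t _.
  by have [sF _] := gF t; rewrite sF scalerAr.
elim: s => [|t s [N IH]]; first by exists 0%N => m I _ _ _; rewrite /lincomb big_nil.
have [_ /(_ k) [N' h']] := gF t; exists (maxn N N') => m I mk Ik hb.
rewrite /lincomb big_cons h' ?scaler0 ?add0r //.
  by apply: IH => //; apply: inbox_leN hb; apply: leq_maxl.
by apply: inbox_leN hb; apply: leq_maxr.
Qed.

Lemma good0 : good (fun _ _ => 0).
Proof.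
split=> [m I1 i j I2|k]; first by rewrite mulr0.
by exists 0%N.
Qed.

Lemma lincomb_nil (T : Type) (a : T -> C) (F : T -> fock) : lincomb [::] a F = fun _ _ => 0.
Proof. by apply: funext => m; apply: funext => I; rewrite /lincomb big_nil. Qed.

Lemma lop0 c X : lop c X -> X (fun _ _ => 0) = fun _ _ => 0.
Proof.
move=> lX; have := @lop_lin c X lX unit [::] (fun=> 0) (fun _ _ _ => 0) (fun=> good0).
by rewrite !lincomb_nil.
Qed.

Lemma lopD c X f g : lop c X -> good f -> good g ->
  X (fun m I => f m I + g m I) = fun m I => X f m I + X g m I.
Proof.
move=> lX gf gg.
have := @lop_lin c X lX bool [:: true; false] (fun=> 1) (fun b => if b then f else g).
have E (h : bool -> fock) : lincomb [:: true; false] (fun=> 1) h =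
    fun m I => h true m I + h false m I.
  by apply: funext => m; apply: funext => I; rewrite /lincomb !big_cons big_nil addr0 !scale1r.
by rewrite !E; apply; case.
Qed.

Lemma lopB c X f g : lop c X -> good f -> good g ->
  X (fun m I => f m I - g m I) = fun m I => X f m I - X g m I.
Proof.
move=> lX gf gg.
have := @lop_lin c X lX bool [:: true; false] (fun b => if b then 1 else -1) (fun b => if b then f else g).
have E (h : bool -> fock) : lincomb [:: true; false] (fun b : bool => if b then 1 else -1) h =
    fun m I => h true m I - h false m I.
  apply: funext => m; apply: funext => I.
  by rewrite /lincomb !big_cons big_nil addr0 scale1r scaleN1r.
by rewrite !E; apply; case.
Qed.

Lemma lopZ c X (a : C) f : lop c X -> good f ->
  X (fun m I => a *: f m I) = fun m I => a *: X f m I.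
Proof.
move=> lX gf; have := @lop_lin c X lX unit [:: tt] (fun=> a) (fun=> f).
have E (h : unit -> fock) : lincomb [:: tt] (fun=> a) h = fun m I => a *: h tt m I.
  by apply: funext => m; apply: funext => I; rewrite /lincomb !big_cons big_nil addr0.
by rewrite !E; apply.
Qed.

Lemma goodZ (a : C) f : good f -> good (fun m I => a *: f m I).
Proof.
move=> gf; have := good_lincomb [:: tt] (fun=> a) (fun=> gf).
rewrite (_ : lincomb _ _ _ = fun m I => a *: f m I) //.
by apply: funext => m; apply: funext => I; rewrite /lincomb !big_cons big_nil addr0.
Qed.

Lemma goodD f g : good f -> good g -> good (fun m I => f m I + g m I).
Proof.
move=> gf gg; have := @good_lincomb bool [:: true; false] (fun=> 1) (fun b => if b then f else g).
rewrite (_ : lincomb _ _ _ = fun m I => f m I + g m I); first by apply; case.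
by apply: funext => m; apply: funext => I; rewrite /lincomb !big_cons big_nil addr0 !scale1r.
Qed.

Lemma lop_le c c' X : (c <= c')%N -> lop c X -> lop c' X.
Proof.
move=> cc [h1 h2 h3]; split=> // k f g h; apply: h1; apply: agree_le h; lia.
Qed.

Lemma lop_comp c c' X Y : lop c X -> lop c' Y -> lop (c + c') (X \o Y).
Proof.
move=> [x1 x2 x3] [y1 y2 y3]; split=> [k f g h|f gf|T s a F gF].
- by apply: x1; apply: y1; rewrite -addnA.
- exact/x2/y2.
- by rewrite /= y3 // x3 // => t; apply: y2.
Qed.

Lemma lop_add c X Y : lop c X -> lop c Y -> lop c (oadd X Y).
Proof.
move=> [x1 x2 x3] [y1 y2 y3]; split=> [k f g h m I mk Ik|f gf|T s a F gF].
- by rewrite /oadd (x1 _ _ _ h) // (y1 _ _ _ h).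
- by apply: goodD; [apply: x2|apply: y2].
- apply: funext => m; apply: funext => I; rewrite /oadd x3 // y3 // /lincomb -big_split.
  by apply: eq_bigr => t _; rewrite scalerDr.
Qed.

Lemma lop_scale (a : C) : lop 0 (oscale a).
Proof.
split=> [k f g h m I mk Ik|f gf|T s c F gF].
- by rewrite /oscale h ?addn0.
- exact: goodZ.
- apply: funext => m; apply: funext => I; rewrite /oscale /lincomb scaler_sumr.
  by apply: eq_bigr => t _; rewrite !scalerA mulrC.
Qed.

Lemma lop_zero c : lop c ozero.
Proof.
split=> [//|f _|T s a F _]; first exact: good0.
by apply: funext => m; apply: funext => I; rewrite /lincomb big1 // => t; rewrite /ozero scaler0.
Qed.

Lemma lop_hbar (n : int) : lop `|n|%N (ohbar n).
Proof.
split=> [k f g h m I mk Ik|f [sf gf]|T s a F gF].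
- by apply: h; lia.
- split=> [m|k]; first exact: sf.
  have [N hN] := gf (k + `|n|)%N; exists (N + `|n|)%N => m I mk Ik hb.
  apply: hN; [lia|lia|]; apply: contra hb => /andP[h1 h2]; apply/andP; split; first by lia.
  by apply: sub_all h2 => i /leq_trans; apply; apply: leq_addr.
- by apply: funext => m; apply: funext => I.
Qed.

Lemma lop_cst (c : R) : lop 0 (ocst c).
Proof.
split=> [k f g h m I mk Ik|f [sf gf]|T s a F gF].
- by rewrite /ocst h ?addn0.
- split=> [m I1 i j I2|k].
    rewrite /ocst sf signM_comm; congr (_ * (pexp _ c * _)).
    by rewrite /wpar !count_cat /=; congr odd; lia.
  have [N hN] := gf k; exists N => m I mk Ik hb; by rewrite /ocst hN // mulr0.
- apply: funext => m; apply: funext => I; rewrite /ocst /lincomb mulr_sumr.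
  by apply: eq_bigr => t _; rewrite scalerAr.
Qed.

Lemma lop_der i : lop 1 (oder i).
Proof.
split=> [k f g h m I mk Ik|f [sf gf]|T s a F gF].
- by apply: h => /=; lia.
- split=> [m I1 j1 j2 I2|k]; first by rewrite /oder -!cat_cons sf.
  have [N hN] := gf k.+1; exists N => m I mk Ik hb.
  apply: hN; [lia|by []|]; apply: contra hb => /andP[h1 /= /andP[_ h2]].
  by rewrite /inbox h1.
- by apply: funext => m; apply: funext => I.
Qed.

Lemma eq_omulx_word i (f g : word -> R) I :
  (forall K, (size K <= size I)%N -> f K = g K) -> omulx_word i f I = omulx_word i g I.
Proof.
elim: I f g => //= j I IH f g h; rewrite h //; congr (_ + _ * _).
by apply: IH => K hK; apply: h.
Qed.

Lemma omulx_word_sum i (T : Type) (s : seq T) (a : T -> C) (F : T -> word -> R) I :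
  omulx_word i (fun K => \sum_(t <- s) a t *: F t K) I =
  \sum_(t <- s) a t *: omulx_word i (F t) I.
Proof.
elim: I F => [|j I IH] F /=; first by rewrite big1 // => t; rewrite scaler0.
rewrite (IH (fun t K => F t (j :: K))) !mulr_sumr -big_split; apply: eq_bigr => t _.
by rewrite scalerDr !scalerAr.
Qed.

Lemma omulx_word0 i (f : word -> R) I : (forall K, (size K < size I)%N -> f K = 0) ->
  omulx_word i f I = 0.
Proof.
elim: I f => //= j I IH f h; rewrite h // mulr0 add0r IH ?mulr0 // => K hK.
by apply: h.
Qed.

Lemma omulx_word_box i (f : word -> R) (N N' : nat) I :
  (imode i <= N')%N -> (N <= N')%N ->
  (forall K, (size K <= size I)%N -> ~~ all (fun i => imode i <= N)%N K -> f K = 0) ->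
  ~~ all (fun i => imode i <= N')%N I -> omulx_word i f I = 0.
Proof.
move=> iN NN; elim: I f => //= j I IH f h; rewrite negb_and => /orP[hj|hI].
  have /negbTE -> : i != j by apply: contraNneq hj => <-.
  rewrite mul0r add0r omulx_word0 ?mulr0 // => K hK; apply: h => /=; first by lia.
  by rewrite negb_and; apply/orP; left; apply: contra hj => /leq_trans; apply.
rewrite h //; last by apply: contra hI; apply: sub_all => x /leq_trans; apply.
rewrite mulr0 add0r IH ?mulr0 // => K hK hb; apply: h => //=.
by rewrite negb_and hb orbT.
Qed.

Lemma omulx_word_sign i n (f : word -> R) I :
  omulx_word i (fun K => (-1) ^+ n * f K) I = (-1) ^+ n * omulx_word i f I.
Proof.
elim: I f => [|j I IH] f /=; first by rewrite mulr0.
by rewrite (IH (fun K => f (j :: K))) mulrDr; congr (_ + _); apply: signM_comm.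
Qed.

Lemma omulx_word_sym i (f : word -> R) :
  (forall I1 i1 i2 I2, f (I1 ++ [:: i1, i2 & I2]) =
     (-1) ^+ (ip i1 && ip i2) * f (I1 ++ [:: i2, i1 & I2])) ->
  forall I1 i1 i2 I2, omulx_word i f (I1 ++ [:: i1, i2 & I2]) =
     (-1) ^+ (ip i1 && ip i2) * omulx_word i f (I1 ++ [:: i2, i1 & I2]).
Proof.
move=> sf I1; elim: I1 f sf => [|j I1 IH] f sf i1 i2 I2 /=; last first.
  rewrite sf (IH (fun K => f (j :: K))); last by move=> K; apply: (sf (j :: K)).
  by rewrite mulrDr; congr (_ + _); rewrite signM_comm.
rewrite (_ : (fun K => f [:: i1, i2 & K]) =
   (fun K => (-1) ^+ (ip i1 && ip i2) * f [:: i2, i1 & K])); last first.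
  by apply: funext => K; apply: (sf [::]).
rewrite omulx_word_sign.
case: (eqVneq i i1) => [<-|_]; case: (eqVneq i i2) => [<-|_];
  rewrite ?(mul1r, mul0r, add0r, addr0) //;
  case: (ip i); case: (ip i1); case: (ip i2);
  by rewrite /= ?(expr0, expr1, mul1r, mulN1r, opprK, opprD, mulrN) // addrCA.
Qed.

Lemma lop_mulx i : lop 0 (omulx i).
Proof.
split=> [k f g h m I mk Ik|f [sf gf]|T s a F gF].
- apply: eq_omulx_word => K hK; apply: h; rewrite ?addn0 //; exact: leq_trans hK Ik.
- split=> [m|k]; first exact/omulx_word_sym/sf.
  have [N hN] := gf k; exists (maxn N (imode i)) => m I mk Ik.
  rewrite negb_and => /orP[hm|hI].
    apply: omulx_word0 => K hK; apply: hN; [by []|lia|].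
    by rewrite negb_and; apply/orP; left; move: hm; lia.
  apply: (@omulx_word_box i _ N (maxn N (imode i))) hI; [exact: leq_maxr|exact: leq_maxl|].
  by move=> K hK hb; apply: hN; [by []|lia|rewrite negb_and hb orbT].
- apply: funext => m; apply: funext => I; exact: omulx_word_sum.
Qed.

Lemma summable_list (T : choiceType) (F : T -> fock) : summable F -> forall k,
  exists s : seq T, uniq s /\ forall t, t \notin s -> forall m I,
    m <= k%:Z -> (size I <= k)%N -> F t m I = 0.
Proof.
move=> sF k; have [s hs] := sF k; exists (undup s); split; first exact: undup_uniq.
by move=> t; rewrite mem_undup; apply: hs.
Qed.

Lemma fsum_agree (T : choiceType) (F : T -> fock) k (s : seq T) : uniq s ->
  (forall t, t \notin s -> forall m I, m <= k%:Z -> (size I <= k)%N -> F t m I = 0) ->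
  agree k (fun m I => \sum_(t \in [set: T]) F t m I) (lincomb s (fun=> 1) F).
Proof.
move=> us hs m I mk Ik; rewrite (fsum_seq us) => [|t ts]; last exact: hs.
by apply: eq_bigr => t _; rewrite scale1r.
Qed.

Lemma summable_finsum (T : choiceType) (F : T -> fock) m I : summable F ->
  finsum (fun t => F t m I).
Proof.
move=> sF; have [s hs] := sF (rng m I); exists s => t ts.
by apply: (hs t ts); rewrite ?rng_m ?rng_I.
Qed.

Lemma summable_lincomb (T : choiceType) (U : Type) (s : seq U) (a : U -> C) (F : U -> T -> fock) :
  (forall u, summable (F u)) -> summable (fun t => lincomb s a (fun u => F u t)).
Proof.
move=> sF k; elim: s => [|u s [S hS]]; first by exists [::] => t _ m I _ _; rewrite /lincomb big_nil.
have [S' hS'] := sF u k; exists (S' ++ S) => t; rewrite mem_cat negb_or => /andP[t1 t2] m I mk Ik.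
by rewrite /lincomb big_cons hS' // scaler0 add0r; apply: hS.
Qed.

Lemma good_fsum (T : choiceType) (F : T -> fock) : (forall t, good (F t)) -> summable F ->
  good (fun m I => \sum_(t \in [set: T]) F t m I).
Proof.
move=> gF sF; split=> [m I1 i j I2|k].
  have [s [us hs]] := summable_list sF (rng m (I1 ++ [:: i, j & I2])).
  rewrite !(fsum_agree us hs) ?rng_m ?rng_I //; last by rewrite /rng !size_cat /=; lia.
  by have [-> _] := good_lincomb s (fun=> 1) gF.
have [s [us hs]] := summable_list sF k.
have [_ /(_ k) [N hN]] := good_lincomb s (fun=> 1) gF.
by exists N => m I mk Ik hb; rewrite (fsum_agree us hs) // hN.
Qed.

Lemma lop_fsum c (T : choiceType) (Y : T -> op) : (forall t, lop c (Y t)) ->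
  (forall f, good f -> summable (fun t => Y t f)) -> lop c (ofsum Y).
Proof.
move=> lY sY; split=> [k f g h m I mk Ik|f gf|U s a F gF].
- by apply: eq_fsbigr => t _; apply: (lop_local (lY t) h).
- by apply: good_fsum => [t|]; [apply: lop_good (lY t) _ gf|apply: sY].
- apply: funext => m; apply: funext => I; rewrite /ofsum /lincomb /=.
  have fin u : finsum (fun t => Y t (F u) m I).
    exact: (@summable_finsum _ (fun t => Y t (F u)) m I (sY _ (gF u))).
  rewrite (eq_bigr (fun u => \sum_(t \in [set: T]) a u *: Y t (F u) m I)); last first.
    by move=> u _; rewrite fsumZ.
  rewrite -fsum_sum => [|u]; last exact: finsumZ.
  by apply: eq_fsbigr => t _; rewrite (lop_lin (lY t)).
Qed.

Lemma eq_summable (T : choiceType) (F G : T -> fock) : (forall t, F t = G t) ->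
  summable F -> summable G.
Proof. by move=> FG sF k; have [s hs] := sF k; exists s => t ts m I; rewrite -FG; apply: hs. Qed.

(* Operators act on a sum degree by degree, so they commute with it. *)
Lemma lop_fsumE c X (T : choiceType) (F : T -> fock) : lop c X ->
  (forall t, good (F t)) -> summable F ->
  X (fun m I => \sum_(t \in [set: T]) F t m I) = fun m I => \sum_(t \in [set: T]) X (F t) m I.
Proof.
move=> lX gF sF; apply: funext => m; apply: funext => I.
have [s [us hs]] := summable_list sF (rng m I + c)%N.
rewrite (lop_local lX (fsum_agree us hs)) ?rng_m ?rng_I // (lop_lin lX) //.
rewrite /lincomb (fsum_seq us) => [|t ts].
  by apply: eq_bigr => t _; rewrite scale1r.
have ag : agree (rng m I + c) (F t) (fun _ _ => 0) by move=> m' I' h1 h2; apply: hs.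
by rewrite (lop_local lX ag) ?rng_m ?rng_I // (lop0 lX).
Qed.

Lemma summable_lop c X (T : choiceType) (F : T -> fock) : lop c X -> summable F ->
  summable (fun t => X (F t)).
Proof.
move=> lX sF k; have [s hs] := sF (k + c)%N; exists s => t ts m I mk Ik.
have ag : agree (k + c) (F t) (fun _ _ => 0) by move=> m' I' h1 h2; apply: hs.
by rewrite (lop_local lX ag) // (lop0 lX).
Qed.

Lemma summableD (T : choiceType) (F G : T -> fock) : summable F -> summable G ->
  summable (fun t m I => F t m I + G t m I).
Proof.
move=> sF sG k; have [s hs] := sF k; have [s' hs'] := sG k; exists (s ++ s') => t.
rewrite mem_cat negb_or => /andP[t1 t2] m I mk Ik; by rewrite hs // hs' // addr0.
Qed.

Lemma summableZ (T : choiceType) (a : C) (F : T -> fock) : summable F ->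
  summable (fun t m I => a *: F t m I).
Proof.
by move=> sF k; have [s hs] := sF k; exists s => t ts m I mk Ik; rewrite hs // scaler0.
Qed.

Lemma eqop_refl X : eqop X X. Proof. by []. Qed.
Lemma eqop_sym X Y : eqop X Y -> eqop Y X. Proof. by move=> h f gf; rewrite h. Qed.
Lemma eqop_trans X Y P : eqop X Y -> eqop Y P -> eqop X P.
Proof. by move=> h1 h2 f gf; rewrite h1 // h2. Qed.

Lemma eqop_comp c Y X X' Y' : lop c Y -> eqop X X' -> eqop Y Y' -> eqop (X \o Y) (X' \o Y').
Proof. by move=> lY h1 h2 f gf; rewrite /= h1 ?h2 //; rewrite -h2 //; apply: lop_good lY _ gf. Qed.

Lemma eqop_compl X Y Y' : eqop Y Y' -> eqop (X \o Y) (X \o Y').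
Proof. by move=> h f gf; rewrite /= h. Qed.

Lemma eqop_add X X' Y Y' : eqop X X' -> eqop Y Y' -> eqop (oadd X Y) (oadd X' Y').
Proof. by move=> h1 h2 f gf; rewrite /oadd h1 // h2. Qed.

Lemma eqop_fsum (T : choiceType) (Y Y' : T -> op) : (forall t, eqop (Y t) (Y' t)) ->
  eqop (ofsum Y) (ofsum Y').
Proof.
move=> h f gf; apply: funext => m; apply: funext => I; apply: eq_fsbigr => t _; by rewrite h.
Qed.

(** * Iterated commutators *)

Section Adjoint.
Variables (a : nat) (A : op).
Hypothesis lA : lop a A.

Lemma lop_ad c X : lop c X -> lop (a + c) (oad A X).
Proof.
move=> lX; have l1 := lop_comp lA lX; have := lop_comp lX lA; rewrite addnC => l2.
rewrite (_ : oad A X = oadd (A \o X) (oscale (-1) \o (X \o A))).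
  by apply: lop_add => //; rewrite -[(a + c)%N]add0n; apply: lop_comp => //; apply: lop_scale.
apply: funext => f; apply: funext => m; apply: funext => I.
by rewrite /oad /oadd /= /oscale scaleN1r.
Qed.

Lemma lop_iter_ad n c X : lop c X -> lop (n * a + c) (iter n (oad A) X).
Proof.
move=> lX; elim: n => [|n IH] //=.
by have := lop_ad IH; rewrite addnA -mulSn.
Qed.

Lemma ad_eqop X Y : eqop X Y -> eqop (oad A X) (oad A Y).
Proof.
by move=> h f gf; rewrite /oad h // (h (A f)) //; apply: (lop_good lA).
Qed.

Lemma iter_ad_eqop n X Y : eqop X Y -> eqop (iter n (oad A) X) (iter n (oad A) Y).
Proof. by move=> h; elim: n => //= n IH; apply: ad_eqop. Qed.

Lemma ad_add c X Y : lop c X -> lop c Y ->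
  eqop (oad A (oadd X Y)) (oadd (oad A X) (oad A Y)).
Proof.
move=> lX lY f gf; apply: funext => m; apply: funext => I.
rewrite /oad /oadd (lopD lA) ?opprD 1?addrACA //; first exact: lop_good lX _ gf.
exact: lop_good lY _ gf.
Qed.

Lemma ad_scale c (b : C) X : lop c X ->
  eqop (oad A (oscale b \o X)) (oscale b \o oad A X).
Proof.
move=> lX f gf; apply: funext => m; apply: funext => I.
rewrite /oad /= /oscale (lopZ _ lA) ?scalerBr //; exact: lop_good lX _ gf.
Qed.

Lemma ad_comp c c' X Y : lop c X -> lop c' Y ->
  eqop (oad A (X \o Y)) (oadd (oad A X \o Y) (X \o oad A Y)).
Proof.
move=> lX lY f gf; apply: funext => m; apply: funext => I.
have gYf := lop_good lY gf; have gAf := lop_good lA gf.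
rewrite /oad /oadd /=.
rewrite (lopB lX) ?addrA ?subrK //; first exact: lop_good lA _ gYf.
exact: lop_good lY _ gAf.
Qed.

Lemma ad_fsum c (T : choiceType) (Y : T -> op) : (forall t, lop c (Y t)) ->
  (forall f, good f -> summable (fun t => Y t f)) ->
  eqop (oad A (ofsum Y)) (ofsum (fun t => oad A (Y t))).
Proof.
move=> lY sY f gf; apply: funext => m; apply: funext => I.
have gAf := lop_good lA gf.
have f1 : summable (fun t => A (Y t f)) by apply: summable_lop lA _; apply: sY.
rewrite /oad /ofsum (lop_fsumE lA) => [|t|]; first last.
- exact: sY.
- exact: lop_good (lY t) _ gf.
rewrite fsumD; first last.
- rewrite (_ : (fun t => _) = (fun t => (-1) *: Y t (A f) m I)).
    exact/finsumZ/(@summable_finsum _ (fun t => Y t (A f)) m I (sY _ gAf)).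
  by apply: funext => t; rewrite scaleN1r.
- exact: (@summable_finsum _ (fun t => A (Y t f)) m I f1).
congr (_ + _); rewrite -scaleN1r -fsumZ; first last.
  exact: (@summable_finsum _ (fun t => Y t (A f)) m I (sY _ gAf)).
by apply: eq_fsbigr => t _; rewrite scaleN1r.
Qed.

Lemma summable_ad c (T : choiceType) (Y : T -> op) : (forall t, lop c (Y t)) ->
  (forall f, good f -> summable (fun t => Y t f)) ->
  forall f, good f -> summable (fun t => oad A (Y t) f).
Proof.
move=> lY sY f gf; apply: (@eq_summable _ (fun t m I => A (Y t f) m I + (-1) *: Y t (A f) m I)).
  by move=> t; apply: funext => m; apply: funext => I; rewrite scaleN1r.
apply: summableD; first by apply: summable_lop lA _; apply: sY.
by apply: summableZ; apply: sY; apply: lop_good lA _ gf.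
Qed.

Lemma summable_iter_ad n c (T : choiceType) (Y : T -> op) : (forall t, lop c (Y t)) ->
  (forall f, good f -> summable (fun t => Y t f)) ->
  forall f, good f -> summable (fun t => iter n (oad A) (Y t) f).
Proof.
move=> lY sY; elim: n => [|n IH] //=.
by apply: (@summable_ad (n * a + c)) => // t; apply: lop_iter_ad.
Qed.

Lemma iter_ad_fsum n c (T : choiceType) (Y : T -> op) : (forall t, lop c (Y t)) ->
  (forall f, good f -> summable (fun t => Y t f)) ->
  eqop (iter n (oad A) (ofsum Y)) (ofsum (fun t => iter n (oad A) (Y t))).
Proof.
move=> lY sY; elim: n => [|n IH] //=.
apply: eqop_trans (ad_eqop IH) _; apply: (@ad_fsum (n * a + c)) => [t|].
  exact: lop_iter_ad.
exact: summable_iter_ad.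
Qed.

Definition nilp_ad d X := eqop (iter d (oad A) X) ozero.

Lemma nilp_ad_le d n X : (d <= n)%N -> nilp_ad d X -> eqop (iter n (oad A) X) ozero.
Proof.
move=> dn hd; rewrite -(subnK dn) iterD.
apply: eqop_trans (iter_ad_eqop _ hd) _; elim: (n - d)%N => [|k IH] //=.
apply: eqop_trans (ad_eqop IH) _ => f gf; apply: funext => m; apply: funext => I.
by rewrite /oad /ozero (lop0 lA) subrr.
Qed.

Definition expc d X : op := fun f m I => \sum_(n < d) (n`!%:R)^-1 *: iter n (oad A) X f m I.

Lemma exp_conjE d X : nilp_ad d X -> eqop (oexp_conj A X) (expc d X).
Proof.
move=> hd f gf; apply: funext => m; apply: funext => I.
rewrite /oexp_conj /expc -(big_mkord xpredT (fun n => (n`!%:R)^-1 *: iter n (oad A) X f m I)).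
rewrite (fsum_seq (iota_uniq 0 (d - 0))) // => n; rewrite mem_iota add0n subn0 -leqNgt => dn.
by rewrite (nilp_ad_le dn hd) // scaler0.
Qed.

End Adjoint.

End Operators.

Arguments ozero {C R r}.

(** * Conjugation by the exponential of an operator *)

Section Conjugation.
Variables (C : numClosedFieldType) (R : supalg C) (r : nat).

Local Notation word := (seq (idx r)).
Local Notation fock := (int -> word -> R).
Local Notation op := (fock -> fock).

Implicit Types (f g : fock) (P Q : op) (I : word) (m : int).

Variables (a : nat) (A : op).
Hypothesis lA : lop a A.

Lemma iter_ad_add n c P Q : lop c P -> lop c Q ->
  eqop (iter n (oad A) (oadd P Q)) (oadd (iter n (oad A) P) (iter n (oad A) Q)).
Proof.
move=> lP lQ; elim: n => //= n IH; apply: eqop_trans (ad_eqop lA IH) _.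
by apply: (@ad_add _ _ _ _ _ lA (n * a + c)); apply: lop_iter_ad.
Qed.

Lemma iter_ad_scale n c (b : C) P : lop c P ->
  eqop (iter n (oad A) (oscale b \o P)) (oscale b \o iter n (oad A) P).
Proof.
move=> lP; elim: n => //= n IH; apply: eqop_trans (ad_eqop lA IH) _.
by apply: (@ad_scale _ _ _ _ _ lA (n * a + c)); apply: lop_iter_ad.
Qed.

Lemma nilp_add d c P Q : lop c P -> lop c Q -> nilp_ad A d P -> nilp_ad A d Q ->
  nilp_ad A d (oadd P Q).
Proof.
move=> lP lQ nP nQ; apply: eqop_trans (iter_ad_add _ lP lQ) _ => f gf.
by apply: funext => m; apply: funext => I; rewrite /oadd nP // nQ // /ozero addr0.
Qed.

Lemma nilp_scale d c (b : C) P : lop c P -> nilp_ad A d P -> nilp_ad A d (oscale b \o P).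
Proof.
move=> lP nP; apply: eqop_trans (iter_ad_scale _ _ lP) _ => f gf.
by apply: funext => m; apply: funext => I; rewrite /= /oscale nP // /ozero scaler0.
Qed.

Lemma exp_conj_add d c P Q : lop c P -> lop c Q -> nilp_ad A d P -> nilp_ad A d Q ->
  eqop (oexp_conj A (oadd P Q)) (oadd (oexp_conj A P) (oexp_conj A Q)).
Proof.
move=> lP lQ nP nQ; apply: eqop_trans (exp_conjE lA (nilp_add lP lQ nP nQ)) _.
apply: eqop_trans (eqop_sym (eqop_add (exp_conjE lA nP) (exp_conjE lA nQ))) => f gf.
apply: funext => m; apply: funext => I; rewrite /expc /oadd -big_split.
by apply: eq_bigr => n _; rewrite (iter_ad_add _ lP lQ) // /oadd scalerDr.
Qed.

Lemma exp_conj_scale d c (b : C) P : lop c P -> nilp_ad A d P ->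
  eqop (oexp_conj A (oscale b \o P)) (oscale b \o oexp_conj A P).
Proof.
move=> lP nP; apply: eqop_trans (exp_conjE lA (nilp_scale b lP nP)) _.
move=> f gf; apply: funext => m; apply: funext => I.
rewrite /= /oscale (exp_conjE lA nP) // /expc scaler_sumr.
by apply: eq_bigr => n _; rewrite (iter_ad_scale _ _ lP) //= /oscale !scalerA mulrC.
Qed.

Lemma nilp_fsum d c (T : choiceType) (Y : T -> op) : (forall t, lop c (Y t)) ->
  (forall f, good f -> summable (fun t => Y t f)) ->
  (forall t, nilp_ad A d (Y t)) -> nilp_ad A d (ofsum Y).
Proof.
move=> lY sY nY; apply: eqop_trans (iter_ad_fsum lA d lY sY) _ => f gf.
by apply: funext => m; apply: funext => I; apply: fsbig1 => t _; rewrite nY.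
Qed.

Lemma exp_conj_fsum d c (T : choiceType) (Y : T -> op) : (forall t, lop c (Y t)) ->
  (forall f, good f -> summable (fun t => Y t f)) ->
  (forall t, nilp_ad A d (Y t)) ->
  eqop (oexp_conj A (ofsum Y)) (ofsum (fun t => oexp_conj A (Y t))).
Proof.
move=> lY sY nY; apply: eqop_trans (exp_conjE lA (nilp_fsum lY sY nY)) _ => f gf.
apply: funext => m; apply: funext => I; rewrite /expc /ofsum.
have fin n : finsum (fun t => iter n (oad A) (Y t) f m I).
  exact: (@summable_finsum _ _ _ _ (fun t => iter n (oad A) (Y t) f) m I (summable_iter_ad lA n lY sY gf)).
rewrite (eq_bigr (fun n : 'I_d => \sum_(t \in [set: T]) ((n`!)%:R)^-1 *: iter n (oad A) (Y t) f m I)).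
  rewrite -fsum_sum => [|n]; last exact: finsumZ.
  by apply: eq_fsbigr => t _; rewrite (exp_conjE lA (nY t)).
by move=> n _; rewrite fsumZ // (iter_ad_fsum lA n lY sY).
Qed.

Lemma summable_exp_conj d c (T : choiceType) (Y : T -> op) : (forall t, lop c (Y t)) ->
  (forall f, good f -> summable (fun t => Y t f)) ->
  (forall t, nilp_ad A d (Y t)) ->
  forall f, good f -> summable (fun t => oexp_conj A (Y t) f).
Proof.
move=> lY sY nY f gf.
apply: (@eq_summable _ _ _ _ (fun t => lincomb (index_iota 0 d) (fun n => (n`!%:R)^-1)
    (fun n => iter n (oad A) (Y t) f))); last first.
  by apply: summable_lincomb => n; apply: (summable_iter_ad lA n lY sY gf).
move=> t; rewrite (exp_conjE lA (nY t)) //.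
by apply: funext => m; apply: funext => I; rewrite /lincomb /expc big_mkord.
Qed.

(* [X n] is the n-th iterated commutator of [X 0] with [A]. *)
Record tower (c : nat) (X : nat -> op) : Prop := Tower {
  tower_lop : forall n, lop c (X n);
  tower_ad : forall n, eqop (oad A (X n)) (X n.+1);
  tower3 : forall n, (3 <= n)%N -> eqop (X n) ozero }.

(** The conjugate of [X 0] by the exponential of A: the commutator series stops after its quadratic
    term. *)
Definition tower_sum (X : nat -> op) : op :=
  fun f => lincomb (iota 0 3) (fun n => (n`!%:R)^-1) (fun n => X n f).

Lemma lop_tower_sum c X : tower c X -> lop c (tower_sum X).
Proof.
move=> tX; rewrite (_ : tower_sum X = oadd (X 0%N) (oadd (X 1%N) (oscale 2^-1 \o X 2%N))).
  have l2 := lop_comp (lop_scale R r 2^-1) (tower_lop tX 2).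
  by apply: lop_add (tower_lop tX 0) (lop_add (tower_lop tX 1) l2).
apply: funext => f; apply: funext => m; apply: funext => I.
rewrite /tower_sum /lincomb !big_cons big_nil /oadd /= /oscale addr0.
by rewrite !(fact0, factS) !muln1 !invr1 !scale1r.
Qed.

Lemma ad_lincomb c (T : Type) (s : seq T) (u : T -> C) (Y : T -> op) :
  (forall t, lop c (Y t)) ->
  eqop (oad A (fun f => lincomb s u (fun t => Y t f)))
       (fun f => lincomb s u (fun t => oad A (Y t) f)).
Proof.
move=> lY f gf; apply: funext => m; apply: funext => I.
rewrite /oad (lop_lin lA) => [|t]; last exact: lop_good (lY t) _ gf.
rewrite /lincomb -sumrB; apply: eq_bigr => t _; by rewrite scalerBr.
Qed.

Section Product.
Variables (c c' : nat) (X Y : nat -> op).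
Hypotheses (tX : tower c X) (tY : tower c' Y).

(** Combinations of the nine products of the levels 0, 1, 2 of two towers. The coefficients are
    natural numbers, so that iterated commutators reduce to evaluating an array. *)
Definition tcomb (u : nat -> nat -> nat) : op := fun f m I =>
  \sum_(i < 3) \sum_(j < 3) (u i j)%:R *: X i (Y j f) m I.

(** The Leibniz rule on coefficient arrays. It is the Pascal recursion: n steps from [delta00] give
    the binomial coefficients on the diagonal i + j = n. *)
Definition tshift (u : nat -> nat -> nat) i j : nat :=
  ((if i is i'.+1 then u i' j else 0) + (if j is j'.+1 then u i j' else 0))%N.

Lemma tcombE u : tcomb u = fun f => lincomb [seq (i, j) | i <- iota 0 3, j <- iota 0 3]
  (fun ij => (u ij.1 ij.2)%:R) (fun ij => X ij.1 (Y ij.2 f)).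
Proof.
apply: funext => f; apply: funext => m; apply: funext => I.
by rewrite /tcomb /lincomb !big_ord_recl !big_ord0 /= !big_cons big_nil !addr0 /= !addrA.
Qed.

Lemma tcomb_ad u : eqop (oad A (tcomb u)) (tcomb (tshift u)).
Proof.
rewrite tcombE => f gf; apply: funext => m; apply: funext => I.
have lXY (ij : nat * nat) : lop (c + c') (X ij.1 \o Y ij.2).
  by apply: lop_comp; [apply: tower_lop tX _|apply: tower_lop tY _].
rewrite (ad_lincomb _ _ lXY) //.
pose v i j := X i (Y j f) m I.
have v3l j : v 3 j = 0 by rewrite /v (tower3 tX) //; apply: lop_good (tower_lop tY j) _ gf.
have v3r i : v i 3 = 0 by rewrite /v (tower3 tY) // (lop0 (tower_lop tX i)).
have V (ij : nat * nat) : oad A (X ij.1 \o Y ij.2) f m I = v ij.1.+1 ij.2 + v ij.1 ij.2.+1.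
  rewrite (ad_comp lA (tower_lop tX _) (tower_lop tY _)) // /oadd /=.
  rewrite (tower_ad tX) ?(tower_ad tY) //; exact: lop_good (tower_lop tY _) _ gf.
rewrite /lincomb /tcomb; under eq_bigr => ij _ do rewrite V scalerDr.
rewrite -/(v _ _) !big_cons big_nil /= !big_ord_recl !big_ord0 /= -!/(v _ _).
rewrite /tshift !(addn0, add0n) !natrD !scalerDl !scale0r !v3l !v3r !scaler0 !(addr0, add0r).
rewrite !addrA [LHS](ACl (2*4*1*3*7*5*9*6*8*11*10*12)) //.
Qed.

Let delta00 i j : nat := ((i == 0) && (j == 0))%N.

Lemma comp_tcomb : (X 0%N \o Y 0%N) = tcomb delta00.
Proof.
apply: funext => f; apply: funext => m; apply: funext => I.
by rewrite /tcomb !big_ord_recl !big_ord0 /= !scale0r !addr0 scale1r.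
Qed.

Lemma tcomb_iter n : eqop (iter n (oad A) (X 0%N \o Y 0%N)) (tcomb (iter n tshift delta00)).
Proof.
rewrite comp_tcomb; elim: n => //= n IH.
exact: eqop_trans (ad_eqop lA IH) (tcomb_ad _).
Qed.

(** Five commutators shared between two factors put at least three on one of them. *)
Lemma nilp_comp : nilp_ad A 5 (X 0%N \o Y 0%N).
Proof.
apply: eqop_trans (tcomb_iter 5) _ => f gf; apply: funext => m; apply: funext => I.
by rewrite /tcomb !big_ord_recl !big_ord0 /= !scale0r !addr0.
Qed.

(** Conjugation is given only as a commutator series, so its multiplicativity has to be read off
    from the coefficients. *)
Lemma exp_conj_comp :
  eqop (oexp_conj A (X 0%N \o Y 0%N)) (tower_sum X \o tower_sum Y).
Proof.
apply: eqop_trans (exp_conjE lA nilp_comp) _ => f gf.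
apply: funext => m; apply: funext => I.
have -> : (tower_sum X \o tower_sum Y) f m I =
    \sum_(i < 3) \sum_(j < 3) ((i`!%:R)^-1 * (j`!%:R)^-1) *: X i (Y j f) m I.
  rewrite /= /tower_sum {1}/lincomb -[iota 0 3]/(index_iota 0 3) big_mkord.
  apply: eq_bigr => i _; rewrite (lop_lin (tower_lop tX i)) => [|t]; last first.
    exact: lop_good (tower_lop tY t) _ gf.
  by rewrite /lincomb big_mkord scaler_sumr; apply: eq_bigr => j _; rewrite scalerA.
rewrite /expc; under eq_bigr => n _ do rewrite tcomb_iter // /tcomb scaler_sumr.
rewrite exchange_big; apply: eq_bigr => i _.
under eq_bigr => n _ do rewrite scaler_sumr.
rewrite exchange_big; apply: eq_bigr => j _.
under eq_bigr => n _ do rewrite scalerA.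
rewrite -scaler_suml; congr (_ *: _).
have nz n : n.+1%:R != 0 :> C by rewrite pnatr_eq0.
(* Only n = i + j contributes, and the binomial coefficient of n over i, divided by n!, is 1 / (i!
   j!). *)
case: i => [[|[|[|i]]] // hi]; case: j => [[|[|[|j]]] // hj];
  rewrite !big_ord_recl big_ord0 /= /tshift /= /delta00 /bump /= ?(addn0, add0n) ?(mulr0, addr0, add0r);
  rewrite !(fact0, factS) ?muln1 /=; field; rewrite ?nz //.
Qed.

End Product.
End Conjugation.
(** * Modes and their conjugates *)

Section Oscillators.
Variables (C : numClosedFieldType) (R : supalg C) (r : nat).

Local Notation word := (seq (idx r)).
Local Notation fock := (int -> word -> R).
Local Notation op := (fock -> fock).
Local Notation ip := (@ipar r).
Local Notation wp := (wpar (@ipar r)).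

Implicit Types (f g : fock) (I : word) (m : int) (s t : oneform r).

Definition oJ (a : 'I_r) (k : int) : op :=
  match k with
  | Posz 0 => ozero
  | Posz k'.+1 => @ohbar C R r 1 \o oder (inl (a, k'))
  | Negz k' => oscale (k'.+1)%:R \o ohbar 1 \o omulx (inl (a, k'))
  end.

Definition oGamma (a : 'I_r) (k : int) : op :=
  match k with
  | Posz 0 => @ohbar C R r 1 \o oadd (oscale 2^-1 \o omulx (inr (a, 0%N))) (oder (inr (a, 0%N)))
  | Posz k => ohbar 1 \o oder (inr (a, k))
  | Negz k' => ohbar 1 \o omulx (inr (a, k'.+1))
  end.

(** Bosonic and fermionic modes are indexed by the same triples as the local one-forms, since each
    mode will be matched with the form of opposite index. *)
Definition osc s : op := if s.1.2 then oGamma s.1.1 s.2 else oJ s.1.1 s.2.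

(* [osc s] is hbar (osc_x s x^i + osc_d s d/dx^i) with i = osc_i s. *)
Definition osc_i s : idx r :=
  if s.1.2 then inr (s.1.1, `|s.2|%N) else inl (s.1.1, `|s.2|.-1%N).

Definition osc_x s : C :=
  if s.1.2 then (if s.2 == 0 then 2^-1 else if s.2 < 0 then 1 else 0)
  else if s.2 < 0 then `|s.2|%N%:R else 0.

Definition osc_d s : C :=
  if s.1.2 then (0 <= s.2)%R%:R else (0 < s.2)%R%:R.

Lemma ipar_osc_i s : ip (osc_i s) = fpar s.
Proof. by case: s => [[a []] k]. Qed.

Lemma oscE s f m I : osc s f m I =
  osc_x s *: omulx_word (osc_i s) (f (m - 1)) I + osc_d s *: f (m - 1) (osc_i s :: I).
Proof.
by case: s => [[a []] [[|k]|k]] //=; rewrite /osc /osc_x /osc_d /= /oadd /= /oscale /ohbar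
  /omulx /oder /ozero /= ?scale0r ?scale1r ?addr0 ?add0r.
Qed.

Lemma lop_osc s : lop 2 (osc s).
Proof.
rewrite (_ : osc s = ohbar 1 \o oadd (oscale (osc_x s) \o omulx (osc_i s)) (oscale (osc_d s) \o oder (osc_i s))).
  apply: (@lop_comp _ _ _ 1 1); first exact: (@lop_hbar C R r 1).
  apply: lop_add; last exact: (@lop_comp _ _ _ 0 1 _ _ (lop_scale _ _ _) (lop_der _ _)).
  apply: (@lop_le _ _ _ (0 + 0)) => //; apply: lop_comp; [exact: lop_scale|exact: lop_mulx].
apply: funext => f; apply: funext => m; apply: funext => I; exact: oscE.
Qed.

Lemma omulx_wordD i (f g : word -> R) I :
  omulx_word i (fun K => f K + g K) I = omulx_word i f I + omulx_word i g I.
Proof.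
elim: I f g => [|j I IH] f g /=; first by rewrite addr0.
by rewrite (IH (fun K => f (j :: K))) !mulrDr addrACA.
Qed.

Lemma omulx_wordZ i (c : C) (f : word -> R) I :
  omulx_word i (fun K => c *: f K) I = c *: omulx_word i f I.
Proof.
elim: I f => [|j I IH] f /=; first by rewrite scaler0.
by rewrite (IH (fun K => f (j :: K))) scalerDr -!scalerAr.
Qed.

Lemma omulx_wordC i j (f : word -> R) I :
  omulx_word i (omulx_word j f) I = (-1) ^+ (ip i && ip j) * omulx_word j (omulx_word i f) I.
Proof.
elim: I f => [|l I IH] f /=; first by rewrite mulr0.
rewrite !omulx_wordD !omulx_word_sign (IH (fun K => f (l :: K))).
have E i' j' : omulx_word i' (fun K => (j' == l)%:R * f K) I = (j' == l)%:R * omulx_word i' f I.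
  case: (j' == l); first by rewrite mul1r; apply: eq_omulx_word => K _; rewrite mul1r.
  rewrite mul0r omulx_word0 // => K _; exact: mul0r.
rewrite !E !mulrDr !mulrA addrCA.
case: (eqVneq i l) => [->|_]; case: (eqVneq j l) => [->|_];
  case: (ip l) => //=; case: (ip i); case: (ip j);
  by rewrite /= ?(expr0, expr1, mulrN1, mulN1r, mulr1, mul1r, mulrN, mulNr, opprK, mul0r, mulr0,
     oppr0, add0r, addr0).
Qed.

(* The supercommutator of [osc s] and [osc t] is [pair s t] times hbar^2. *)
Definition pair s t : C :=
  if (s.1 == t.1) && (s.2 == - t.2) then (if s.1.2 then 1 else s.2%:~R) else 0.

Lemma pairE s t : pair s t =
  (osc_i s == osc_i t)%:R *
  (osc_d s * osc_x t - (-1) ^+ (fpar s && fpar t) * (osc_x s * osc_d t)).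
Proof.
case: s => [[a e] k]; case: t => [[b e'] l].
have E (x y : bool) : (x = y) -> x%:R = y%:R :> C by move=> ->.
have inlE (x y : 'I_r * nat) : (inl x == inl y :> idx r) = (x == y) by [].
have inrE (x y : 'I_r * nat) : (inr x == inr y :> idx r) = (x == y) by [].
rewrite /pair /osc_i /osc_x /osc_d /fpar /= xpair_eqE.
case: e; case: e' => /=; rewrite ?andbF ?mul0r // andbT ?inlE ?inrE xpair_eqE;
 (case: (a == b) => /=; last by rewrite mul0r);
 case: k => [[|k]|k]; case: l => [[|l]|l]; rewrite ?NegzE ?oppr0 ?opprK ?abszN /=;
 rewrite ?(mul0r, mulr0, mul1r, mulr1, add0r, addr0, subr0, sub0r, oppr0, expr0, expr1, mulN1r, mulr0n, opprK) //.
(* The zero mode of [oGamma] pairs with itself, with 1/2 from either order. *)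
- by field.
- by rewrite eqz_nat; case: eqP.
- by rewrite eqr_opp eqz_nat; case: eqP.
- by rewrite eqz_nat eqSS; case: eqP => [->|_]; rewrite ?mul1r ?mul0r // pmulrn.
- by rewrite eqr_opp eqz_nat eqSS; case: eqP => [->|_]; rewrite ?mul1r ?mul0r // nmulrn.
Qed.

(** Multiplications exchange by [omulx_wordC] and derivatives by the graded symmetry of [f]; only a
    derivative meeting its own variable leaves a constant. *)
Lemma osc_comm s t f m I : good f ->
  osc s (osc t f) m I = (-1) ^+ (fpar s && fpar t) * osc t (osc s f) m I + pair s t *: f (m - 2) I.
Proof.
move=> [sf _]; rewrite pairE !oscE.
have m2 : m - 1 - 1 = m - 2 by lia.
have E s' t' K : omulx_word (osc_i s') (osc t' f (m - 1)) K =
    osc_x t' *: omulx_word (osc_i s') (omulx_word (osc_i t') (f (m - 2))) K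
    + osc_d t' *: omulx_word (osc_i s') (fun K => f (m - 2) (osc_i t' :: K)) K.
  rewrite -!omulx_wordZ -omulx_wordD; apply: eq_omulx_word => K' _; by rewrite oscE m2.
rewrite !E m2 /= !ipar_osc_i.
rewrite (omulx_wordC (osc_i s)) !ipar_osc_i.
have sy : f (m - 2) [:: osc_i t, osc_i s & I] =
    (-1) ^+ (fpar s && fpar t) * f (m - 2) [:: osc_i s, osc_i t & I].
  by rewrite (sf _ [::]) !ipar_osc_i andbC.
rewrite sy (andbC (fpar t)) !(scalerDr, mulrDr).
set e := fpar s && fpar t; set S := (-1) ^+ e : R.
have SZ c x : S * (c *: x) = c *: (S * x) by rewrite scalerAr.
have SS x : S * (S * x) = x by rewrite mulrA -signr_addb addbb mul1r.
rewrite (eq_sym (osc_i t)); set d : C := (osc_i s == osc_i t)%:R.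
have dE x : (osc_i s == osc_i t)%:R * x = d *: x by rewrite /d scaler_nat mulr_natl.
have SE x : S * x = (-1) ^+ e *: x by rewrite scale_sign.
rewrite !dE !SZ !SS !SE !scalerA.
set X := omulx_word _ _ I; set Y := omulx_word _ _ I; set F := f _ _.
set X' := omulx_word _ _ I; set G := f _ _.
rewrite (mulrC (osc_x t) (osc_x s)) (mulrC (osc_x t) (osc_d s)) (mulrC (osc_d t) (osc_d s)).
rewrite (mulrC (osc_d t) (osc_x s)) scalerDl mulrN scaleNr (mulrC d (osc_d s * _)).
rewrite (_ : d * _ = osc_x s * osc_d t * d * (-1) ^+ e); last by ring.
set P := _ *: F; rewrite -[LHS](addrK P) !addrA [LHS](ACl (1*4*6*2*5*3*7)) //=.
Qed.

Lemma omulx_word_cst b c i (h : word -> R) I : hpar b c ->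
  omulx_word i (fun K => pexp (wp K) c * h K) I =
  (-1) ^+ (b && ip i) * (pexp (wp I) c * omulx_word i h I).
Proof.
move=> hc; elim: I h => [|j I IH] h /=; first by rewrite !mulr0.
have E K : pexp (wp (j :: K)) c = (-1) ^+ (b && ip j) * pexp (wp K) c.
  by rewrite wpar_cons -pexp_addb (hpar_pexpE (ip j) (hpar_pexp (wp K) hc)) andbC.
rewrite (@eq_omulx_word _ _ _ _ _ (fun K => (-1) ^+ (b && ip j) * (pexp (wp K) c * h (j :: K)))); last first.
  by move=> K _; rewrite E mulrA.
rewrite omulx_word_sign (IH (fun K => h (j :: K))) E !mulrDr; congr (_ + _).
  have [->|_] := eqVneq i j; last by rewrite !mul0r !mulr0.
  by rewrite !mul1r !mulrA -signr_addb addbb mul1r.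
set s1 := b && ip i; set s2 := b && ip j; set s3 := ip i && ip j.
set x := omulx_word _ _ _.
rewrite [X in _ = _ * X]signM_comm.
by rewrite !mulrA -!signr_addb; congr (_ ^+ (nat_of_bool _) * _ * _); case: s1; case: s2; case: s3.
Qed.

Lemma ocst_osc b c s f m I : hpar b c ->
  ocst c (osc s f) m I = (-1) ^+ (b && fpar s) * osc s (ocst c f) m I.
Proof.
move=> hc; rewrite /ocst !oscE (omulx_word_cst _ _ _ hc) ipar_osc_i wpar_cons ipar_osc_i.
rewrite -pexp_addb (hpar_pexpE (fpar s) (hpar_pexp (wp I) hc)) (andbC (fpar s)).
rewrite !mulrDr -!scalerAr; congr (_ + _); congr (_ *: _);
  by rewrite !mulrA -!signr_addb addbb !mul1r.
Qed.

Lemma ocst_ocst c c' f : ocst c (ocst c' f) = ocst (c * c') f.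
Proof.
by apply: funext => m; apply: funext => I; rewrite /ocst pexpM mulrA.
Qed.

Lemma ohbar_ocst n c f : ohbar n (ocst c f) = ocst c (ohbar n f). Proof. by []. Qed.

Lemma osc_ohbar n s f : osc s (ohbar n f) = ohbar n (osc s f).
Proof.
apply: funext => m; apply: funext => I; rewrite /ohbar !oscE.
by rewrite (_ : m - n - 1 = m - 1 - n) //; lia.
Qed.

Lemma osc_scale a s f : osc s (oscale a f) = oscale a (osc s f).
Proof.
apply: funext => m; apply: funext => I; rewrite /oscale !oscE omulx_wordZ scalerDr !scalerA.
by rewrite !(mulrC a).
Qed.

Lemma osc_sign n s f : osc s (fun m I => (-1) ^+ n * f m I) = fun m I => (-1) ^+ n * osc s f m I.
Proof.
apply: funext => m; apply: funext => I.
by rewrite !oscE omulx_word_sign mulrDr !scalerAr.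
Qed.

Lemma oscD s f g : osc s (fun m I => f m I + g m I) = fun m I => osc s f m I + osc s g m I.
Proof.
apply: funext => m; apply: funext => I.
by rewrite !oscE omulx_wordD !scalerDr addrACA.
Qed.

(** The summands of log T and, in [oquad], of log Phi. The constant acts before the modes, as in the
    exponents of T and Phi. *)
Definition olin s (M : R) : op := ohbar (-2) \o osc s \o ocst M.

Definition oquad s s' (M : R) : op := ohbar (-2) \o osc s \o osc s' \o ocst M.

Lemma lop_olin s M : lop 4 (olin s M).
Proof.
apply: (@lop_comp _ _ _ 4 0); last exact: lop_cst.
by apply: (@lop_comp _ _ _ 2 2); [apply: (@lop_hbar C R r (-2))|apply: lop_osc].
Qed.

Lemma lop_oquad s s' M : lop 6 (oquad s s' M).
Proof.
apply: (@lop_comp _ _ _ 6 0); last exact: lop_cst.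
apply: (@lop_comp _ _ _ 4 2); last exact: lop_osc.
by apply: (@lop_comp _ _ _ 2 2); [apply: (@lop_hbar C R r (-2))|apply: lop_osc].
Qed.

Lemma ad_olin s t M f m I : good f -> hpar (fpar s) M ->
  oad (olin s M) (osc t) f m I = (-1) ^+ (fpar s && fpar t) * (pair s t *: ocst M f m I).
Proof.
move=> gf hM; rewrite /oad /olin /= osc_ohbar /ohbar.
have gMf : good (ocst M f) by apply: lop_good (lop_cst _ _) _ gf.
have -> : ocst M (osc t f) = fun m I => (-1) ^+ (fpar s && fpar t) * osc t (ocst M f) m I.
  by apply: funext => m'; apply: funext => I'; rewrite (ocst_osc _ _ _ _ hM).
rewrite osc_sign osc_comm // mulrDr mulrA -signr_addb addbb mul1r addrAC subrr add0r.
by rewrite (_ : m - -2 - 2 = m) //; lia.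
Qed.

(** One contraction with each of the two oscillators; the uncontracted terms cancel. *)
Lemma ad_oquad s s' t M f m I : good f -> hpar (fpar s (+) fpar s') M ->
  oad (oquad s s' M) (osc t) f m I =
  (-1) ^+ ((fpar s (+) fpar s') && fpar t) *
    (pair s' t *: osc s (ocst M f) m I
     + (-1) ^+ (fpar s' && fpar t) * (pair s t *: osc s' (ocst M f) m I)).
Proof.
move=> gf hM; rewrite /oad /oquad /= osc_ohbar /ohbar.
set g := ocst M f; have gg : good g by apply: lop_good (lop_cst _ _) _ gf.
have gs' : good (osc s' g) by apply: lop_good (lop_osc _) _ gg.
have -> : ocst M (osc t f) = fun m I => (-1) ^+ ((fpar s (+) fpar s') && fpar t) * osc t g m I.
  by apply: funext => m'; apply: funext => I'; rewrite (ocst_osc _ _ _ _ hM).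
rewrite !osc_sign.
have -> : osc s' (osc t g) = fun m I => (-1) ^+ (fpar s' && fpar t) * osc t (osc s' g) m I
    + pair s' t *: ohbar 2 g m I.
  by apply: funext => m'; apply: funext => I'; rewrite osc_comm.
rewrite oscD osc_sign.
have -> : osc s (fun m I => pair s' t *: ohbar 2 g m I) = oscale (pair s' t) (osc s (ohbar 2 g)).
  by rewrite -osc_scale.
have mm : m - -2 - 2 = m by lia.
rewrite osc_comm // osc_ohbar /oscale /ohbar mm.
rewrite !mulrDr !mulrA -!signr_addb.
rewrite (_ : (_ && _) (+) (_ && _) (+) (_ && _) = false); last first.
  by case: (fpar s); case: (fpar s'); case: (fpar t).
rewrite mul1r -!addrA [LHS]addrC -!addrA addNr addr0 addrC.
by congr (_ + _ * _); congr (_ ^+ (nat_of_bool _)); case: (fpar s); case: (fpar s'); case: (fpar t).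
Qed.

End Oscillators.

(** * The operator log T and its commutators with the modes *)

Section SpectralOperators.
Variables (C : numClosedFieldType) (R : supalg C) (r : nat).

Local Notation word := (seq (idx r)).
Local Notation fock := (int -> word -> R).
Local Notation op := (fock -> fock).
Local Notation ip := (@ipar r).
Local Notation wp := (wpar (@ipar r)).

Implicit Types (f g : fock) (I : word) (m : int) (s u : oneform r) (i j : idx r).

(** The mode acting as hbar d/dx^i. For i = (a, F, 0) it also multiplies by x^i / 2, the source of
    all zero mode corrections. *)
Definition ann i : oneform r :=
  match i with inl (a, k) => (a, false, k.+1%:Z) | inr (a, k) => (a, true, k%:Z) end.

Lemma osc_i_ann i : osc_i (ann i) = i.
Proof. by case: i => [[a k]|[a k]]. Qed.

Lemma fpar_ann i : fpar (ann i) = ip i.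
Proof. by case: i => [[a k]|[a k]]. Qed.

Lemma ann_mode i : (ann i).2 = imode i.
Proof. by case: i => [[a k]|[a k]]. Qed.

Lemma pair_ann0 i u : i != osc_i u -> pair C (ann i) u = 0.
Proof. by move=> h; rewrite pairE osc_i_ann (negbTE h) mul0r. Qed.

(** A mode of positive index only differentiates, and beyond N its variable is absent from the
    series in the given degree. *)
Lemma osc_far f : good f -> forall k : nat, exists N : nat, forall s M m I, N%:Z < s.2 ->
  m <= k%:Z -> (size I <= k)%N -> osc s (ocst M f) m I = 0.
Proof.
move=> [_ gf] k; have [N hN] := gf k.+1; exists N.+1 => s M m I hs mk Ik.
rewrite oscE /osc_x /osc_d (_ : (s.2 == 0) = false); last by lia.
rewrite (_ : (s.2 < 0) = false) ?if_same ?scale0r ?add0r; last by lia.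
rewrite /ocst hN ?mulr0 ?scaler0 //=; first by lia.
rewrite /inbox /= negb_and; apply/orP; right; rewrite negb_and; apply/orP; left.
by rewrite /osc_i; case: s.1.2 => /=; lia.
Qed.

Lemma osc0 s : osc s (fun _ _ => 0 : R) = fun _ _ => 0.
Proof. exact: (lop0 (@lop_osc C R r s)). Qed.

Lemma olin_ocst b c s M f : hpar b c -> hpar (fpar s) M ->
  olin s M (ocst c f) = ocst c (olin s M f).
Proof.
move=> hc hM; apply: funext => m; apply: funext => I.
rewrite /olin /= -ohbar_ocst /ohbar (ocst_osc _ _ _ _ hc) !ocst_ocst.
rewrite (_ : ocst (M * c) f = fun m I => (-1) ^+ (fpar s && b) * ocst (c * M) f m I).
  by rewrite osc_sign andbC.
apply: funext => m'; apply: funext => I'.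
by rewrite (supcommE hM hc) /ocst (pexpM _ ((-1) ^+ _)) pexp_sign mulrA.
Qed.

Lemma oquad_ocst b c s s' M f : hpar b c -> hpar (fpar s (+) fpar s') M ->
  oquad s s' M (ocst c f) = ocst c (oquad s s' M f).
Proof.
move=> hc hM; apply: funext => m; apply: funext => I.
rewrite /oquad /= -ohbar_ocst /ohbar (ocst_osc _ _ _ _ hc).
rewrite (_ : ocst c (osc s' (ocst M f)) =
  fun m I => (-1) ^+ (b && fpar s') * osc s' (ocst c (ocst M f)) m I); last first.
  by apply: funext => m'; apply: funext => I'; rewrite (ocst_osc _ _ _ _ hc).
rewrite osc_sign !ocst_ocst (supcommE hM hc) mulrA -signr_addb.
rewrite (_ : ocst ((-1) ^+ _ * _) f =
  fun m I => (-1) ^+ ((fpar s (+) fpar s') && b) * ocst (c * M) f m I); last first.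
  by apply: funext => m'; apply: funext => I'; rewrite /ocst (pexpM _ ((-1) ^+ _)) pexp_sign mulrA.
rewrite !osc_sign; congr (_ ^+ (nat_of_bool _) * _).
by case: (b); case: (fpar s); case: (fpar s').
Qed.

Section LogT.
Variables (t tau : 'I_r -> int -> R).
Hypotheses (t_even : forall a k, hpar false (t a k)) (tau_odd : forall a k, hpar true (tau a k)).
Hypothesis t0 : forall a, t a 0 = 0.
Hypothesis mero : exists N : int, forall a k, k < N -> t a k = 0 /\ tau a k = 0.

Definition ologT : op := fun f m I =>
  \sum_a \sum_(k \in [set: int])
    ohbar (-2) (fun m I =>
       (k%:~R)^-1 *: oJ a k (ocst (t a k) f) m I
       - oGamma a k (ocst (tau a k) f) m I) m I.

Definition sympT (p : 'I_r * int) : op :=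
  oadd (oscale (p.2%:~R)^-1 \o olin (p.1, false, p.2) (t p.1 p.2))
       (oscale (-1) \o olin (p.1, true, p.2) (tau p.1 p.2)).

Lemma lop_sympT p : lop 4 (sympT p).
Proof.
by apply: lop_add; apply: (@lop_comp _ _ _ 0 4);
  [exact: lop_scale|exact: lop_olin|exact: lop_scale|exact: lop_olin].
Qed.

Lemma olin0 s f : olin s 0 f = fun _ _ => 0.
Proof.
rewrite /olin /= (_ : ocst 0 f = fun _ _ => 0) ?osc0 //.
by apply: funext => m; apply: funext => I; rewrite /ocst pexp0 mul0r.
Qed.

(** For very negative k the coefficients of omega_{0,1} vanish, for large k the modes annihilate the
    series. *)
Lemma summable_sympT f : good f -> summable (fun p => sympT p f).
Proof.
move=> gf k; have [N hN] := osc_far gf (k + 2)%N; have [N' hN'] := mero.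
pose K := (N + `|N'|)%N.
exists [seq (a, z - K%:Z) | a <- enum 'I_r, z <- map Posz (iota 0 (K + K).+1)] => -[a l] hl m I mk Ik.
have {}hl : l < - K%:Z \/ K%:Z < l.
  case: (boolP ((- K%:Z <= l) && (l <= K%:Z))) => h; last by lia.
  case/negP: hl; apply/allpairsP; exists (a, l + K%:Z); rewrite mem_enum addrK; split=> //.
  apply/mapP; exists (absz (l + K%:Z)); [rewrite mem_iota|]; move: h => /=; lia.
rewrite /sympT /oadd /= /oscale; case: hl => hl.
  have [-> ->] : t a l = 0 /\ tau a l = 0 by apply: hN'; lia.
  by rewrite !olin0 !scaler0 addr0.
by rewrite /olin /= /ohbar !hN ?scaler0 ?addr0 //=; lia.
Qed.

Lemma ologTE : eqop ologT (ofsum sympT).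
Proof.
move=> f gf; apply: funext => m; apply: funext => I; rewrite /ofsum.
have fin := @summable_finsum _ _ _ _ (fun p => sympT p f) m I (summable_sympT gf).
rewrite fsum_pair_fst // fsum_fin; apply: eq_bigr => a _; apply: eq_fsbigr => k _.
by rewrite /sympT /oadd /= /oscale scaleN1r.
Qed.

Lemma lop_ologT : lop 4 (ofsum sympT).
Proof. apply: lop_fsum; [exact: lop_sympT|exact: summable_sympT]. Qed.

Definition om01 s : R := if s.1.2 then tau s.1.1 s.2 else t s.1.1 s.2.

Definition fneg s : oneform r := (s.1, - s.2).

(** Obtained from [ad_fsum] by antisymmetry of the commutator. *)
Lemma ad_fsuml c (T : choiceType) (Y : T -> op) X d : lop d X -> (forall t, lop c (Y t)) ->
  (forall f, good f -> summable (fun t => Y t f)) ->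
  eqop (oad (ofsum Y) X) (ofsum (fun t => oad (Y t) X)).
Proof.
move=> lX lY sY f gf; apply: funext => m; apply: funext => I.
have := congr1 (fun h => h m I) (ad_fsum lX lY sY gf).
rewrite /oad /ofsum => /(congr1 (fun x => - x)); rewrite opprB => ->.
have fin := @summable_finsum _ _ _ _ _ m I (summable_ad lX lY sY gf).
rewrite -scaleN1r -(fsumZ _ fin); apply: eq_fsbigr => x _.
by rewrite scaleN1r /oad opprB.
Qed.

(** Only the mode opposite to [u] contracts with it. For J_{a,k} the pairing k cancels the 1/k of
    log T; for Gamma the minus sign in log T cancels the sign of two odd modes crossing. *)
Lemma ad_ologT u : eqop (oad (ofsum sympT) (osc u)) (ocst (om01 (fneg u))).
Proof.
case: u => [[b e] l]; set u := (b, e, l).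
have h := ad_fsuml (@lop_osc C R r u) lop_sympT summable_sympT.
apply: eqop_trans h _ => f gf.
apply: funext => m; apply: funext => I; rewrite /ofsum.
have E p : oad (sympT p) (osc u) f m I =
   (p.2%:~R)^-1 *: (pair C (p.1, false, p.2) u *: ocst (t p.1 p.2) f m I)
   - (-1) ^+ fpar u * (pair C (p.1, true, p.2) u *: ocst (tau p.1 p.2) f m I).
  have h1 := @ad_olin _ _ _ (p.1, false, p.2) u _ _ m I gf (t_even p.1 p.2).
  have h2 := @ad_olin _ _ _ (p.1, true, p.2) u _ _ m I gf (tau_odd p.1 p.2).
  have hD X Y : osc u (oadd X Y f) m I = osc u (X f) m I + osc u (Y f) m I.
    by rewrite (_ : oadd X Y f = fun m I => X f m I + Y f m I) // oscD.
  rewrite mul1r in h1; rewrite -h1 -[(-1) ^+ fpar u]/((-1) ^+ (true && fpar u)) -h2 /oad /sympT hD.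
  rewrite /= !osc_scale /oadd /= /oscale !scaleN1r scalerBr !opprD !opprK addrACA.
  by congr (_ + _); rewrite addrC.
rewrite (@fsum1 _ _ _ _ (b, - l)) ?E //.
  rewrite /u; case: (e); rewrite /pair /om01 /fneg /fpar /= !xpair_eqE !eqxx ?andbF /= ?eqxx.
    by rewrite scale0r scaler0 add0r scale1r mulN1r opprK.
  (* At [l = 0] the factor 1/k of log T is 0 by convention, which agrees with t_{a,0} = 0. *)
  rewrite scale0r mulr0 subr0; have [->|l0] := eqVneq l 0.
    by rewrite oppr0 t0 /ocst pexp0 mul0r !scaler0.
  by rewrite scalerA mulVf ?scale1r // intr_eq0 oppr_eq0.
move=> [a k] hp; rewrite E /pair /u /= !xpair_eqE.
have -> b1 : (a == b) && b1 && (k == - l) = false.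
  by apply: contraNF hp => /andP[/andP[/eqP -> _] /eqP ->].
have -> b1 : (a == b) && b1 && (k == - l) = false.
  by apply: contraNF hp => /andP[/andP[/eqP -> _] /eqP ->].
by rewrite !scale0r scaler0 mulr0 subr0.
Qed.

Lemma sympT_ocst b c p f : hpar b c -> sympT p (ocst c f) = ocst c (sympT p f).
Proof.
move=> hc; apply: funext => m; apply: funext => I.
rewrite /sympT /oadd /= !(olin_ocst _ hc) //= /oscale.
by rewrite [in RHS]/ocst mulrDr -!scalerAr.
Qed.

Lemma ologT_ocst b c : hpar b c -> eqop (oad (ofsum sympT) (ocst c)) ozero.
Proof.
move=> hc; apply: eqop_trans (ad_fsuml (@lop_cst C R r c) lop_sympT summable_sympT) _ => f gf.
apply: funext => m; apply: funext => I; apply: fsbig1 => p _.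
by rewrite /oad (sympT_ocst _ _ hc) subrr.
Qed.

Lemma hpar_om01 s : hpar (fpar s) (om01 s).
Proof. by case: s => [[a []] k]; [apply: tau_odd|apply: t_even]. Qed.

Definition towT u (n : nat) : op :=
  match n with 0%N => osc u | 1%N => ocst (om01 (fneg u)) | _ => ozero end.

Lemma ad_zero a A : @lop C R r a A -> eqop (oad A ozero) ozero.
Proof.
move=> lA f gf; apply: funext => m; apply: funext => I.
by rewrite /oad /ozero (lop0 lA) subrr.
Qed.

Lemma tower_towT u : tower (ofsum sympT) 2 (towT u).
Proof.
split=> [[|[|n]]|[|[|n]]|[|[|[|n]]]] //=.
- exact: lop_osc.
- by apply: lop_le (lop_cst _ _).
- exact: lop_zero.
- exact: ad_ologT.
- exact: ologT_ocst (hpar_om01 _).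
- exact: ad_zero lop_ologT.
Qed.

End LogT.
End SpectralOperators.

Arguments ann {r} i : simpl never.

(** * The operator log Phi and its commutators with the modes *)

Section LogPhi.
Variables (C : numClosedFieldType) (R : supalg C) (r : nat).

Local Notation word := (seq (idx r)).
Local Notation fock := (int -> word -> R).
Local Notation op := (fock -> fock).
Local Notation ip := (@ipar r).
Local Notation wp := (wpar (@ipar r)).
Local Notation ann := (@ann r).

Implicit Types (f g : fock) (I : word) (m : int) (s u : oneform r) (i j : idx r).

Definition idxs (N : nat) : seq (idx r) :=
  [seq inl (a, k) | a <- enum 'I_r, k <- iota 0 N]
  ++ [seq inr (a, k) | a <- enum 'I_r, k <- iota 0 N.+1].

Lemma mem_idxs N i : (i \in idxs N) = (imode i <= N)%N.
Proof.
rewrite mem_cat; case: i => [[a k]|[a k]]; apply/orP/idP.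
- by case=> /allpairsP[[b l]] [_ h] // [_ ->]; move: h; rewrite mem_iota.
- by move=> h; left; apply/allpairsP; exists (a, k); rewrite mem_enum mem_iota.
- by case=> /allpairsP[[b l]] [_ h] // [_ ->]; move: h; rewrite mem_iota.
- by move=> h; right; apply/allpairsP; exists (a, k); rewrite mem_enum mem_iota.
Qed.

Lemma uniq_idxs N : uniq (idxs N).
Proof.
rewrite cat_uniq !allpairs_uniq ?enum_uniq ?iota_uniq //.
- rewrite andbT; apply/hasPn => i /allpairsP[[a k] [_ _ ->]].
  by apply/negP => /allpairsP[[b l] []].
- by move=> [a k] [b l] _ _ /= [-> ->].
- by move=> [a k] [b l] _ _ /= [-> ->].
Qed.

Lemma sum_idxs (V : nmodType) N (G : idx r -> V) : \sum_(i <- idxs N) G i =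
  \sum_a \sum_(k <- iota 0 N) G (inl (a, k)) + \sum_a \sum_(k <- iota 0 N.+1) G (inr (a, k)).
Proof. by rewrite big_cat !big_allpairs_dep !big_enum. Qed.

Lemma sum_iotaS (V : nmodType) N (G : nat -> V) :
  \sum_(k <- iota 0 N.+1) G k = G 0%N + \sum_(k <- iota 0 N) G k.+1.
Proof. by rewrite -[iota 0 N.+1]/(0%N :: iota (1 + 0) N) big_cons iotaDl big_map. Qed.

Lemma fsum_idxs (V : nmodType) N (G : idx r -> V) : (forall i, (N < imode i)%N -> G i = 0) ->
  \sum_(i \in [set: idx r]) G i = \sum_(i <- idxs N) G i.
Proof.
by move=> h; apply: fsum_seq (uniq_idxs N) _ => i; rewrite mem_idxs -ltnNge; apply: h.
Qed.

(** A mode of large index kills the series when it acts first. An outer one is moved inside: two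
    annihilation modes supercommute unless both have index 0. *)
Lemma oquad_far f : good f -> forall k : nat, exists N : nat, forall i j M m I,
  (N < imode i)%N || (N < imode j)%N ->
  m <= k%:Z -> (size I <= k)%N -> oquad (ann i) (ann j) M f m I = 0.
Proof.
move=> gf k; have [N hN] := osc_far gf (k + 4)%N; exists N => i j M m I.
set g := ocst M f; have gg : good g by apply: lop_good (@lop_cst C R r _) _ gf.
have far i' j' m' I' : (N < imode j')%N -> m' <= k%:Z -> (size I' <= k)%N ->
    osc (ann i') (osc (ann j') g) (m' + 2) I' = 0.
  move=> hj mk Ik.
  have ag : agree (k + 2 + 2) (osc (ann j') g) (fun _ _ => 0).
    by move=> m1 I1 h1 h2; apply: hN; [rewrite ann_mode; lia|lia|lia].
  by rewrite (lop_local (@lop_osc C R r _) ag) ?osc0 //; lia.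
rewrite /oquad /= /ohbar opprK -/g.
case: (ltnP N (imode j)) => [hj _ mk Ik|hj]; first exact: far.
rewrite orbF => hi mk Ik; rewrite osc_comm // far // mulr0 add0r /pair !ann_mode.
by rewrite (_ : (_ == _ :> int) = false) ?andbF ?scale0r //; apply/negbTE/eqP; lia.
Qed.

Variables (B phi V : 'I_r -> 'I_r -> nat -> nat -> R).
Hypotheses (B_even : forall a b k l, hpar false (B a b k l))
  (phi_odd : forall a b k l, hpar true (phi a b k l))
  (V_even : forall a b k l, hpar false (V a b k l))
  (V_00 : forall a b, V a b 0 0 = 0)
  (B_sym : forall a b k l, B a b k l = B b a l k)
  (V_antisym : forall a b k l, V a b k l = - V b a l k).

Definition ologPhi : op := fun f m I =>
  2^-1 *: \sum_a \sum_b \sum_(kl \in [set: nat * nat])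
    (let: (k, l) := kl in
     ohbar (-2) (fun m I =>
       (k%:R * l%:R)^-1 *: oJ a k (oJ b l (ocst (B a b k l) f)) m I
       - (2 / k%:R) *: oJ a k (oGamma b l (ocst (phi a b k l) f)) m I
       + oGamma a k (oGamma b l (ocst (V a b k l) f)) m I) m I).

(** The graded-symmetric matrix of the quadratic form log Phi, up to the factor 1/2 and hbar^(-2).
    The mixed term -2 J Gamma phi / k is split evenly between the two orders of its factors;
    [inl (a, k)] has mode k + 1. *)
Definition Mx i j : R :=
  match i, j with
  | inl (a, k), inl (b, l) => (k.+1%:R * l.+1%:R)^-1 *: B a b k.+1 l.+1
  | inl (a, k), inr (b, l) => - (k.+1%:R)^-1 *: phi a b k.+1 l
  | inr (b, l), inl (a, k) => - (k.+1%:R)^-1 *: phi a b k.+1 l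
  | inr (a, k), inr (b, l) => V a b k l
  end.

Lemma hpar_Mx i j : hpar (ip i (+) ip j) (Mx i j).
Proof.
by case: i => [[a k]|[a k]]; case: j => [[b l]|[b l]] //=; do ?apply: hparZ.
Qed.

Lemma Mx_sym i j : Mx j i = (-1) ^+ (ip i && ip j) * Mx i j.
Proof.
case: i => [[a k]|[a k]]; case: j => [[b l]|[b l]] /=; rewrite ?mul1r //.
  by rewrite B_sym mulrC.
by rewrite V_antisym mulN1r.
Qed.

Definition symPhi (p : idx r * idx r) : op := oquad (ann p.1) (ann p.2) (Mx p.1 p.2).

Lemma summable_symPhi f : good f -> summable (fun p => symPhi p f).
Proof.
move=> gf k; have [N hN] := oquad_far gf k.
exists [seq (i, j) | i <- idxs N, j <- idxs N] => -[i j] hp m I mk Ik.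
apply: hN => //; rewrite !ltnNge -negb_and; apply: contra hp => /andP[h1 h2].
by apply: allpairs_f; rewrite mem_idxs.
Qed.

Lemma lop_symPhi p : lop 6 (symPhi p). Proof. exact: lop_oquad. Qed.

Definition oPhi : op := oscale 2^-1 \o ofsum symPhi.

Lemma lop_Phi : lop 6 (ofsum symPhi).
Proof. by apply: lop_fsum; [move=> p; apply: lop_oquad|apply: summable_symPhi]. Qed.

Lemma lop_oPhi : lop 6 oPhi.
Proof. exact: lop_comp (lop_scale R r 2^-1) lop_Phi. Qed.

Lemma oquadZ s u c M f m I : oquad s u (c *: M) f m I = c *: oquad s u M f m I.
Proof.
rewrite /oquad /= (_ : ocst (c *: M) f = oscale c (ocst M f)) ?osc_scale //.
by apply: funext => m'; apply: funext => I'; rewrite /ocst /oscale pexpZ -scalerAl.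
Qed.

Lemma oquad_swap i j M f m I : good f -> ip i != ip j ->
  oquad (ann j) (ann i) M f m I = oquad (ann i) (ann j) M f m I.
Proof.
move=> gf hij; have gg : good (ocst M f) by apply: lop_good (@lop_cst C R r _) _ gf.
rewrite /oquad /= /ohbar osc_comm // !fpar_ann.
rewrite pair_ann0 ?scale0r ?addr0; last first.
  by rewrite osc_i_ann; apply: contraNneq hij => ->.
by move: hij; case: (ip i); case: (ip j); rewrite ?mul1r.
Qed.

Lemma ologPhiE : eqop ologPhi oPhi.
Proof.
move=> f gf; apply: funext => m; apply: funext => I; congr (_ *: _).
have [N hN] := oquad_far gf (rng m I).
have {}hN i j M : (N < imode i)%N || (N < imode j)%N -> oquad (ann i) (ann j) M f m I = 0.
  by move=> h; apply: hN; rewrite ?rng_m ?rng_I.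
pose h i j M := oquad (ann i) (ann j) M f m I.
(* The terms of log Phi at (k, l) rewritten as terms of [oPhi]: those with a mode J_{a,0} vanish,
   and the mixed term of weight 2 is shared by both orders of its factors. *)
pose F a b k l : R :=
  (if (k, l) is (k'.+1, l'.+1) then h (inl (a, k')) (inl (b, l')) (Mx (inl (a, k')) (inl (b, l'))) else 0)
  + (if k is k'.+1 then h (inl (a, k')) (inr (b, l)) (Mx (inl (a, k')) (inr (b, l)))
       + h (inr (b, l)) (inl (a, k')) (Mx (inr (b, l)) (inl (a, k'))) else 0)
  + h (inr (a, k)) (inr (b, l)) (Mx (inr (a, k)) (inr (b, l))).
rewrite /ofsum (@fsum_pair_seq _ _ _ _ _ (idxs N) (idxs N)) ?uniq_idxs //; last first.
  by move=> i j; rewrite !mem_idxs -!ltnNge => hij; apply: hN.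
rewrite (eq_bigr (fun a => \sum_b \sum_(k <- iota 0 N.+1) \sum_(l <- iota 0 N.+1) F a b k l)); last first.
  move=> a _; apply: eq_bigr => b _.
  rewrite (eq_fsbigr (fun kl : nat * nat => F a b kl.1 kl.2)); last first.
    move=> [k l] _; rewrite /F /ohbar /=; congr (_ + _ + _).
    - case: k => [|k]; first by rewrite scaler0.
      case: l => [|l]; first by rewrite mulr0 invr0 scale0r.
      by rewrite /h /= oquadZ.
    - case: k => [|k]; first by rewrite scaler0 oppr0.
      rewrite /h !oquadZ (@oquad_swap (inl (a, k)) (inr (b, l))) // -scalerDl -opprD -mulr2n scaleNr mulr_natl //.
  rewrite (@fsum_pair_seq _ _ nat nat (fun kl => F a b kl.1 kl.2) (iota 0 N.+1) (iota 0 N.+1)) ?iota_uniq // => k l.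
  rewrite !mem_iota -!leqNgt !add0n /F /h => hkl.
  case: k hkl => [|k']; case: l => [|l'] hkl; rewrite /= !hN ?addr0 //=; lia.
pose G i j := h i j (Mx i j).
have FE a b : \sum_(k <- iota 0 N.+1) \sum_(l <- iota 0 N.+1) F a b k l =
    \sum_(k <- iota 0 N) \sum_(l <- iota 0 N) G (inl (a, k)) (inl (b, l))
    + (\sum_(k <- iota 0 N) \sum_(l <- iota 0 N.+1) G (inl (a, k)) (inr (b, l))
       + \sum_(k <- iota 0 N) \sum_(l <- iota 0 N.+1) G (inr (b, l)) (inl (a, k)))
    + \sum_(k <- iota 0 N.+1) \sum_(l <- iota 0 N.+1) G (inr (a, k)) (inr (b, l)).
  rewrite /F; under eq_bigr => k _ do rewrite !big_split.
  rewrite !big_split /=; congr (_ + _ + _); rewrite sum_iotaS big1 ?add0r //.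
    by apply: eq_bigr => k _; rewrite sum_iotaS add0r.
  by rewrite -big_split; apply: eq_bigr => k _; rewrite -big_split.
under eq_bigr => a _ do under eq_bigr => b _ do rewrite FE.
have sumE i : \sum_(j <- idxs N) symPhi (i, j) f m I =
    \sum_b \sum_(l <- iota 0 N) G i (inl (b, l)) + \sum_b \sum_(l <- iota 0 N.+1) G i (inr (b, l)).
  by rewrite sum_idxs.
under [RHS]eq_bigr => i _ do rewrite sumE.
rewrite sum_idxs.
under [X in _ = X + _]eq_bigr => a _ do rewrite big_split.
under [X in _ = _ + X]eq_bigr => a _ do rewrite big_split.
rewrite !big_split /=.
under eq_bigr => a _ do rewrite !big_split.
rewrite !big_split /= -!addrA; congr (_ + _).
  by apply: eq_bigr => a _; rewrite exchange_big.
congr (_ + _); first by apply: eq_bigr => a _; rewrite exchange_big.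
congr (_ + _).
  rewrite exchange_big; apply: eq_bigr => b _ /=; rewrite [RHS]exchange_big /=.
  by apply: eq_bigr => a _; rewrite exchange_big.
by apply: eq_bigr => a _; rewrite exchange_big.
Qed.

(* Coefficients of the commutator of log Phi with [osc u]. *)
Definition cPhi u i : R :=
  pair C (ann (osc_i u)) u *: ((-1) ^+ (ip i (+) fpar u) * Mx i (osc_i u)).

Definition annih (c : idx r -> R) : op := ofsum (fun i => ocst (c i) \o osc (ann i)).

Lemma lop_annih_term (c : idx r -> R) i : lop 2 (ocst (c i) \o osc (ann i)).
Proof. by apply: (@lop_comp _ _ _ 0 2); [apply: lop_cst|apply: lop_osc]. Qed.

Lemma ocst1 f : ocst 1 f = f.
Proof. by apply: funext => m; apply: funext => I; rewrite /ocst pexp1 mul1r. Qed.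

Lemma ann_far f : good f -> forall k : nat, exists N : nat, forall i m I,
  (N < imode i)%N -> m <= k%:Z -> (size I <= k)%N -> osc (ann i) f m I = 0.
Proof.
move=> gf k; have [N hN] := osc_far gf k; exists N => i m I hi mk Ik.
by rewrite -(ocst1 f); apply: hN => //; rewrite ann_mode; lia.
Qed.

Lemma summable_annih c f : good f -> summable (fun i => (ocst (c i) \o osc (ann i)) f).
Proof.
move=> gf k; have [N hN] := ann_far gf k; exists (idxs N) => i hi m I mk Ik.
by rewrite /= /ocst hN ?mulr0 //; move: hi; rewrite mem_idxs -ltnNge.
Qed.

Lemma lop_annih c : lop 2 (annih c).
Proof. by apply: lop_fsum; [move=> i; apply: lop_annih_term|apply: summable_annih]. Qed.

Lemma annihD c c' f : good f ->
  annih (fun i => c i + c' i) f = fun m I => annih c f m I + annih c' f m I.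
Proof.
move=> gf; apply: funext => m; apply: funext => I; rewrite /annih /ofsum -fsumD.
- by apply: eq_fsbigr => i _; rewrite /= /ocst pexpD mulrDl.
- exact: (@summable_finsum _ _ _ _ (fun i => (ocst (c i) \o osc (ann i)) f) m I (summable_annih c gf)).
- exact: (@summable_finsum _ _ _ _ (fun i => (ocst (c' i) \o osc (ann i)) f) m I (summable_annih c' gf)).
Qed.

(** By the graded symmetry of [Mx] both contractions give the same sum, which cancels the factor 1/2
    of log Phi. *)
Lemma ad_oPhi u : eqop (oad oPhi (osc u)) (annih (cPhi u)).
Proof.
move=> f gf; apply: funext => m; apply: funext => I.
have gu : good (osc u f) by apply: lop_good (@lop_osc C R r _) _ gf.
have -> : oad oPhi (osc u) f m I = 2^-1 *: oad (ofsum symPhi) (osc u) f m I.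
  by rewrite /oad /oPhi /= osc_scale /oscale scalerBr.
have h := ad_fsuml (@lop_osc C R r u) lop_symPhi summable_symPhi.
rewrite [oad _ _ f]h // {h}.
pose e := fpar u.
pose X p : R := (-1) ^+ ((ip p.1 (+) ip p.2) && e) *
   (pair C (ann p.2) u *: osc (ann p.1) (ocst (Mx p.1 p.2) f) m I).
pose Y p : R := (-1) ^+ (((ip p.1 (+) ip p.2) && e) (+) (ip p.2 && e)) *
   (pair C (ann p.1) u *: osc (ann p.2) (ocst (Mx p.1 p.2) f) m I).
have XYE p : oad (symPhi p) (osc u) f m I = X p + Y p.
  rewrite /symPhi ad_oquad // ?fpar_ann; last exact: hpar_Mx.
  by rewrite mulrDr mulrA -signr_addb.
have [N hN] := osc_far gf (rng m I).
have oN i M : (N < imode i)%N -> osc (ann i) (ocst M f) m I = 0.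
  by move=> hi; apply: hN; rewrite ?rng_m ?rng_I // ann_mode; lia.
pose j0 := osc_i u.
have Xfin : finsum X.
  exists [seq (i, j) | i <- idxs N, j <- [:: j0]] => -[i j] hp.
  rewrite /X /=; have [jj|jj] := eqVneq j j0; last by rewrite (pair_ann0 C jj) scale0r mulr0.
  rewrite oN ?scaler0 ?mulr0 // ltnNge; apply: contra hp => hi.
  by apply: allpairs_f; rewrite ?mem_idxs // inE jj.
have Yfin : finsum Y.
  exists [seq (i, j) | i <- [:: j0], j <- idxs N] => -[i j] hp.
  rewrite /Y /=; have [jj|jj] := eqVneq i j0; last by rewrite (pair_ann0 C jj) scale0r mulr0.
  rewrite oN ?scaler0 ?mulr0 // ltnNge; apply: contra hp => hi.
  by apply: allpairs_f; rewrite ?mem_idxs // inE jj.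
rewrite /ofsum (eq_fsbigr (fun p => X p + Y p)) => [|p _]; last exact: XYE.
rewrite fsumD // (fsum_pair_fst Xfin) (fsum_pair_snd Yfin).
have ipj0 : ip j0 = e by rewrite ipar_osc_i.
have XE i : \sum_(j \in [set: idx r]) X (i, j) = X (i, j0).
  by apply: fsum1 => j jj; rewrite /X /= (pair_ann0 C jj) scale0r mulr0.
have YE i : \sum_(j \in [set: idx r]) Y (j, i) = X (i, j0).
  rewrite (@fsum1 _ _ _ _ j0) => [|j jj]; last by rewrite /Y /= (pair_ann0 C jj) scale0r mulr0.
  rewrite /X /Y /= Mx_sym ipj0 (_ : ocst _ f = fun m I => (-1) ^+ (ip i && e) * ocst (Mx i j0) f m I).
    rewrite osc_sign scalerAr mulrA -signr_addb.
    by congr (_ ^+ (nat_of_bool _) * _); case: (e); case: (ip i).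
  by apply: funext => m'; apply: funext => I'; rewrite /ocst pexpM pexp_sign mulrA.
rewrite (eq_fsbigr (fun i => X (i, j0))) => [|i _]; last exact: XE.
rewrite [X in _ *: (_ + X)](eq_fsbigr (fun i => X (i, j0))) => [|i _]; last exact: YE.
have half (x : R) : 2^-1 *: (x + x) = x.
  by rewrite -mulr2n -scaler_nat scalerA mulVf ?scale1r // pnatr_eq0.
rewrite half; apply: eq_fsbigr => i _ /=.
have hM : hpar (ip i (+) e) (Mx i j0) by rewrite -ipj0; apply: hpar_Mx.
have := ocst_osc (ann i) f m I hM; rewrite fpar_ann => E.
rewrite /cPhi -/j0 -/e /X /= ipj0.
have -> : ocst (pair C (ann j0) u *: ((-1) ^+ (ip i (+) e) * Mx i j0)) (osc (ann i) f) m I =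
    pair C (ann j0) u *: ((-1) ^+ (ip i (+) e) * ocst (Mx i j0) (osc (ann i) f) m I).
  by rewrite /ocst pexpZ pexpM pexp_sign -scalerAl mulrA.
rewrite E mulrA -signr_addb -[LHS]scalerAr.
by congr (_ *: (_ ^+ (nat_of_bool _) * _)); case: (ip i); case: (e).
Qed.

Lemma hpar_cPhi u i : hpar (ip i (+) fpar u) (cPhi u i).
Proof.
by apply: hparZ; apply: hpar_sign; rewrite -ipar_osc_i; apply: hpar_Mx.
Qed.

Definition zeromode (b : 'I_r) : idx r := inr (b, 0%N).

(** Coefficients of one further commutator. Log Phi is built from annihilation modes, and among
    these only the zero modes can pair with it. *)
Definition cPhi2 (c : idx r -> R) i : R := \sum_b c (zeromode b) * cPhi (ann (zeromode b)) i.

Lemma hpar_cPhi2 e c i : (forall i, hpar (ip i (+) e) (c i)) -> hpar (ip i (+) e) (cPhi2 c i).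
Proof.
move=> hc; apply: hpar_sum => b.
rewrite (_ : _ (+) _ = (true (+) e) (+) (ip i (+) true)).
  exact: (hparM (hc (zeromode b)) (hpar_cPhi (ann (zeromode b)) i)).
by case: (ip i); case: (e).
Qed.

Lemma symPhi_ocst b c p f : hpar b c -> symPhi p (ocst c f) = ocst c (symPhi p f).
Proof. by move=> hc; apply: oquad_ocst hc _; rewrite !fpar_ann; apply: hpar_Mx. Qed.

Lemma ad_oPhi_ocst b c : hpar b c -> eqop (oad oPhi (ocst c)) ozero.
Proof.
move=> hc f gf; apply: funext => m; apply: funext => I.
have h := ad_fsuml (@lop_cst C R r c) lop_symPhi summable_symPhi.
have : oad (ofsum symPhi) (ocst c) f m I = 0.
  rewrite [oad _ _ f]h //; apply: fsbig1 => p _.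
  by rewrite /oad (symPhi_ocst _ _ hc) subrr.
rewrite /oad /oPhi /= /oscale {2}/ocst => E.
rewrite [X in _ - X](_ : _ = 2^-1 *: ocst c (ofsum symPhi f) m I); last by rewrite /ocst -scalerAr.
by rewrite -scalerBr E scaler0.
Qed.

Lemma annih0 f : annih (fun=> 0) f = fun _ _ => 0.
Proof.
apply: funext => m; apply: funext => I; apply: fsbig1 => i _.
by rewrite /= /ocst pexp0 mul0r.
Qed.

(** Two annihilation modes pair only if their indices are opposite, hence both 0. *)
Lemma cPhi_ann i : (forall b, i != zeromode b) -> cPhi (ann i) = fun=> 0.
Proof.
move=> hi; apply: funext => j; rewrite /cPhi osc_i_ann /pair ann_mode eqxx /=.
rewrite (_ : (_ == _ :> int) = false) ?scale0r //.
by case: i hi => [[a k]|[a [|k]]] //= hi; have := hi a; rewrite eqxx.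
Qed.

Lemma ad_oPhi_annih e (c : idx r -> R) : (forall i, hpar (ip i (+) e) (c i)) ->
  eqop (oad oPhi (annih c)) (annih (cPhi2 c)).
Proof.
move=> hc; apply: eqop_trans (ad_fsum lop_oPhi (lop_annih_term c) (summable_annih c)) _.
move=> f gf; apply: funext => m; apply: funext => I.
have E i : oad oPhi (ocst (c i) \o osc (ann i)) f = ocst (c i) (annih (cPhi (ann i)) f).
  rewrite (ad_comp lop_oPhi (@lop_cst C R r _) (@lop_osc C R r _)) //.
  apply: funext => m'; apply: funext => I'; rewrite /oadd /=.
  rewrite (ad_oPhi_ocst (hc i)) ?ad_oPhi ?add0r //; exact: lop_good (@lop_osc C R r _) _ gf.
rewrite [LHS]/ofsum (@fsum_seq _ _ (map zeromode (enum 'I_r))).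
- rewrite big_map big_enum /= /annih [RHS]/ofsum.
  under eq_bigr => b _ do rewrite E.
  rewrite [LHS](eq_bigr (fun b => \sum_(i \in [set: idx r])
      ocst (c (zeromode b)) ((ocst (cPhi (ann (zeromode b)) i) \o osc (ann i)) f) m I)); last first.
    move=> b _; rewrite /annih (lop_fsumE (@lop_cst C R r (c (zeromode b)))) //.
      by move=> i; apply: lop_good (lop_annih_term _ _) _ gf.
    exact: summable_annih.
  rewrite -fsum_sum => [|b]; last first.
    have := summable_lop (@lop_cst C R r (c (zeromode b))) (summable_annih (cPhi (ann (zeromode b))) gf).
    by move=> h; exact: (@summable_finsum _ _ _ _ _ m I h).
  apply: eq_fsbigr => i _ /=; rewrite /ocst /cPhi2 pexp_sum mulr_suml.
  by apply: eq_bigr => b _; rewrite pexpM mulrA.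
- by rewrite map_inj_uniq ?enum_uniq // => b b' [].
move=> i hi; rewrite E cPhi_ann ?annih0; first by rewrite /ocst mulr0.
by move=> b; apply: contra hi => /eqP ->; rewrite map_f // mem_enum.
Qed.

Definition towPhi u (w : R) (n : nat) : op :=
  match n with
  | 0%N => oadd (osc u) (ocst w)
  | 1%N => annih (cPhi u)
  | 2%N => annih (cPhi2 (cPhi u))
  | _ => ozero
  end.

(** Zero modes enter the second commutator with coefficients containing V_{00} = 0, so this
    commutator commutes with log Phi and the tower stops. *)
Lemma tower_towPhi b u w : hpar b w -> tower oPhi 2 (towPhi u w).
Proof.
move=> hw; have lu := @lop_osc C R r u; have lw := lop_le (isT : 0 <= 2)%N (@lop_cst C R r w).
have hc i : hpar (ip i (+) fpar u) (cPhi u i) by apply: hpar_cPhi.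
have hc2 i : hpar (ip i (+) fpar u) (cPhi2 (cPhi u) i) by apply: hpar_cPhi2.
split=> [[|[|[|n]]]|[|[|[|n]]]|[|[|[|[|n]]]]] //=.
- exact: lop_add.
- exact: lop_annih.
- exact: lop_annih.
- exact: lop_zero.
- apply: eqop_trans (ad_add lop_oPhi lu lw) _ => f gf.
  apply: funext => m; apply: funext => I.
  by rewrite /oadd ad_oPhi // (ad_oPhi_ocst hw) // /ozero addr0.
- exact: ad_oPhi_annih hc.
- apply: eqop_trans (ad_oPhi_annih hc2) _ => f gf.
  rewrite (_ : cPhi2 (cPhi2 (cPhi u)) = fun=> 0) ?annih0 //.
  apply: funext => i; rewrite /cPhi2 big1 // => b1 _.
  rewrite big1 ?mul0r // => b2 _; rewrite [X in _ * X](_ : _ = 0) ?mulr0 //.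
  by rewrite /cPhi osc_i_ann /Mx /= V_00 mulr0 scaler0.
- exact: ad_zero lop_oPhi.
Qed.

(** The 1/2 is the 1/2! of the exponential series; it reappears in the corrections of d xi_{-k} and
    d eta_{-k}. *)
Definition dPhi u i : R := cPhi u i + 2^-1 *: cPhi2 (cPhi u) i.

(* The conjugate of [osc u + w] by Phi. *)
Definition ell u (w : R) : op := oadd (oadd (osc u) (ocst w)) (annih (dPhi u)).

Lemma tower_sum_towPhi u w : eqop (tower_sum (towPhi u w)) (ell u w).
Proof.
move=> f gf; apply: funext => m; apply: funext => I.
rewrite /tower_sum /lincomb !big_cons big_nil /ell /oadd /=.
rewrite !(fact0, factS) !muln1 !invr1 !scale1r addr0; congr (_ + _).
rewrite (annihD (cPhi u) (fun i => 2^-1 *: cPhi2 (cPhi u) i)) //; congr (_ + _).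
rewrite /annih /ofsum -fsumZ.
  by apply: eq_fsbigr => i _; rewrite /= /ocst pexpZ scalerAl.
exact: (@summable_finsum _ _ _ _ (fun i => (ocst (cPhi2 (cPhi u) i) \o osc (ann i)) f) m I (summable_annih _ gf)).
Qed.

End LogPhi.

(** * Conjugation of families of normally ordered products *)

Section ConjugatedModes.
Variables (C : numClosedFieldType) (R : supalg C) (r : nat).

Local Notation word := (seq (idx r)).
Local Notation fock := (int -> word -> R).
Local Notation op := (fock -> fock).
Local Notation ip := (@ipar r).
Local Notation wp := (wpar (@ipar r)).
Local Notation ann := (@ann r).

Implicit Types (f g : fock) (I : word) (m : int) (s u : oneform r).

Lemma iter_ad_eqop2 n a c (A A' X X' : op) : eqop A A' -> lop a A' -> eqop X X' -> lop c X' ->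
  eqop (iter n (oad A) X) (iter n (oad A') X').
Proof.
move=> eA lA eX lX; elim: n => //= n IH f gf.
have lY := lop_iter_ad lA n lX.
apply: funext => m; apply: funext => I; rewrite /oad IH // eA; last exact: lop_good lY _ gf.
by rewrite eA // IH //; apply: lop_good lA _ gf.
Qed.

Lemma exp_conj_eqop2 a c (A A' X X' : op) : eqop A A' -> lop a A' -> eqop X X' -> lop c X' ->
  eqop (oexp_conj A X) (oexp_conj A' X').
Proof.
move=> eA lA eX lX f gf; apply: funext => m; apply: funext => I.
by apply: eq_fsbigr => n _; rewrite (iter_ad_eqop2 n eA lA eX lX).
Qed.

Section ConjFamily.
Variables (a : nat) (A : op).
Hypotheses (lA : lop a A) (hA : forall f, A (ohbar 2 f) = ohbar 2 (A f)).

Lemma ad_hbar (v : C) : eqop (oad A (oscale v \o ohbar 2)) ozero.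
Proof.
move=> f gf; apply: funext => m; apply: funext => I.
have g2 : good (ohbar 2 f) by apply: lop_good (@lop_hbar C R r 2) _ gf.
by rewrite /oad /= /oscale (lopZ _ lA g2) hA subrr.
Qed.

Lemma lop_schbar (v : C) : lop 2 (@oscale C R r v \o ohbar 2).
Proof. by apply: (@lop_comp _ _ _ 0 2); [apply: lop_scale|apply: (@lop_hbar C R r 2)]. Qed.

Lemma nilp_hbar (v : C) : nilp_ad A 5 (oscale v \o ohbar 2).
Proof. by apply: (nilp_ad_le lA (d := 1)) => //; apply: ad_hbar. Qed.

Lemma exp_conj_hbar (v : C) : eqop (oexp_conj A (oscale v \o ohbar 2)) (oscale v \o ohbar 2).
Proof.
have n1 : nilp_ad A 1 (oscale v \o ohbar 2) by apply: ad_hbar.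
apply: eqop_trans (exp_conjE lA n1) _ => f gf; apply: funext => m; apply: funext => I.
by rewrite /expc big_ord_recl big_ord0 addr0 /= invr1 scale1r.
Qed.

Variables (c : nat) (T : choiceType) (k v : T -> C) (X Y : T -> nat -> op).
Hypotheses (tX : forall t, tower A c (X t)) (tY : forall t, tower A c (Y t)).

(** A summand of L or G. The normal ordering constant stays inside the summand, since the products
    alone need not be summable over [t]. *)
Definition pfam (X0 Y0 : T -> op) t : op :=
  oscale (k t) \o oadd (X0 t \o Y0 t) (oscale (v t) \o ohbar 2).

Lemma lop_pfam (X0 Y0 : T -> op) : (forall t, lop c (X0 t)) -> (forall t, lop c (Y0 t)) ->
  forall t, lop (c + c + 2) (pfam X0 Y0 t).
Proof.
move=> lX lY t; apply: (@lop_comp _ _ _ 0); first exact: lop_scale.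
apply: lop_add; first by apply: lop_le (lop_comp (lX t) (lY t)); lia.
by apply: lop_le (lop_schbar _); lia.
Qed.

Let X0 t := X t 0%N.
Let Y0 t := Y t 0%N.
Hypothesis sP : forall f, good f -> summable (fun t => pfam X0 Y0 t f).

Let lX t : lop c (X0 t). Proof. exact: tower_lop (tX t) 0. Qed.
Let lY t : lop c (Y0 t). Proof. exact: tower_lop (tY t) 0. Qed.

Lemma nilp_pfam t : nilp_ad A 5 (pfam X0 Y0 t).
Proof.
have l1 : lop (c + c + 2) (X0 t \o Y0 t) by apply: lop_le (lop_comp (lX t) (lY t)); lia.
have l2 : lop (c + c + 2) (@oscale C R r (v t) \o ohbar 2) by apply: lop_le (lop_schbar _); lia.
apply: (nilp_scale lA _ (lop_add l1 l2)); apply: (nilp_add lA l1 l2).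
  exact (nilp_comp lA (tX t) (tY t)).
exact: nilp_hbar.
Qed.

Lemma exp_conj_pfam t : eqop (oexp_conj A (pfam X0 Y0 t))
  (pfam (fun t => tower_sum (X t)) (fun t => tower_sum (Y t)) t).
Proof.
have l1 : lop (c + c + 2) (X0 t \o Y0 t) by apply: lop_le (lop_comp (lX t) (lY t)); lia.
have l2 : lop (c + c + 2) (@oscale C R r (v t) \o ohbar 2) by apply: lop_le (lop_schbar _); lia.
have n1 := nilp_comp lA (tX t) (tY t).
have n2 := nilp_hbar (v t).
apply: eqop_trans (exp_conj_scale lA _ (lop_add l1 l2) (nilp_add lA l1 l2 n1 n2)) _.
apply: eqop_compl; apply: eqop_trans (exp_conj_add lA l1 l2 n1 n2) _.
apply: eqop_add; first exact (exp_conj_comp lA (tX t) (tY t)).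
exact: exp_conj_hbar.
Qed.

Lemma exp_conj_family : eqop (oexp_conj A (ofsum (pfam X0 Y0)))
  (ofsum (pfam (fun t => tower_sum (X t)) (fun t => tower_sum (Y t)))).
Proof.
apply: eqop_trans (exp_conj_fsum lA (lop_pfam lX lY) sP nilp_pfam) _.
exact: eqop_fsum exp_conj_pfam.
Qed.

Lemma nilp_family : nilp_ad A 5 (ofsum (pfam X0 Y0)).
Proof. exact (nilp_fsum lA (lop_pfam lX lY) sP nilp_pfam). Qed.

Lemma summable_conj_family f : good f ->
  summable (fun t => pfam (fun t => tower_sum (X t)) (fun t => tower_sum (Y t)) t f).
Proof.
move=> gf; have := summable_exp_conj lA (lop_pfam lX lY) sP nilp_pfam gf.
by apply: eq_summable => t; rewrite exp_conj_pfam.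
Qed.

End ConjFamily.

Definition ovac : fock := fun m I => ((m == 0) && (I == [::]))%:R.
Definition ovev (X Y : op) (m : int) : R := X (Y ovac) m [::].
Definition onord (X Y : op) : op := fun f m I =>
  X (Y f) m I
  - \sum_(j \in [set: int]) ocst (ovev X Y j) (ohbar j f) m I.

(* <0| X Y |0> / hbar^2 for X = osc s and Y = osc u. *)
Definition vv s u : C := (osc_i s == osc_i u)%:R * (osc_d C s * osc_x C u).

Lemma ovevE s u m : ovev (osc s) (osc u) m = (m == 2)%:R * (vv s u)%:A.
Proof.
rewrite /ovev !oscE /= scaler0 add0r mulr0 addr0.
rewrite /ovac /= andbF scaler0 addr0 andbT subr_eq0 subr_eq.
have -> : (m == 1 + 1) = (m == 2) by [].
rewrite /vv eq_sym; case: (osc_i s == osc_i u); rewrite ?mul0r ?scale0r ?mulr0 ?scaler0 //.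
by rewrite !mul1r scalerA; case: (m == 2); rewrite ?mul1r ?mul0r ?scaler0.
Qed.

Lemma onordE s u f m I :
  onord (osc s) (osc u) f m I = osc s (osc u f) m I + (- vv s u) *: ohbar 2 f m I.
Proof.
rewrite /onord (@fsum1 _ _ _ _ (2 : int)) => [|j /negbTE jn].
  by rewrite ovevE eqxx mul1r /ocst pexpZ pexp1 scaleNr -scalerAl mul1r.
by rewrite ovevE jn mul0r /ocst pexp0 mul0r.
Qed.

Section Summability.
Variables (a : 'I_r) (e e' : bool) (M : int).
Let s1 (j : int) : oneform r := (a, e, - j).
Let s2 (j : int) : oneform r := (a, e', M + j).

(** For large positive j the inner mode annihilates [f] and the vacuum expectation value is 0. For
    large negative j the modes are exchanged, and the constant that appears is exactly the one that
    is subtracted. *)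
Lemma summable_modes (k : int -> C) f : good f ->
  summable (fun j => pfam k (fun j => - vv (s1 j) (s2 j)) (fun j => osc (s1 j)) (fun j => osc (s2 j)) j f).
Proof.
move=> gf n; have [N hN] := osc_far gf (n + 2)%N.
pose K := (N + `|M|)%N.
exists [seq z - K%:Z | z <- map Posz (iota 0 (K + K).+1)] => j hj m I mn In.
have {}hj : j < - K%:Z \/ K%:Z < j.
  case: (boolP ((- K%:Z <= j) && (j <= K%:Z))) => h; last by lia.
  case/negP: hj; apply/mapP; exists (j + K%:Z); last by rewrite addrK.
  by apply/mapP; exists (absz (j + K%:Z)); [rewrite mem_iota|]; move: h => /=; lia.
have far s s' : N%:Z < s.2 -> osc s' (osc s f) m I = 0.
  move=> hs; have ag : agree (n + 2) (osc s f) (fun _ _ => 0).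
    by move=> m1 I1 h1 h2; rewrite -(ocst1 f); apply: hN.
  by rewrite (lop_local (@lop_osc C R r s') ag) ?osc0 //; lia.
rewrite /pfam /oadd /= /oscale /ohbar; case: hj => hj; last first.
  rewrite far ?add0r; last by rewrite /s2 /=; lia.
  rewrite /vv (_ : osc_d C (s1 j) = 0) ?mul0r ?mulr0 ?oppr0 ?scale0r ?scaler0 //.
  rewrite /osc_d /s1 /=; have -> : (0 <= - j) = false by lia.
  have -> : (0 < - j) = false by lia. by rewrite if_same.
rewrite osc_comm // far ?mulr0 ?add0r; last by rewrite /s1 /=; lia.
have x0 : osc_x C (s1 j) = 0.
  rewrite /osc_x /s1 /=; have -> : (- j == 0) = false by lia.
  have -> : (- j < 0) = false by lia.
  by case: (e).
by rewrite pairE x0 mul0r mulr0 subr0 /vv -scalerDl subrr scale0r scaler0.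
Qed.

End Summability.

End ConjugatedModes.

(** * The conjugates of L and G by T and Phi *)

Section ConjugatedOperators.
Variables (C : numClosedFieldType) (R : supalg C) (r : nat).

Local Notation word := (seq (idx r)).
Local Notation fock := (int -> word -> R).
Local Notation op := (fock -> fock).

Implicit Types (f g : fock) (I : word) (m : int) (s u : oneform r).

Definition otrip (w : C) (P Q : op) : op :=
  oadd (oadd (oscale 2^-1 \o P) (oscale 2^-1 \o Q)) (oscale w \o ohbar 2).

Lemma lop_otrip c w (P Q : op) : lop c P -> lop c Q -> lop (c + 2) (otrip w P Q).
Proof.
move=> lP lQ; apply: lop_add; last by apply: lop_le (@lop_schbar C R r _); lia.
apply: lop_add; apply: (@lop_le _ _ _ (0 + c)); try lia; apply: lop_comp => //; exact: lop_scale.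
Qed.

Lemma eqop_otrip w (P P' Q Q' : op) : eqop P P' -> eqop Q Q' ->
  eqop (otrip w P Q) (otrip w P' Q').
Proof.
move=> h h'; apply: eqop_add; last exact: eqop_refl.
by apply: eqop_add; apply: eqop_compl.
Qed.

Lemma exp_conj_otrip a c (A P Q : op) w : lop a A -> (forall f, A (ohbar 2 f) = ohbar 2 (A f)) ->
  lop c P -> lop c Q -> nilp_ad A 5 P -> nilp_ad A 5 Q ->
  eqop (oexp_conj A (otrip w P Q)) (otrip w (oexp_conj A P) (oexp_conj A Q)).
Proof.
move=> lA hA lP lQ nP nQ.
have l1 : lop (c + 2) (@oscale C R r 2^-1 \o P).
  by apply: (@lop_le _ _ _ (0 + c)); [lia|apply: lop_comp lP; apply: (@lop_scale C R r)].
have l2 : lop (c + 2) (@oscale C R r 2^-1 \o Q).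
  by apply: (@lop_le _ _ _ (0 + c)); [lia|apply: lop_comp lQ; apply: (@lop_scale C R r)].
have l3 : lop (c + 2) (@oscale C R r w \o ohbar 2) by apply: lop_le (@lop_schbar C R r _); lia.
have n1 := nilp_scale lA 2^-1 lP nP; have n2 := nilp_scale lA 2^-1 lQ nQ.
have n3 := nilp_hbar lA hA w.
apply: eqop_trans (exp_conj_add lA (lop_add l1 l2) l3 (nilp_add lA l1 l2 n1 n2) n3) _.
apply: eqop_add (exp_conj_hbar lA hA w).
apply: eqop_trans (exp_conj_add lA l1 l2 n1 n2) _.
apply: eqop_add; [exact (exp_conj_scale lA 2^-1 lP nP)|exact (exp_conj_scale lA 2^-1 lQ nQ)].
Qed.

Lemma eqop_pfam c (T : choiceType) (k v : T -> C) (X X' Y Y' : T -> op) :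
  (forall t, lop c (Y t)) -> (forall t, eqop (X t) (X' t)) -> (forall t, eqop (Y t) (Y' t)) ->
  forall t, eqop (pfam k v X Y t) (pfam k v X' Y' t).
Proof.
move=> lY hX hY t; apply: eqop_compl; apply: eqop_add; last exact: eqop_refl.
exact: eqop_comp (lY t) (hX t) (hY t).
Qed.

Variables (t tau : 'I_r -> int -> R) (B phi V : 'I_r -> 'I_r -> nat -> nat -> R).
Hypotheses (t_even : forall a k, hpar false (t a k)) (tau_odd : forall a k, hpar true (tau a k)).
Hypothesis t0 : forall a, t a 0 = 0.
Hypothesis mero : exists N : int, forall a k, k < N -> t a k = 0 /\ tau a k = 0.
Hypotheses (B_even : forall a b k l, hpar false (B a b k l))
  (phi_odd : forall a b k l, hpar true (phi a b k l))
  (V_even : forall a b k l, hpar false (V a b k l))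
  (V_00 : forall a b, V a b 0 0 = 0)
  (B_sym : forall a b k l, B a b k l = B b a l k)
  (V_antisym : forall a b k l, V a b k l = - V b a l k).

Definition oLop (a : 'I_r) (n : int) : op := fun f m I =>
  2^-1 *: (\sum_(j \in [set: int])
     (-1) ^ (j - 1) *: onord (oJ a (- j)) (oJ a (2 * n + j)) f m I)
  + 2^-1 *: (\sum_(j \in [set: int])
     ((-1) ^ j * (j + n)%:~R) *:
        onord (oGamma a (- j)) (oGamma a (2 * n + j)) f m I)
  + ((n == 0)%:R / 4) *: ohbar 2 f m I.

Definition oGop (a : 'I_r) (n : int) : op := fun f m I =>
  \sum_(j \in [set: int])
     (-1) ^ (j - 1) *: oJ a (- j) (oGamma a (2 * n + 1 + j) f) m I.

Local Notation logT := (ologT t tau).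
Local Notation logPhi := (ologPhi B phi V).

Definition oLtilde a n : op := oexp_conj logPhi (oexp_conj logT (oLop a n)).
Definition oGtilde a n : op := oexp_conj logPhi (oexp_conj logT (oGop a n)).

Local Notation AT := (ofsum (sympT t tau)).
Local Notation AP := (oPhi B phi V).

Let lAT : lop 4 AT. Proof. exact: lop_ologT mero. Qed.
Let lAP : lop 6 AP. Proof. exact: lop_oPhi. Qed.

Lemma AT_hbar f : AT (ohbar 2 f) = ohbar 2 (AT f).
Proof.
have E s M : olin s M (ohbar 2 f) = ohbar 2 (olin s M f).
  apply: funext => m; apply: funext => I.
  by rewrite /olin /= -ohbar_ocst osc_ohbar /ohbar addrAC.
apply: funext => m; apply: funext => I; apply: eq_fsbigr => p _.
by rewrite /sympT /oadd /= !E.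
Qed.

Lemma AP_hbar f : AP (ohbar 2 f) = ohbar 2 (AP f).
Proof.
have E s u M : oquad s u M (ohbar 2 f) = ohbar 2 (oquad s u M f).
  apply: funext => m; apply: funext => I.
  by rewrite /oquad /= -ohbar_ocst !osc_ohbar /ohbar addrAC.
apply: funext => m; apply: funext => I; congr (_ *: _); apply: eq_fsbigr => p _.
by rewrite /symPhi E.
Qed.

Definition mode (a : 'I_r) (e : bool) (k : int) : oneform r := (a, e, k).

(* The conjugate of the oscillator whose index is opposite to [s]. *)
Definition ellmode s : op := ell B phi V (fneg s) (om01 t tau s).

Definition oldfam a e e' (M : int) (k : int -> C) : int -> op :=
  pfam k (fun j => - vv C (mode a e (- j)) (mode a e' (M + j)))
    (fun j => osc (mode a e (- j))) (fun j => osc (mode a e' (M + j))).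

(** [ellmode] reverses the index, so the modes -j and M + j of [oldfam] become the forms j and -(M +
    j). *)
Definition newfam a e e' (M : int) (k : int -> C) : int -> op :=
  pfam k (fun j => - vv C (mode a e (- j)) (mode a e' (M + j)))
    (fun j => ellmode (mode a e j)) (fun j => ellmode (mode a e' (- (M + j)))).

Section Family.
Variables (a : 'I_r) (e e' : bool) (M : int) (k : int -> C).
Let s1 (j : int) := mode a e (- j).
Let s2 (j : int) := mode a e' (M + j).
Let v j := - vv C (s1 j) (s2 j).
Let w1 j := om01 t tau (fneg (s1 j)).
Let w2 j := om01 t tau (fneg (s2 j)).
Let midfam : int -> op :=
  pfam k v (fun j => oadd (osc (s1 j)) (ocst (w1 j))) (fun j => oadd (osc (s2 j)) (ocst (w2 j))).

Let T1 j := tower_towT t_even tau_odd t0 mero (s1 j).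
Let T2 j := tower_towT t_even tau_odd t0 mero (s2 j).

Lemma tower_sum_towT u : eqop (tower_sum (towT t tau u)) (oadd (osc u) (ocst (om01 t tau (fneg u)))).
Proof.
move=> f gf; apply: funext => m; apply: funext => I.
rewrite /tower_sum /lincomb !big_cons big_nil /oadd /=.
by rewrite !(fact0, factS) !muln1 !invr1 !scale1r /ozero scaler0 !addr0.
Qed.

Let lmid u : lop 2 (oadd (osc u) (ocst (om01 t tau (fneg u)))).
Proof. by apply: lop_add; [apply: lop_osc|apply: lop_le (@lop_cst C R r _)]. Qed.

Let sold f : good f -> summable (fun j => oldfam a e e' M k j f).
Proof. exact: summable_modes. Qed.

Let mid_eq j : eqop (pfam k v (fun j => tower_sum (towT t tau (s1 j)))
    (fun j => tower_sum (towT t tau (s2 j))) j) (midfam j).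
Proof.
apply: (@eqop_pfam 2) => [j'|j'|j']; [|exact: tower_sum_towT|exact: tower_sum_towT].
exact: lop_tower_sum (T2 j').
Qed.

Let smid f : good f -> summable (fun j => midfam j f).
Proof.
move=> gf; have := summable_conj_family lAT AT_hbar T1 T2 sold gf.
by apply: eq_summable => j; rewrite mid_eq.
Qed.

Let hp u : hpar (fpar u) (om01 t tau (fneg u)).
Proof. by case: u => [[b []] l]; [apply: tau_odd|apply: t_even]. Qed.

Let P1 j := tower_towPhi B_even phi_odd V_even V_00 B_sym V_antisym (s1 j) (hp (s1 j)).
Let P2 j := tower_towPhi B_even phi_odd V_even V_00 B_sym V_antisym (s2 j) (hp (s2 j)).

Let new_eq j : eqop (pfam k v (fun j => tower_sum (towPhi B phi V (s1 j) (w1 j)))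
    (fun j => tower_sum (towPhi B phi V (s2 j) (w2 j))) j) (newfam a e e' M k j).
Proof.
apply: (@eqop_pfam 2) => [j'|j'|j'].
- exact: lop_tower_sum (P2 j').
- by apply: eqop_trans (tower_sum_towPhi _ _ _ _ _) _; rewrite /ellmode /w1 /s1 /fneg /mode /= opprK.
- by apply: eqop_trans (tower_sum_towPhi _ _ _ _ _) _; rewrite /ellmode /w2 /s2 /fneg /mode /= opprK.
Qed.

Lemma summable_newfam f : good f -> summable (fun j => newfam a e e' M k j f).
Proof.
move=> gf; have := summable_conj_family lAP AP_hbar P1 P2 smid gf.
by apply: eq_summable => j; rewrite new_eq.
Qed.

Lemma lop_oldfam : lop 6 (ofsum (oldfam a e e' M k)).
Proof.
apply: lop_fsum sold => j; exact: (@lop_pfam _ _ _ 2) (fun j => @lop_osc _ _ _ _) (fun j => @lop_osc _ _ _ _) j.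
Qed.

Lemma nilp_oldfam : nilp_ad AT 5 (ofsum (oldfam a e e' M k)).
Proof. exact (nilp_family lAT AT_hbar T1 T2 sold). Qed.

Lemma conjT_fam : eqop (oexp_conj AT (ofsum (oldfam a e e' M k))) (ofsum midfam).
Proof.
exact: eqop_trans (exp_conj_family lAT AT_hbar T1 T2 sold) (eqop_fsum mid_eq).
Qed.

Lemma lop_midfam : lop 6 (ofsum midfam).
Proof. apply: lop_fsum smid => j; exact: (@lop_pfam _ _ _ 2) (fun j => lmid _) (fun j => lmid _) j. Qed.

Lemma nilp_midfam : nilp_ad AP 5 (ofsum midfam).
Proof. exact (nilp_family lAP AP_hbar P1 P2 smid). Qed.

Lemma conjPhi_fam : eqop (oexp_conj AP (ofsum midfam)) (ofsum (newfam a e e' M k)).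
Proof.
exact: eqop_trans (exp_conj_family lAP AP_hbar P1 P2 smid) (eqop_fsum new_eq).
Qed.

(** The family conjugated by T alone is hidden; the conjugation by Phi relies on these four
    properties of it. *)
Lemma conj_fam : exists Q, [/\ eqop (oexp_conj AT (ofsum (oldfam a e e' M k))) Q,
  lop 6 Q, nilp_ad AP 5 Q & eqop (oexp_conj AP Q) (ofsum (newfam a e e' M k))].
Proof.
by exists (ofsum midfam); split; [exact: conjT_fam|exact: lop_midfam|exact: nilp_midfam|exact: conjPhi_fam].
Qed.

End Family.

Definition kJ (j : int) : C := (-1) ^ (j - 1).
Definition kG (n j : int) : C := (-1) ^ j * (j + n)%:~R.

Lemma oLopE a n : oLop a n = otrip ((n == 0)%:R / 4)
  (ofsum (oldfam a false false (2 * n) kJ)) (ofsum (oldfam a true true (2 * n) (kG n))).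
Proof.
apply: funext => f; apply: funext => m; apply: funext => I.
rewrite /oLop /otrip /oadd /= /oscale; congr (_ *: _ + _ *: _ + _).
  apply: eq_fsbigr => j _.
  by rewrite -[onord _ _ _ _ _]/(onord (osc (mode a false (- j))) (osc (mode a false (2 * n + j))) f m I) onordE.
apply: eq_fsbigr => j _.
by rewrite -[onord _ _ _ _ _]/(onord (osc (mode a true (- j))) (osc (mode a true (2 * n + j))) f m I) onordE.
Qed.

Lemma oGopE a n : oGop a n = ofsum (oldfam a false true (2 * n + 1) kJ).
Proof.
apply: funext => f; apply: funext => m; apply: funext => I.
apply: eq_fsbigr => j _; rewrite /oldfam /pfam /= /oscale /oadd /=.
(* A variable of J never equals one of Gamma, so the vacuum expectation value is 0 and G is already
   normally ordered. *)
by rewrite [vv _ _ _](_ : _ = 0) ?oppr0 ?scale0r ?addr0 // /vv mul0r.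
Qed.

Lemma oLtildeE a n : eqop (oLtilde a n) (otrip ((n == 0)%:R / 4)
  (ofsum (newfam a false false (2 * n) kJ)) (ofsum (newfam a true true (2 * n) (kG n)))).
Proof.
have [Q1 [e1 l1 n1 c1]] := conj_fam a false false (2 * n) kJ.
have [Q2 [e2 l2 n2 c2]] := conj_fam a true true (2 * n) (kG n).
have lo1 := lop_oldfam a false false (2 * n) kJ.
have lo2 := lop_oldfam a true true (2 * n) (kG n).
have no1 := nilp_oldfam a false false (2 * n) kJ.
have no2 := nilp_oldfam a true true (2 * n) (kG n).
set w := _ / 4.
have s1 : eqop (oexp_conj logT (oLop a n)) (otrip w Q1 Q2).
  rewrite oLopE; have lt := lop_otrip w lo1 lo2.
  apply: (eqop_trans (exp_conj_eqop2 (ologTE mero) lAT (@eqop_refl C R r _) lt)).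
  apply: eqop_trans (exp_conj_otrip w lAT AT_hbar lo1 lo2 no1 no2) _.
  exact: eqop_otrip.
have lQ := lop_otrip w l1 l2.
apply: (eqop_trans (exp_conj_eqop2 (ologPhiE B phi V) lAP s1 lQ)).
apply: eqop_trans (exp_conj_otrip w lAP AP_hbar l1 l2 n1 n2) _.
exact: eqop_otrip.
Qed.

Lemma oGtildeE a n : eqop (oGtilde a n) (ofsum (newfam a false true (2 * n + 1) kJ)).
Proof.
have [Q1 [e1 l1 n1 c1]] := conj_fam a false true (2 * n + 1) kJ.
have lo1 := lop_oldfam a false true (2 * n + 1) kJ.
have s1 : eqop (oexp_conj logT (oGop a n)) Q1.
  rewrite oGopE; exact (eqop_trans (exp_conj_eqop2 (ologTE mero) lAT (@eqop_refl C R r _) lo1) e1).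
exact (eqop_trans (exp_conj_eqop2 (ologPhiE B phi V) lAP s1 l1) c1).
Qed.

End ConjugatedOperators.
(** * Constraints on the partition function *)

Section PartitionFunction.
Variables (C : numClosedFieldType) (R : supalg C) (r : nat).

Local Notation word := (seq (idx r)).
Local Notation fock := (int -> word -> R).
Local Notation nfock := (nat -> word -> R).
Local Notation op := (fock -> fock).
Local Notation ip := (@ipar r).
Local Notation wp := (wpar (@ipar r)).
Local Notation wcv := (@wconv C R (idx r) ip).
Local Notation ncv := (@nconv C R (idx r) ip).
Local Notation whm := (@whom C R (idx r) ip).
Local Notation gwh := (@gwhom C R (idx r) ip).
Local Notation ann := (@ann r).

Implicit Types (f g : fock) (X Y : nfock) (I : word) (m : int) (s u : oneform r).

Definition xword (i : idx r) : word -> R := fun K => (K == [:: i])%:R.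

Lemma whom_xword i : whm (ip i) (xword i).
Proof.
move=> K; rewrite /xword; have [->|_] := eqVneq K [:: i]; last exact: hpar0.
by rewrite wpar_cons wpar_nil addbF addbb; apply: hpar1.
Qed.

Lemma wconv_xword i (h : word -> R) I : wcv (xword i) h I = omulx_word i h I.
Proof.
elim: I h => [|j I IH] h /=; first by rewrite wconv_nil /xword mul0r.
rewrite (wconv_cons _ _ _ (whom_xword i)) IH; congr (_ + _).
rewrite (@eq_wconv _ _ _ _ _ (fun K => (i == j)%:R * unitw 1 K) _ h) //; last first.
  move=> K _; rewrite /sder /xword eqseq_cons (eq_sym j).
  by case: (i == j); rewrite ?mul0r // mul1r; case: K.
case: (i == j); last by rewrite mul0r wconv_eq0l // => K _; rewrite mul0r.
rewrite mul1r -[RHS](wconv1l ip); apply: eq_wconv => // K _; by rewrite mul1r.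
Qed.

Lemma wconv_cst e e' c (h h' : word -> R) I : hpar e c -> whm e' h ->
  wcv (fun K => pexp (wp K) c * h K) h' I = pexp (wp I) c * wcv h h' I.
Proof.
move=> hc hh; rewrite -(wconv_unitl ip _ _ hc) (wconvA _ _ (@whom_unitw C R (idx r) ip _ _ hc) hh).
by apply: eq_wconv => // K _; rewrite (wconv_unitl ip _ _ hc).
Qed.

Lemma wconv_cst_mulx e i c (h : word -> R) I : hpar e c ->
  wcv (fun K => pexp (wp K) c * xword i K) h I = pexp (wp I) c * omulx_word i h I.
Proof. by move=> hc; rewrite (wconv_cst _ _ hc (whom_xword i)) wconv_xword. Qed.

Definition nshift X : nfock := fun M I => if M is M'.+1 then X M' I else 0.

Lemma nconv_shift X Y M I : ncv (nshift X) Y M I = nshift (ncv X Y) M I.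
Proof.
rewrite /nconv big_ord_recl wconv_eq0l // add0r.
by case: M => [|M]; [rewrite big_ord0|apply: eq_bigr => j _].
Qed.

Definition nunitc (c : R) : nfock := fun M I => if M is 0%N then unitw c I else 0.

Lemma nconv_unitc e c Y M I : hpar e c -> ncv (nunitc c) Y M I = pexp (wp I) c * Y M I.
Proof.
move=> hc; rewrite /nconv big_ord_recl subn0 (wconv_unitl ip _ _ hc) big1 ?addr0 // => j _.
by apply: wconv_eq0l.
Qed.

Lemma gwhom_unitc e c : hpar e c -> gwh e (nunitc c).
Proof. by move=> hc [|M] K; [apply: whom_unitw|apply: hpar0]. Qed.

Definition toZ X : fock := fun m I => if m is Posz M then X M I else 0.

Variables (t tau : 'I_r -> int -> R) (B phi V : 'I_r -> 'I_r -> nat -> nat -> R).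
Hypotheses (t_even : forall a k, hpar false (t a k)) (tau_odd : forall a k, hpar true (tau a k)).
Hypothesis t0 : forall a, t a 0 = 0.
Hypothesis mero : exists N : int, forall a k, k < N -> t a k = 0 /\ tau a k = 0.
Hypotheses (B_even : forall a b k l, hpar false (B a b k l))
  (phi_odd : forall a b k l, hpar true (phi a b k l))
  (V_even : forall a b k l, hpar false (V a b k l))
  (V_00 : forall a b, V a b 0 0 = 0)
  (B_sym : forall a b k l, B a b k l = B b a l k)
  (V_antisym : forall a b k l, V a b k l = - V b a l k).

Local Notation om s := (om01 t tau s).
Local Notation dP := (dPhi B phi V).

(* [ellmode s] is [om s + hbar * sum_i (cx s i x^i + cd s i d_i)]. *)
Definition cd s i : R :=
  (osc_d C (fneg s) * (i == osc_i s)%:R)%:A + dP (fneg s) i.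
Definition cx s i : R :=
  (osc_x C (fneg s) * (i == osc_i s)%:R)%:A + osc_x C (ann i) *: dP (fneg s) i.

Lemma osc_i_neg s : osc_i (fneg s) = osc_i s.
Proof. by case: s => [[a e] k]; rewrite /osc_i /fneg /= abszN. Qed.

Lemma hpar_scalar (c : C) : hpar false (c%:A : R).
Proof. exact/hparZ/hpar1. Qed.

Lemma hpar_dP u i : hpar (ip i (+) fpar u) (dP u i).
Proof.
have hc j : hpar (ip j (+) fpar u) (cPhi B phi V u j) by apply: hpar_cPhi.
by apply: hparD (hc i) _; apply: hparZ; apply: hpar_cPhi2.
Qed.

Lemma hpar_delta s i (c : C) : hpar (ip i (+) fpar s) ((c * (i == osc_i s)%:R)%:A : R).
Proof.
have [->|_] := eqVneq i (osc_i s).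
  by rewrite ipar_osc_i addbb; apply: hpar_scalar.
by rewrite mulr0 scale0r; apply: hpar0.
Qed.

Lemma hpar_cd s i : hpar (ip i (+) fpar s) (cd s i).
Proof. exact (hparD (hpar_delta s i _) (hpar_dP (fneg s) i)). Qed.

Lemma hpar_cx s i : hpar (ip i (+) fpar s) (cx s i).
Proof. exact (hparD (hpar_delta s i _) (hparZ _ (hpar_dP (fneg s) i))). Qed.

Lemma hpar_om s : hpar (fpar s) (om s).
Proof. exact: hpar_om01. Qed.

Definition nlin N s (h : word -> R) I : R := \sum_(i <- idxs r N)
  (pexp (wp I) (cx s i) * omulx_word i h I + pexp (wp I) (cd s i) * h (i :: I)).

(** [ellmode s] on power series in hbar, with all indices of mode above [N] dropped, so that only
    finite sums and Cauchy products remain. *)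
Definition nell N s X : nfock := fun M I =>
  pexp (wp I) (om s) * X M I + nshift (fun M' => nlin N s (X M')) M I.

Lemma osc_d_ann i : osc_d C (ann i) = 1.
Proof. by case: i => [[a k]|[a k]]. Qed.

Lemma osc_x_ann0 i : (0 < imode i)%N -> osc_x C (ann i) = 0.
Proof. by case: i => [[a k]|[a [|k]]]. Qed.

(** Multiplications occur only for [osc_i s] and the zero modes, all of mode at most [N]; the
    dropped derivatives vanish by the assumption on [X]. *)
Lemma ellmode_toZ N s X m I : (`|s.2| < N)%N ->
  (forall M i, M%:Z + 1 <= m -> (N < imode i)%N -> X M (i :: I) = 0) ->
  ellmode t tau B phi V s (toZ X) m I = toZ (nell N s X) m I.
Proof.
move=> sN far; rewrite /ellmode /ell /oadd.
have far' i : (N < imode i)%N -> toZ X (m - 1) (i :: I) = 0.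
  by move=> hi; case E : (m - 1) => [M|M] //=; apply: far => //; lia.
have isN : osc_i s \in idxs r N.
  by rewrite mem_idxs /osc_i; case: (s.1.2) => /=; lia.
rewrite /annih /ofsum (fsum_idxs (N := N)) => [|i hi]; last first.
  by rewrite /= /ocst oscE osc_x_ann0 ?scale0r ?osc_i_ann ?far' ?scaler0 ?addr0 ?mulr0 //; lia.
have E : osc (fneg s) (toZ X) m I + \sum_(i <- idxs r N) (ocst (dP (fneg s) i) \o osc (ann i)) (toZ X) m I
    = nlin N s (toZ X (m - 1)) I.
  have -> : osc (fneg s) (toZ X) m I = \sum_(i <- idxs r N)
      ((osc_x C (fneg s) * (i == osc_i s)%:R) *: omulx_word i (toZ X (m - 1)) I
       + (osc_d C (fneg s) * (i == osc_i s)%:R) *: toZ X (m - 1) (i :: I)).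
    rewrite (bigD1_seq _ isN (uniq_idxs r N)) /= big1 => [|i /negbTE ->]; last first.
      by rewrite !mulr0 !scale0r addr0.
    by rewrite eqxx !mulr1 addr0 oscE osc_i_neg.
  rewrite -big_split; apply: eq_bigr => i _ /=.
  rewrite /ocst oscE osc_i_ann osc_d_ann scale1r mulrDr /cx /cd; move: (dP (fneg s) i) => d.
  by rewrite !pexpD !mulrDl !pexpZ !pexp1 -!scalerAl !mul1r -scalerAr addrACA.
rewrite addrAC E addrC /nell; case: m far far' E => [M|M] far far' E /=; last first.
  rewrite /ocst /= mulr0 add0r /nlin big1 // => i _.
  by rewrite omulx_word0 // !mulr0 addr0.
rewrite /ocst /=; congr (_ + _); case: M far far' E => [|M] far far' E /=.
  rewrite /nlin big1 // => i _; rewrite (_ : 0%N%:Z - 1 = Negz 0) //.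
  by rewrite omulx_word0 // !mulr0 addr0.
by rewrite (_ : M.+1%:Z - 1 = M%:Z) //; lia.
Qed.

Variable W : nfock.
Hypotheses (Wev : gwh false W) (W0 : forall M, W M [::] = 0).
Hypothesis Wsym : forall M I1 i j I2,
  W M (I1 ++ [:: i, j & I2]) = (-1) ^+ (ip i && ip j) * W M (I1 ++ [:: j, i & I2]).
Hypothesis Wfin : forall k : nat, exists N : nat, forall M I, (M <= k)%N -> (size I <= k)%N ->
  ~~ all (fun i => imode i <= N)%N I -> W M I = 0.

Local Notation Z := (nexp ip W).
(* The mode [ellmode s] acts on Z = exp W as multiplication by [GN N s]; dropping
   the indices of mode above [N] is exact in bounded degree. *)
Definition GN N s : nfock := fun M I => nunitc (om s) M I
  + nshift (fun M' K => \sum_(i <- idxs r N)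
      (nunitc 1 M' [::] * (pexp (wp K) (cx s i) * xword i K) + pexp (wp K) (cd s i) * W M' (i :: K))) M I.

(** The derivative part of a conjugated mode applied to a prefactor G of Z; [nshift] is its factor
    hbar. *)
Definition DN N s (G : nfock) : nfock :=
  nshift (fun M' K => \sum_(i <- idxs r N) pexp (wp K) (cd s i) * G M' (i :: K)).

Lemma gwhom_GN N s : gwh (fpar s) (GN N s).
Proof.
move=> M K; apply: hparD; first exact: gwhom_unitc (hpar_om s) _ _.
case: M => [|M]; first exact: hpar0.
apply: hpar_sum => i; have hK b : (fpar s (+) b) = (ip i (+) fpar s) (+) (ip i (+) b).
  by case: (ip i); case: (fpar s); case: b.
apply: hparD; rewrite hK; last first.
  by apply: hparM; [apply: hpar_pexp; apply: hpar_cd|rewrite -wpar_cons; apply: Wev].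
rewrite -[X in hpar X]addFb; apply: hparM; first by case: M => [|M]; [apply: hpar1|apply: hpar0].
apply: hparM; [apply: hpar_pexp; apply: hpar_cx|exact: whom_xword].
Qed.

Lemma nexp_sder i : (fun M => sder i (Z M)) = ncv (fun M => sder i (W M)) Z.
Proof. by apply: funext => M; apply: funext => K; rewrite /sder nexp_cons. Qed.

(** A derivative of G Z falls on G, which gives [DN], or on Z. In the second case the derivative of
    W moves in front of G, and the sign of this move cancels the one in the Leibniz rule. *)
Lemma nell_mul N s e G M I : gwh e G ->
  nell N s (ncv G Z) M I = ncv (DN N s G) Z M I + ncv (GN N s) (ncv G Z) M I.
Proof.
move=> hG; rewrite /nell.
have -> : ncv (GN N s) (ncv G Z) M I = pexp (wp I) (om s) * ncv G Z M I +
    nshift (fun M' K => \sum_(i <- idxs r N) (pexp (wp K) (cx s i) * omulx_word i (ncv G Z M') K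
       + pexp (wp K) (cd s i) * ncv (fun M => sder i (W M)) (ncv G Z) M' K)) M I.
  rewrite nconvDl (nconv_unitc _ _ _ (hpar_om s)) nconv_shift; congr (_ + _).
  case: M => [|M] //=; rewrite nconv_suml; apply: eq_bigr => i _; rewrite nconvDl; congr (_ + _).
    rewrite /nconv big_ord_recl subn0 big1 ?addr0 => [|j _].
      rewrite -(wconv_cst_mulx _ _ _ (hpar_cx s i)); apply: eq_wconv => // K _.
      by rewrite mul1r.
    by apply: wconv_eq0l => K _; rewrite mul0r.
  rewrite mulr_sumr; apply: eq_bigr => j _.
  by rewrite -(wconv_cst _ _ (hpar_cd s i) (whom_sder i (Wev j))).
rewrite addrCA; congr (_ + _); rewrite nconv_shift; case: M => [|M] /=; first by rewrite addr0.
rewrite nconv_suml -big_split; apply: eq_bigr => i _ /=.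
rewrite [LHS]addrC [RHS]addrCA addrC; congr (_ + _).
have -> : ncv (fun M K => pexp (wp K) (cd s i) * G M (i :: K)) Z M I =
    pexp (wp I) (cd s i) * ncv (fun M => sder i (G M)) Z M I.
  rewrite mulr_sumr; apply: eq_bigr => j _.
  by rewrite -(wconv_cst _ _ (hpar_cd s i) (whom_sder i (hG j))).
rewrite -mulrDr; congr (_ * _).
rewrite (nconv_cons _ _ _ _ hG) nexp_sder; congr (_ + _).
rewrite (nconv_leftC _ _ _ hG (gwhom_sder i Wev)) mulrA -signr_addb addFb addbb mul1r //.
Qed.

(** The series by which two successive modes multiply Z: the outer mode differentiates the factor of
    the inner one or contributes its own factor. *)
Definition QN N s u : nfock := fun M I => DN N s (GN N u) M I + ncv (GN N s) (GN N u) M I.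

Lemma nell_Z N s M I : nell N s Z M I = ncv (GN N s) Z M I.
Proof.
have Z1 M' I' : ncv (nunitc 1) Z M' I' = Z M' I'.
  by rewrite (nconv_unitc _ _ _ (hpar1 R)) pexp1 mul1r.
have E : ncv (nunitc 1) Z = Z by apply: funext => M'; apply: funext => I'.
have := nell_mul N s M I (gwhom_unitc (hpar1 R)); rewrite E => ->.
rewrite nconv_shift [X in X + _](_ : _ = 0) ?add0r //; case: M => [|M] //=.
rewrite nconv_suml big1 // => i _; apply: big1 => j _; apply: wconv_eq0l => K _.
by case: (nat_of_ord j) => [|j'] /=; rewrite mulr0.
Qed.

Lemma nell_nell N s u M I : nell N s (nell N u Z) M I = ncv (QN N s u) Z M I.
Proof.
rewrite (_ : nell N u Z = ncv (GN N u) Z); last first.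
  by apply: funext => M'; apply: funext => I'; apply: nell_Z.
rewrite (nell_mul _ _ _ _ (gwhom_GN N u)) /QN nconvDl; congr (_ + _).
exact: nconvA (gwhom_GN N s) (gwhom_GN N u).
Qed.

Definition wsym (f : word -> R) := forall I1 i j I2,
  f (I1 ++ [:: i, j & I2]) = (-1) ^+ (ip i && ip j) * f (I1 ++ [:: j, i & I2]).

Lemma wsym_sder i (f : word -> R) : wsym f -> wsym (sder i f).
Proof. by move=> sf I1; apply: (sf (i :: I1)). Qed.

Lemma wconv_sym e (f g : word -> R) : whm e f -> wsym f -> wsym g -> wsym (wcv f g).
Proof.
move=> hf sf sg I1; elim: I1 e f g hf sf sg => [|k I1 IH] e f g hf sf sg i j I2 /=; last first.
  rewrite !(wconv_cons _ _ _ hf) (IH _ _ _ (whom_sder k hf) (wsym_sder k sf) sg).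
  rewrite (IH _ _ _ hf sf (wsym_sder k sg)) mulrDr; congr (_ + _); exact: signM_comm.
rewrite !(wconv_cons _ _ _ hf, wconv_cons _ _ _ (whom_sder _ hf)) !mulrDr.
have E (h h' : word -> R) : wsym h -> wsym h' ->
    wcv (sder j (sder i h)) h' I2 = (-1) ^+ (ip i && ip j) * wcv (sder i (sder j h)) h' I2.
  move=> sh _; rewrite -wconv_signl; apply: eq_wconv => // K _; exact: (sh [::] i j K).
have E' (h h' : word -> R) : wsym h' ->
    wcv h (sder j (sder i h')) I2 = (-1) ^+ (ip i && ip j) * wcv h (sder i (sder j h')) I2.
  move=> sh; rewrite -wconv_signr; apply: eq_wconv => // K _; exact: (sh [::] i j K).
rewrite (E _ _ sf sg) (E' _ _ sg) !mulrA -!signr_addb -!addrA; congr (_ + _).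
rewrite addrCA; congr (_ * _ + (_ * _ + _ * _)); congr (_ ^+ (nat_of_bool _));
  by case: (e); case: (ip i); case: (ip j).
Qed.

Lemma wsym_nconv e X Y : gwh e X -> (forall M, wsym (X M)) -> (forall M, wsym (Y M)) ->
  forall M, wsym (ncv X Y M).
Proof.
move=> hX sX sY M I1 i j I2; rewrite /nconv mulr_sumr; apply: eq_bigr => k _.
exact: wconv_sym (hX k) (sX k) (sY _) I1 i j I2.
Qed.

Lemma wsym_npow n M : wsym (npow ip W n M).
Proof.
elim: n M => [|n IH] M; last exact: wsym_nconv Wev Wsym IH M.
move=> I1 i j I2; rewrite /npow /= /nunit; case: M => [|M]; last by rewrite mulr0.
by case: I1 => [|k I1]; rewrite /= mulr0.
Qed.

Lemma wsym_nexp M : wsym (Z M).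
Proof.
move=> I1 i j I2; rewrite /nexp !size_cat /= mulr_sumr; apply: eq_bigr => n _.
by rewrite wsym_npow scalerAr.
Qed.

Definition boxed N I := all (fun i => imode i <= N)%N I.

Lemma mem_mask_split (T : eqType) (b : bitseq) (s : seq T) x : size b = size s ->
  x \in s -> x \in mask b s ++ mask (map negb b) s.
Proof.
elim: s b => // y s IH [|c b] //= [szb]; rewrite inE => /orP[/eqP ->|xs].
  by case: c; rewrite ?mem_cat !inE eqxx ?orbT.
have := IH b szb xs; case: c; rewrite /= ?mem_cat ?inE ?mem_cat => /orP[] ->;
  by rewrite ?orbT.
Qed.

Lemma wconv_box N n (f g : word -> R) :
  (forall I, (size I <= n)%N -> ~~ boxed N I -> f I = 0) ->
  (forall I, (size I <= n)%N -> ~~ boxed N I -> g I = 0) ->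
  forall I, (size I <= n)%N -> ~~ boxed N I -> wcv f g I = 0.
Proof.
move=> hf hg I In hI; rewrite /wconv big1 // => b _ /=.
have sz (b' : bitseq) : size b' = size I -> (size (mask b' I) <= n)%N.
  by move=> h; apply: leq_trans In; rewrite size_mask // -h count_size.
case h1 : (boxed N (mask b I)); last by rewrite hf ?pexp0 ?mulr0 ?mul0r ?h1 // sz // size_tuple.
case h2 : (boxed N (mask (map negb b) I)); last by rewrite hg ?mulr0 ?h2 // sz // size_map size_tuple.
case/negP: hI; apply/allP => i iI.
have := mem_mask_split (size_tuple b) iI.
by rewrite mem_cat => /orP[ii|ii]; [move/allP: h1 => /(_ _ ii)|move/allP: h2 => /(_ _ ii)].
Qed.

Lemma npow_box k N : (forall M I, (M <= k)%N -> (size I <= k)%N -> ~~ boxed N I -> W M I = 0) ->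
  forall n M I, (M <= k)%N -> (size I <= k)%N -> ~~ boxed N I -> npow ip W n M I = 0.
Proof.
move=> hW; elim=> [|n IH] M I Mk Ik hI.
  by rewrite /npow /= /nunit; case: M Mk => //; case: I Ik hI.
rewrite npowS /nconv big1 // => j _.
apply: (@wconv_box N k) => // K Kk hK; first by apply: hW => //; have := ltn_ord j; lia.
by apply: IH => //; lia.
Qed.

Lemma nexp_box k N : (forall M I, (M <= k)%N -> (size I <= k)%N -> ~~ boxed N I -> W M I = 0) ->
  forall M I, (M <= k)%N -> (size I <= k)%N -> ~~ boxed N I -> Z M I = 0.
Proof.
move=> hW M I Mk Ik hI; rewrite /nexp big1 // => n _.
by rewrite (npow_box hW) ?scaler0.
Qed.

Lemma good_Z : good (toZ Z).
Proof.
split=> [[M|M] I1 i j I2|k] /=; first exact: wsym_nexp; first by rewrite mulr0.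
have [N hN] := Wfin k; exists N => -[M|M] I mk Ik hb //=.
by apply: (nexp_box hN) => //; move: hb; rewrite /inbox /boxed /=; lia.
Qed.

Lemma nell_box N u k : (forall M I, (M <= k)%N -> (size I <= k)%N -> ~~ boxed N I -> Z M I = 0) ->
  forall M i I, (M < k)%N -> (size I < k.-1)%N -> (N < imode i)%N -> nell N u Z M (i :: I) = 0.
Proof.
move=> hZ M i I Mk Ik hi.
have z M' K : (M' <= M)%N -> (size K <= size I)%N -> Z M' (i :: K) = 0.
  by move=> h1 h2; apply: hZ => /=; [lia|lia|rewrite /boxed /= leqNgt hi].
rewrite /nell z // mulr0 add0r; case: M Mk z => [|M] Mk z //=.
rewrite /nlin big_seq big1 // => j; rewrite mem_idxs => jN /=.
have -> : (j == i) = false by apply: contraTF jN => /eqP ->; rewrite -ltnNge.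
rewrite mul0r add0r omulx_word0 => [|K hK]; last by apply: z; lia.
have -> : Z M [:: j, i & I] = 0.
  by apply: hZ => /=; [lia|lia|rewrite /boxed /= (leqNgt (imode i)) hi andbF].
by rewrite !mulr0 addr0.
Qed.

Definition irange (K : nat) : seq int := [seq z - K%:Z | z <- map Posz (iota 0 (K + K).+1)].

Lemma mem_irange K z : (z \in irange K) = (`|z| <= K)%N.
Proof.
apply/mapP/idP => [[x /mapP[y]]|h].
  by rewrite mem_iota => hy -> ->; lia.
exists (z + K%:Z); last by rewrite addrK.
by apply/mapP; exists (absz (z + K%:Z)); [rewrite mem_iota|]; lia.
Qed.

Lemma uniq_irange K : uniq (irange K).
Proof.
rewrite map_inj_uniq; last by move=> x y; lia.
by rewrite map_inj_uniq ?iota_uniq // => x y [].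
Qed.

Lemma seq_bound (s : seq int) : exists K : nat, forall z, (K < `|z|)%N -> z \notin s.
Proof.
elim: s => [|x s [K hK]]; first by exists 0%N.
exists (maxn K `|x|)%N => z hz; rewrite inE negb_or; apply/andP; split; last by apply: hK; lia.
by apply: contraTneq hz => ->; lia.
Qed.

Definition nh2 : nfock := nshift (nshift (nunitc 1)).

Lemma toZ_sub2 X M I : toZ X (M%:Z - 2) I = nshift (nshift X) M I.
Proof.
case: M => [|[|M]]; [by []|by []|].
by have -> : M.+2%:Z - 2 = M%:Z by lia.
Qed.

Lemma nconv_nh2 M I : ncv nh2 Z M I = toZ Z (M%:Z - 2) I.
Proof.
rewrite toZ_sub2 /nh2 nconv_shift; case: M => [|M] //=; rewrite nconv_shift; case: M => [|M] //=.
by rewrite (nconv_unitc _ _ _ (hpar1 R)) pexp1 mul1r.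
Qed.

Definition QNv N s u (v : C) : nfock := fun M I => QN N s u M I + v *: nh2 M I.

(** Two conjugated modes are applied, each with locality loss 2, hence [n + 4]. The bound on [N]
    leaves room for all indices with |j| at most [K]. *)
Lemma newfam_Z a e e' L k (n N K : nat) : (K + `|L| < N)%N ->
  (forall M I, (M <= n + 4)%N -> (size I <= n + 4)%N -> ~~ boxed N I -> Z M I = 0) ->
  forall j M I, (`|j| <= K)%N -> (M <= n)%N -> (size I <= n)%N ->
  newfam t tau B phi V a e e' L k j (toZ Z) M%:Z I =
    k j *: ncv (QNv N (mode a e j) (mode a e' (- (L + j)))
                   (- vv C (mode a e (- j)) (mode a e' (L + j)))) Z M I.
Proof.
move=> KN hZ j M I jK Mn In; rewrite /newfam /pfam /= /oscale /oadd /=; congr (_ *: _).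
rewrite /QNv nconvDl nconvZl nconv_nh2; congr (_ + _).
set s := mode a e j; set u := mode a e' _.
have lell v : lop 2 (ellmode t tau B phi V v).
  apply: lop_add; last exact: lop_annih.
  by apply: lop_add; [apply: lop_osc|apply: lop_le (@lop_cst C R r _)].
have ag : agree (n + 2) (ellmode t tau B phi V u (toZ Z)) (toZ (nell N u Z)).
  move=> m' I' hm hI; apply: ellmode_toZ; first by rewrite /u /mode /=; lia.
  by move=> M' i hM hi; apply: hZ => /=; [lia|lia|rewrite /boxed /= leqNgt hi].
rewrite (lop_local (lell s) ag) //.
rewrite (@ellmode_toZ N) /=; [|by rewrite /s /mode /=; lia|].
  exact: nell_nell.
move=> M' i hM hi; apply: (@nell_box N u (n + 4)) => //; lia.
Qed.

(** [K] is fixed by the degree alone; [N] comes after [K] because every mode index in the finite sum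
    has to lie below [N]. *)
Lemma ofsum_newfam_Z a e e' L k n : exists K0 : nat, forall K, (K0 <= K)%N ->
  exists N0 : nat, forall N, (N0 <= N)%N -> forall M I, (M <= n)%N -> (size I <= n)%N ->
  ofsum (newfam t tau B phi V a e e' L k) (toZ Z) M%:Z I =
  ncv (fun M I => \sum_(j <- irange K) k j *: QNv N (mode a e j) (mode a e' (- (L + j)))
                   (- vv C (mode a e (- j)) (mode a e' (L + j))) M I) Z M I.
Proof.
have sm := summable_newfam t_even tau_odd t0 mero B_even phi_odd V_even V_00 B_sym V_antisym
  a e e' L k good_Z.
have [s hs] := sm n; have [K0 hK0] := seq_bound s; exists K0 => K hK.
have [N1 hN1] := Wfin (n + 4)%N; exists (maxn N1 (K + `|L|).+1) => N hN M I Mn In.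
have hZ : forall M I, (M <= n + 4)%N -> (size I <= n + 4)%N -> ~~ boxed N I -> Z M I = 0.
  apply: nexp_box => M' I' h1 h2 hb; apply: hN1 => //; apply: contra hb.
  by apply: sub_all => x /leq_trans; apply; lia.
rewrite /ofsum (fsum_seq (uniq_irange K)) => [|j hj]; last first.
  apply: (hs j) => //; apply: hK0; move: hj; rewrite mem_irange; lia.
rewrite nconv_suml big_seq [RHS]big_seq; apply: eq_bigr => j; rewrite mem_irange => hj.
by rewrite nconvZl; apply: (@newfam_Z _ _ _ _ _ n N K) => //; lia.
Qed.

(** In bounded degree the sum over all modes has become one over [irange K], and there Z can be
    cancelled by [nconv_inj]. *)
Lemma Gtilde_relation a n0 n : (forall m I, oGtilde t tau B phi V a n0 (toZ Z) m I = 0) ->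
  exists K0 : nat, forall K, (K0 <= K)%N -> exists N0 : nat, forall N, (N0 <= N)%N ->
  forall M I, (M <= n)%N -> (size I <= n)%N ->
  \sum_(j <- irange K) kJ C j *: QNv N (mode a false j) (mode a true (- (2 * n0 + 1 + j)))
     (- vv C (mode a false (- j)) (mode a true (2 * n0 + 1 + j))) M I = 0.
Proof.
move=> hG; have [K0 hK0] := ofsum_newfam_Z a false true (2 * n0 + 1) (kJ C) n.
exists K0 => K hK; have [N0 hN0] := hK0 K hK; exists N0 => N hN.
pose X : nfock := fun M I => \sum_(j <- irange K) kJ C j *:
  QNv N (mode a false j) (mode a true (- (2 * n0 + 1 + j)))
     (- vv C (mode a false (- j)) (mode a true (2 * n0 + 1 + j))) M I.
apply: (@nconv_inj _ _ _ ip X Z n (nexp_nil ip W)) => M I Mn In.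
rewrite -(hN0 N hN) // -(oGtildeE t_even tau_odd t0 mero B_even phi_odd V_even V_00 B_sym V_antisym) //.
exact: good_Z.
Qed.

Lemma Ltilde_relation a n0 n : (forall m I, oLtilde t tau B phi V a n0 (toZ Z) m I = 0) ->
  exists K0 : nat, forall K, (K0 <= K)%N -> exists N0 : nat, forall N, (N0 <= N)%N ->
  forall M I, (M <= n)%N -> (size I <= n)%N ->
  2^-1 *: (\sum_(j <- irange K) kJ C j *: QNv N (mode a false j) (mode a false (- (2 * n0 + j)))
     (- vv C (mode a false (- j)) (mode a false (2 * n0 + j))) M I)
  + 2^-1 *: (\sum_(j <- irange K) kG C n0 j *: QNv N (mode a true j) (mode a true (- (2 * n0 + j)))
     (- vv C (mode a true (- j)) (mode a true (2 * n0 + j))) M I)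
  + ((n0 == 0)%:R / 4) *: nh2 M I = 0.
Proof.
move=> hL; have [K1 hK1] := ofsum_newfam_Z a false false (2 * n0) (kJ C) n.
have [K2 hK2] := ofsum_newfam_Z a true true (2 * n0) (kG C n0) n.
exists (maxn K1 K2) => K hK; have [N1 hN1] := hK1 K ltac:(lia); have [N2 hN2] := hK2 K ltac:(lia).
exists (maxn N1 N2) => N hN.
pose X : nfock := fun M I =>
  2^-1 *: (\sum_(j <- irange K) kJ C j *: QNv N (mode a false j) (mode a false (- (2 * n0 + j)))
     (- vv C (mode a false (- j)) (mode a false (2 * n0 + j))) M I)
  + 2^-1 *: (\sum_(j <- irange K) kG C n0 j *: QNv N (mode a true j) (mode a true (- (2 * n0 + j)))
     (- vv C (mode a true (- j)) (mode a true (2 * n0 + j))) M I)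
  + ((n0 == 0)%:R / 4) *: nh2 M I.
apply: (@nconv_inj _ _ _ ip X Z n (nexp_nil ip W)) => M I Mn In.
rewrite /X !nconvDl !nconvZl -hN1 -?hN2 //; try lia.
rewrite nconv_nh2 -[RHS](hL M%:Z I).
by rewrite (oLtildeE t_even tau_odd t0 mero B_even phi_odd V_even V_00 B_sym V_antisym) //; exact: good_Z.
Qed.

End PartitionFunction.
(** * From series to multidifferentials *)

Section Evaluation.
Variables (C : numClosedFieldType) (R : supalg C) (r : nat).

Local Notation word := (seq (idx r)).
Local Notation nfock := (nat -> word -> R).
Local Notation ip := (@ipar r).
Local Notation wp := (wpar (@ipar r)).
Local Notation fp := (@fpar r).
Local Notation wcv := (@wconv C R (idx r) ip).
Local Notation ncv := (@nconv C R (idx r) ip).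
Local Notation whm := (@whom C R (idx r) ip).
Local Notation gwh := (@gwhom C R (idx r) ip).

Implicit Types (X Y : nfock) (I K : word) (s u : oneform r) (T : seq (oneform r)).

Variable cf : oneform r -> idx r -> R.
Hypothesis hcf : forall s i, hpar (ip i (+) fp s) (cf s i).
Variable N : nat.

Definition sdN s (f : word -> R) : word -> R :=
  fun K => \sum_(i <- idxs r N) pexp (wp K) (cf s i) * f (i :: K).

(* Substitutes d xi_{-i} for x^i, over the i of mode at most [N], and takes the
   coefficient of the forms [T]. *)
Fixpoint evN (f : word -> R) T : R :=
  if T is s :: T' then evN (sdN s f) T' else f [::].

Lemma whom_sdN e s f : whm e f -> whm (e (+) fp s) (sdN s f).
Proof.
move=> hf K; apply: hpar_sum => i.
rewrite (_ : _ (+) _ = (ip i (+) fp s) (+) (e (+) wp (i :: K))).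
  by apply: hparM (hf _); apply: hpar_pexp.
by rewrite wpar_cons; case: (e); case: (ip i); case: (fp s); case: (wp K).
Qed.

Lemma whom_evN e f : whm e f -> @whom C R _ fp e (evN f).
Proof.
move=> hf T; elim: T e f hf => [|s T IH] e f hf /=; first by rewrite addbF; exact: whom_nil hf.
by rewrite wpar_cons addbA; apply: IH; apply: whom_sdN.
Qed.

(** The coefficient [cf s i] has the combined parity of i and s, so it turns a derivation of the
    parity of i into one of the parity of s. *)
Lemma sdN_wconv e s f g : whm e f ->
  sdN s (wcv f g) = fun K => wcv (sdN s f) g K + (-1) ^+ (e && fp s) * wcv f (sdN s g) K.
Proof.
move=> hf; apply: funext => K; rewrite wconv_suml wconv_sumr mulr_sumr -big_split.
apply: eq_bigr => i _; rewrite (wconv_cons _ _ _ hf) mulrDr; congr (_ + _).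
  by rewrite -(wconv_cst _ _ (hcf s i) (whom_sder i hf)).
have hu := @whom_unitw C R (idx r) ip _ _ (hcf s i).
rewrite signM_comm -(wconv_unitl ip _ _ (hcf s i)) (wconv_leftC _ _ hu hf) mulrA -signr_addb.
rewrite (_ : _ (+) _ = e && fp s); last by case: (e); case: (ip i); case: (fp s).
by congr (_ * _); apply: eq_wconv => // K' _; rewrite (wconv_unitl ip _ _ (hcf s i)).
Qed.

Lemma evN_sum (U : Type) (l : seq U) (c : U -> C) (f : U -> word -> R) T :
  evN (fun K => \sum_(x <- l) c x *: f x K) T = \sum_(x <- l) c x *: evN (f x) T.
Proof.
elim: T f => [|s T IH] f //=; rewrite -IH; congr evN; apply: funext => K.
rewrite /sdN; under eq_bigr => i _ do rewrite mulr_sumr.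
by rewrite exchange_big; apply: eq_bigr => x _; rewrite scaler_sumr; apply: eq_bigr => i _; rewrite scalerAr.
Qed.

Lemma evND f g T : evN (fun K => f K + g K) T = evN f T + evN g T.
Proof.
have := evN_sum [:: true; false] (fun=> 1) (fun b => if b then f else g) T.
rewrite !big_cons big_nil !scale1r addr0 => <-; congr evN; apply: funext => K.
by rewrite !big_cons big_nil !scale1r addr0.
Qed.

Lemma evNZ c f T : evN (fun K => c *: f K) T = c *: evN f T.
Proof.
have := evN_sum [:: tt] (fun=> c) (fun=> f) T; rewrite big_cons big_nil addr0 => <-.
by congr evN; apply: funext => K; rewrite big_cons big_nil addr0.
Qed.

Lemma evN_sign n f T : evN (fun K => (-1) ^+ n * f K) T = (-1) ^+ n * evN f T.
Proof.
rewrite -scale_sign -evNZ; congr evN; apply: funext => K; by rewrite scale_sign.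
Qed.

Lemma eq_evN f g T : (forall K, size K = size T -> f K = g K) -> evN f T = evN g T.
Proof.
elim: T f g => [|s T IH] f g h /=; first exact: h.
by apply: IH => K hK; apply: eq_bigr => i _; rewrite h //= hK.
Qed.

Lemma evN0 f T : (forall K, size K = size T -> f K = 0) -> evN f T = 0.
Proof.
move=> h; rewrite (@eq_evN _ (fun K => (0 : C) *: f K)) ?evNZ ?scale0r // => K hK.
by rewrite h // scaler0.
Qed.

(** Each product is determined by its Leibniz rule, and [sdN] carries one rule into the other. *)
Lemma evN_wconv e f g T : whm e f -> evN (wcv f g) T = @wconv C R _ fp (evN f) (evN g) T.
Proof.
elim: T e f g => [|s T IH] e f g hf /=; first by rewrite !wconv_nil.
rewrite (wconv_cons _ _ _ (whom_evN hf)) (sdN_wconv _ _ hf) evND evN_sign.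
by rewrite (IH _ _ _ (whom_sdN s hf)) (IH _ _ _ hf).
Qed.

Lemma evN_nconv e X Y M T : gwh e X ->
  evN (ncv X Y M) T = @nconv C R _ fp (fun M => evN (X M)) (fun M => evN (Y M)) M T.
Proof.
move=> hX; rewrite /nconv (_ : (fun I => _) = fun I => \sum_(j <- index_enum 'I_M.+1)
   (1 : C) *: wcv (X j) (Y (M - j)%N) I); last first.
  by apply: funext => I; apply: eq_bigr => j _; rewrite scale1r.
by rewrite evN_sum; apply: eq_bigr => j _; rewrite scale1r (evN_wconv _ _ (hX j)).
Qed.

(** The signs from exchanging the variables and from exchanging the coefficients combine into the
    sign of the two forms. *)
Lemma sdN_swap s u f : (forall i j K, f [:: i, j & K] = (-1) ^+ (ip i && ip j) * f [:: j, i & K]) ->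
  sdN s (sdN u f) = fun K => (-1) ^+ (fp s && fp u) * sdN u (sdN s f) K.
Proof.
move=> sf; apply: funext => K; rewrite /sdN.
under eq_bigr => i _ do rewrite mulr_sumr.
under [in RHS]eq_bigr => i _ do rewrite mulr_sumr.
rewrite exchange_big /= mulr_sumr; apply: eq_bigr => j _; rewrite mulr_sumr; apply: eq_bigr => i _.
have E i' j' s' : pexp (wp (i' :: K)) (cf s' j') =
    (-1) ^+ (ip i' && (ip j' (+) fp s')) * pexp (wp K) (cf s' j').
  by rewrite wpar_cons -pexp_addb (hpar_pexpE (ip i') (hpar_pexp (wp K) (hcf s' j'))).
have AB := supcommE (hpar_pexp (wp K) (hcf s i)) (hpar_pexp (wp K) (hcf u j)).
rewrite !E (sf i j); move: AB; set A := pexp _ (cf s i); set A' := pexp _ (cf u j) => AB.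
rewrite -!mulrA !(signM_comm _ A) !(signM_comm _ A') (mulrA A) AB.
rewrite !mulrA -!signr_addb; congr (_ ^+ (nat_of_bool _) * _ * _ * _).
by case: (ip i); case: (ip j); case: (fp s); case: (fp u).
Qed.

End Evaluation.

(** * Basis forms and bidifferential as coefficients of the conjugated modes *)

Section Basis.
Variables (C : numClosedFieldType) (R : supalg C) (r : nat).

Local Notation word := (seq (idx r)).
Local Notation ip := (@ipar r).
Local Notation wp := (wpar (@ipar r)).
Local Notation fp := (@fpar r).

Implicit Types (I K : word) (s u : oneform r) (T : seq (oneform r)).

Variables (B phi V : 'I_r -> 'I_r -> nat -> nat -> R).
Hypotheses (B_even : forall a b k l, hpar false (B a b k l))
  (phi_odd : forall a b k l, hpar true (phi a b k l))
  (V_even : forall a b k l, hpar false (V a b k l))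
  (V_00 : forall a b, V a b 0 0 = 0)
  (B_sym : forall a b k l, B a b k l = B b a l k)
  (V_antisym : forall a b k l, V a b k l = - V b a l k).

Definition odxi (i : idx r) s : R :=
  let: (b, e, m) := s in
  match i with
  | inl (a, k') => let k := k'.+1 in
      (if e then 0 else ((b == a) && (m == - k%:Z))%:R)
      + (k%:R)^-1 *:
        match m with
        | Posz l =>
            if e then phi a b k l + 2^-1 *: \sum_c V c b 0%N l * phi a c k 0%N
            else if (0 < l)%N then
              B a b k l + 2^-1 *: \sum_c phi b c l 0%N * phi a c k 0%N
            else 0
        | _ => 0
        end
  | inr (a, 0%N) =>
      (if e then ((b == a) && (m == 0))%:R else 0)
      + match m with
        | Posz l =>
            if (0 < l)%N then if e then V a b 0%N l else phi b a l 0%N else 0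
        | _ => 0
        end
  | inr (a, k) =>
      (if e then ((b == a) && (m == - k%:Z))%:R else 0)
      + match m with
        | Posz l =>
            if e then V a b k l + 2^-1 *: \sum_c V a c k 0%N * V c b 0%N l
            else if (0 < l)%N then
              phi b a l k + 2^-1 *: \sum_c V a c k 0%N * phi b c l 0%N
            else 0
        | _ => 0
        end
  end.

Definition oBreg s1 s2 : R :=
  match s1, s2 with
  | (a, e1, Posz k), (b, e2, Posz l) =>
      match e1, e2 with
      | false, false => if (0 < k)%N && (0 < l)%N then B a b k l else 0
      | false, true =>
          if (0 < k)%N then (1 - (l == 0)%:R / 2) *: phi a b k l else 0
      | true, false =>
          if (0 < l)%N then (1 - (k == 0)%:R / 2) *: phi b a l k else 0
      | true, true =>
          (1 - (k == 0)%:R / 2 - (l == 0)%:R / 2) *: V a b k l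
      end
  | _, _ => 0
  end.

(* Coefficients of the expansion of B^R for |z_1| < |z_2|. *)
Definition sing s u : C :=
  if (s.1 == u.1) && (s.2 == - u.2) then
    if s.1.2 then (if 0 < s.2 then 1 else if s.2 == 0 then 2^-1 else 0)
    else (if 0 < s.2 then s.2%:~R else 0)
  else 0.

Local Notation cP := (cPhi B phi V).
Local Notation dP := (dPhi B phi V).

Lemma cPhi_true (b : 'I_r) (l : nat) i : cP (b, true, - l%:Z) i =
  match i with inl (a, k) => (k.+1%:R)^-1 *: phi a b k.+1 l | inr (a, k) => V a b k l end.
Proof.
rewrite /cPhi /osc_i /= abszN /pair /= eqxx opprK eqxx /= scale1r.
case: i => [[a k]|[a k]]; rewrite /fpar /= ?mul1r //.
by rewrite expr1 mulN1r scaleNr opprK.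
Qed.

Lemma cPhi_false (b : 'I_r) (l : nat) i : cP (b, false, - l.+1%:Z) i =
  match i with inl (a, k) => (k.+1%:R)^-1 *: B a b k.+1 l.+1 | inr (a, k) => phi b a l.+1 k end.
Proof.
rewrite /cPhi /osc_i /= /pair /= eqxx opprK eqxx /=.
have nz n : n.+1%:R != 0 :> C by rewrite pnatr_eq0.
case: i => [[a k]|[a k]]; rewrite /fpar /= ?mul1r.
  by rewrite scalerA invfM mulrCA -pmulrn mulfV ?mulr1.
by rewrite expr1 mulN1r scaleNr opprK scalerA -pmulrn mulfV ?scale1r.
Qed.

Lemma cPhi_0 (b : 'I_r) i : cP (b, false, 0) i = 0.
Proof. by rewrite /cPhi /pair /osc_i /= andbF scale0r. Qed.

Lemma cPhi_pos (b : 'I_r) e (l : nat) i : cP (b, e, l.+1%:Z) i = 0.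
Proof.
rewrite /cPhi /pair /osc_i; case: e => /=; rewrite (_ : (_ == _ :> int) = false) ?andbF ?scale0r //;
  by apply/negbTE/eqP; lia.
Qed.

(** The regular part of d xi_{-i}, with the factors in the order in which the commutators with log
    Phi produce them; [odxi] has some of these products reversed. *)
Definition oddx (i : idx r) s : R :=
  match s, i with
  | (b, true, Posz l), inl (a, k) =>
      (k.+1%:R)^-1 *: (phi a b k.+1 l + 2^-1 *: \sum_c V c b 0%N l * phi a c k.+1 0%N)
  | (b, true, Posz l), inr (a, k) => V a b k l + 2^-1 *: \sum_c V c b 0%N l * V a c k 0%N
  | (b, false, Posz l.+1), inl (a, k) =>
      (k.+1%:R)^-1 *: (B a b k.+1 l.+1 + 2^-1 *: \sum_c phi b c l.+1 0%N * phi a c k.+1 0%N)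
  | (b, false, Posz l.+1), inr (a, k) =>
      phi b a l.+1 k + 2^-1 *: \sum_c phi b c l.+1 0%N * V a c k 0%N
  | _, _ => 0
  end.

Lemma dPhiE s i : dP (fneg s) i = oddx i s.
Proof.
have z c j := cPhi_true c 0 j.
have zE c j : cP (ann (zeromode c)) j = cP (c, true, - 0%N%:Z) j by [].
case: s => [[b e] [l|l]]; last first.
  rewrite /dPhi /cPhi2 /fneg /= NegzE opprK cPhi_pos add0r big1 ?scaler0 //.
    by case: e; case: i => [[a k]|[a k]].
  by move=> c _; rewrite cPhi_pos mul0r.
rewrite /dPhi /cPhi2 /fneg /=; case: e.
  rewrite cPhi_true; under eq_bigr => c _ do rewrite cPhi_true zE z.
  case: i => [[a k]|[a k]] //=; rewrite scalerDr; congr (_ + _).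
  rewrite scalerA mulrC -scalerA; congr (_ *: _); rewrite scaler_sumr.
  by apply: eq_bigr => c _; rewrite scalerAr.
case: l => [|l].
  rewrite oppr0 cPhi_0 add0r big1 ?scaler0 //.
  by move=> c _; rewrite cPhi_0 mul0r.
rewrite cPhi_false; under eq_bigr => c _ do rewrite cPhi_false zE z.
case: i => [[a k]|[a k]] //=; rewrite scalerDr; congr (_ + _).
rewrite scalerA mulrC -scalerA; congr (_ *: _); rewrite scaler_sumr.
by apply: eq_bigr => c _; rewrite scalerAr.
Qed.

Lemma natr_alg (b : bool) : b%:R = (b%:R : C)%:A :> R.
Proof. by case: b; rewrite ?scale1r ?scale0r. Qed.

(** The commutators with log Phi reproduce the corrections in the basis. The formula for d eta_{a,0}
    is the general one at k = 0, since its correction carries a factor V_{00} = 0. *)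
Lemma odxiE i s : odxi i s = cd B phi V s i.
Proof.
have Z0 (x : R) (P : pred 'I_r) : 2^-1 *: (\sum_(c | P c) 0 : R) = 0 by rewrite big1 ?scaler0.
rewrite /cd dPhiE; case: s => [[b e] m].
have inlE (x y : 'I_r * nat) : (inl x == inl y :> idx r) = (x == y) by [].
have inrE (x y : 'I_r * nat) : (inr x == inr y :> idx r) = (x == y) by [].
have -> : ((osc_d C (fneg (b, e, m)) * (i == osc_i (b, e, m))%:R)%:A : R) =
    (match i with inl (a, k) => ~~ e && ((b == a) && (m == - k.+1%:Z))
                | inr (a, k) => e && ((b == a) && (m == - k%:Z)) end : bool)%:R.
  rewrite [RHS]natr_alg; congr (_ *: _).
  case: i => [[a k]|[a k]]; case: e => //=; rewrite /osc_d /osc_i /= ?inlE ?inrE ?mulr0 //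
    -natrM mulnb xpair_eqE (eq_sym a);
    congr (nat_of_bool _)%:R; case: (b == a); rewrite ?andbF //=; lia.
have Vc a k b' l : \sum_c V a c k 0%N * V c b' 0%N l = \sum_c V c b' 0%N l * V a c k 0%N.
  by apply: eq_bigr => c _; rewrite (supcommE (V_even _ _ _ _) (V_even _ _ _ _)) mul1r.
have Vphi a k b' l : \sum_c V a c k 0%N * phi b' c l 0%N = \sum_c phi b' c l 0%N * V a c k 0%N.
  by apply: eq_bigr => c _; rewrite (supcommE (V_even _ _ _ _) (phi_odd _ _ _ _)) mul1r.
have V0 a b' l : 2^-1 *: (\sum_c V c b' 0%N l * V a c 0%N 0%N) = 0 :> R.
  by rewrite big1 ?scaler0 // => c _; rewrite V_00 mulr0.
have P0 a b' l : 2^-1 *: (\sum_c phi b' c l 0%N * V a c 0%N 0%N) = 0 :> R.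
  by rewrite big1 ?scaler0 // => c _; rewrite V_00 mulr0.
rewrite /odxi; case: i => [[a k]|[a [|k]]]; case: e; case: m => [[|l]|l] //=;
  rewrite ?scaler0 ?Vc ?Vphi ?V0 ?P0 ?V_00 ?addr0 //.
Qed.

(* The terms in x^i of [GN N s], after the substitution. *)
Definition upN N s u : R := \sum_(i <- idxs r N) cd B phi V u i * pexp (ip i) (cx B phi V s i).

(** Multiplication occurs in the conjugated mode only through the mode itself and, with weight 1/2,
    through the zero modes produced by log Phi. *)
Lemma upN_zeromodes N s u : (`|s.2| < N)%N -> upN N s u = osc_x C (fneg s) *: odxi (osc_i s) u
  + 2^-1 *: \sum_c odxi (zeromode c) u * pexp true (oddx (zeromode c) s).
Proof.
move=> sN; rewrite /upN.
have isN : osc_i s \in idxs r N by rewrite mem_idxs /osc_i; case: (s.1.2) => /=; lia.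
have -> : \sum_(i <- idxs r N) cd B phi V u i * pexp (ip i) (cx B phi V s i) =
    \sum_(i <- idxs r N) (osc_x C (fneg s) * (i == osc_i s)%:R) *: odxi i u +
    \sum_(i <- idxs r N) osc_x C (ann i) *: (odxi i u * pexp (ip i) (oddx i s)).
  rewrite -big_split; apply: eq_bigr => i _; rewrite -odxiE /cx dPhiE pexpD !pexpZ pexp1.
  by rewrite mulrDr -!scalerAr mulr1.
congr (_ + _).
  rewrite (bigD1_seq _ isN (uniq_idxs r N)) /= big1 => [|i /negbTE ->].
    by rewrite eqxx mulr1 addr0.
  by rewrite mulr0 scale0r.
rewrite sum_idxs big1 => [|a _]; last by apply: big1 => k _; rewrite osc_x_ann0 ?scale0r.
rewrite add0r scaler_sumr; apply: eq_bigr => c _.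
rewrite sum_iotaS big1 => [|k _]; last by rewrite osc_x_ann0 ?scale0r.
by rewrite addr0 /osc_x /= .
Qed.

Lemma oddx_zeromode c s : oddx (zeromode c) s = match s with
  | (b, true, Posz l) => V c b 0 l
  | (b, false, Posz l.+1) => phi b c l.+1 0
  | _ => 0 end.
Proof.
case: s => [[b []] [[|l]|l]] //=; rewrite big1 ?scaler0 ?addr0 // => c' _; rewrite ?V_00 ?mul0r ?mulr0 //.
Qed.

(** For a zero index in [s] the weight 1/2 is the multiplication part of Gamma_{a,0}. For a zero
    index in [u] it comes from the constant part of d eta_{c,0} in the zero mode sum. The regular
    part of that sum cancels the corrections inside d xi_{-i}, by antisymmetry of V or by the sign
    of the odd phi. *)
Lemma upE N s u : (`|s.2| < N)%N -> upN N s u = (sing s u)%:A + oBreg s u.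
Proof.
move=> /upN_zeromodes ->.
have Zs (f : 'I_r -> R) : (forall c, f c = 0) -> 2^-1 *: (\sum_c f c) = 0 :> R.
  by move=> h; rewrite big1 ?scaler0.
under eq_bigr => c _ do rewrite oddx_zeromode.
have pV a b k l : pexp true (V a b k l) = V a b k l by rewrite (hpar_pexpE _ (V_even _ _ _ _)) mul1r.
have pP a b k l : pexp true (phi a b k l) = - phi a b k l.
  by rewrite (hpar_pexpE _ (phi_odd _ _ _ _)) mulN1r.
have h0 : 1 - 0 / 2 = 1 :> C by rewrite mul0r subr0.
have h1 : 1 - 1 / 2 = 2^-1 :> C by field.
have dl (b : 'I_r) (f : 'I_r -> R) : \sum_c (b == c)%:R * f c = f b.
  rewrite (bigD1 b) //= eqxx mul1r big1 ?addr0 // => c; rewrite eq_sym => /negbTE ->.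
  by rewrite mul0r.
have tf a b : ((a, true) == (b, false) :> 'I_r * bool) = false by rewrite xpair_eqE andbF.
have ft a b : ((a, false) == (b, true) :> 'I_r * bool) = false by rewrite xpair_eqE andbF.
have pos k m : ((k.+1 : int) == - (m.+1 : int)) = false by apply/negbTE/eqP; lia.
have pos0 k : ((k.+1 : int) == - (0%N : int)) = false by apply/negbTE/eqP; lia.
have neg0 m : ((0%N : int) == - (m.+1 : int)) = false by apply/negbTE/eqP; lia.
have neg m : ((0%N : int) == - Negz m) = false by apply/negbTE/eqP; lia.
have nn k m : (Negz m == - (k.+1 : int)) = ((k.+1 : int) == - Negz m) by lia.
have sc (b : bool) (x : C) : (if b then x else 0)%:A = b%:R * x%:A :> R.
  by case: b; rewrite ?scale0r ?mul0r ?mul1r.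
have xe a b e : ((a, e) == (b, e) :> 'I_r * bool) = (b == a).
  by rewrite xpair_eqE eqxx andbT eq_sym.
case: s => [[a []] [[|k]|k]].
- rewrite Zs => [|c]; last by rewrite V_00 pexp0 mulr0.
  rewrite addr0 /osc_x /sing /fneg /=; case: u => [[b []] [[|m]|m]] /=;
    rewrite ?tf ?neg0 ?neg ?xe ?oppr0 ?eqxx ?andbT ?andbF ?V_00 ?h0 ?h1 ?subrr ?scaler0 ?scale0r
      ?add0r ?addr0 //=.
  + by case: (b == a); rewrite ?scaler0 ?scale0r.
  + by rewrite mul0r subr0.
  + by rewrite scaler0.
  + by rewrite scaler0.
  + by rewrite scaler0.
- under eq_bigr => c _ do rewrite pV.
  rewrite /osc_x /sing /fneg /=; case: u => [[b []] [[|m]|m]] /=;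
    rewrite ?tf ?pos ?pos0 ?nn ?xe ?eqxx ?andbT ?andbF ?scaler0 ?scale0r
      ?scale1r ?add0r ?addr0 ?h0 ?h1 //=; try by rewrite Zs // => c; rewrite ?add0r mul0r.
  + rewrite Zs ?addr0 => [|c]; last by rewrite V_00 mulr0.
    under eq_bigr => c _ do rewrite andbT addr0.
    rewrite dl (V_antisym b) scalerN -{1}[V a b _ _]scale1r -scalerBl; congr (_ *: _); by field.
  + rewrite -addrA -scalerDr -big_split /= Zs ?addr0 ?scale1r // => c.
    by rewrite andbF add0r (V_antisym c a) mulrN (supcommE (V_even _ _ _ _) (V_even _ _ _ _)) mul1r subrr.
  + rewrite Zs ?addr0 => [|c]; first by case: (_ && _); rewrite ?scale0r ?scale1r.
    by rewrite andbF addr0 mul0r.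
  + rewrite -addrA -scalerDr -big_split /= Zs ?addr0 ?scale1r // => c.
    by rewrite add0r (V_antisym c a) mulrN (supcommE (V_even _ _ _ _) (phi_odd _ _ _ _)) mul1r subrr.
- rewrite Zs => [|c]; last by rewrite pexp0 mulr0.
  rewrite addr0 /osc_x /sing /fneg /= scale0r; case: (_ && _); rewrite ?scale0r ?addr0 //.
- rewrite Zs => [|c]; last by rewrite pexp0 mulr0.
  rewrite addr0 /osc_x /sing /fneg /= scale0r; case: u => [[b []] [[|m]|m]] //=;
   case: (_ && _); rewrite ?scale0r ?addr0 //.
- under eq_bigr => c _ do rewrite pP.
  have kk (x : R) : k.+1%:R *: (k.+1%:R^-1 *: x) = x by rewrite scalerA mulfV ?scale1r // pnatr_eq0.
  rewrite /osc_x /sing /fneg /=; case: u => [[b []] [[|m]|m]] /=;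
    rewrite ?ft ?pos ?pos0 ?nn ?xe ?eqxx ?andbT ?andbF ?scaler0 ?scale0r
      ?scale1r ?add0r ?addr0 ?kk ?h0 ?h1 ?scaler0 ?add0r //=; try by rewrite Zs // => c; rewrite ?add0r mul0r.
  + rewrite Zs ?addr0 => [|c]; last by rewrite V_00 mul0r.
    under eq_bigr => c _ do rewrite andbT addr0.
    rewrite dl scalerN -{1}[phi a b _ _]scale1r -scalerBl; congr (_ *: _); by field.
  + rewrite -addrA -scalerDr -big_split /= Zs ?addr0 ?scale1r // => c.
    by rewrite andbF add0r mulrN subrr.
  + rewrite Zs // => c; by rewrite andbF addr0 mul0r.
  + rewrite -addrA -scalerDr -big_split /= Zs ?addr0 // => c.
    by rewrite add0r mulrN subrr.
  + rewrite Zs ?addr0 => [|c]; last by rewrite mul0r.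
    by case: (_ && _); rewrite ?scaler0 ?scale0r ?scaler_nat.
- rewrite Zs => [|c]; last by rewrite pexp0 mulr0.
  rewrite addr0 /osc_x /sing /fneg /= scale0r; case: (_ && _); rewrite ?scale0r ?addr0 //.
Qed.

End Basis.

(** * The constraints as identities between correlators *)

Section Correlators.
Variables (C : numClosedFieldType) (R : supalg C) (r : nat).

Local Notation word := (seq (idx r)).
Local Notation nfock := (nat -> word -> R).
Local Notation ip := (@ipar r).
Local Notation wp := (wpar (@ipar r)).
Local Notation fp := (@fpar r).
Local Notation ncv := (@nconv C R (idx r) ip).
Local Notation gwh := (@gwhom C R (idx r) ip).
Local Notation fcv := (@nconv C R (oneform r) fp).

Implicit Types (X Y : nfock) (I K : word) (s u : oneform r) (T : seq (oneform r)).

Variables (t tau : 'I_r -> int -> R) (B phi V : 'I_r -> 'I_r -> nat -> nat -> R).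
Hypotheses (t_even : forall a k, hpar false (t a k)) (tau_odd : forall a k, hpar true (tau a k)).
Hypothesis t0 : forall a, t a 0 = 0.
Hypothesis mero : exists N : int, forall a k, k < N -> t a k = 0 /\ tau a k = 0.
Hypotheses (B_even : forall a b k l, hpar false (B a b k l))
  (phi_odd : forall a b k l, hpar true (phi a b k l))
  (V_even : forall a b k l, hpar false (V a b k l))
  (V_00 : forall a b, V a b 0 0 = 0)
  (B_sym : forall a b k l, B a b k l = B b a l k)
  (V_antisym : forall a b k l, V a b k l = - V b a l k).

Variable W : nfock.
Hypotheses (Wev : gwh false W) (W0 : forall M, W M [::] = 0).
Hypothesis Wsym : forall M I1 i j I2,
  W M (I1 ++ [:: i, j & I2]) = (-1) ^+ (ip i && ip j) * W M (I1 ++ [:: j, i & I2]).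
Hypothesis Wfin : forall k : nat, exists N : nat, forall M I, (M <= k)%N -> (size I <= k)%N ->
  ~~ all (fun i => imode i <= N)%N I -> W M I = 0.

Local Notation om s := (om01 t tau s).
Local Notation ev := (evN (cd B phi V)).
Local Notation G := (GN t tau B phi V W).

Lemma hcd s i : hpar (ip i (+) fp s) (cd B phi V s i).
Proof. exact: hpar_cd. Qed.

(* The coefficient of [s :: T] in omega_{g,|T|+1} when M = 2g + |T|. *)
Definition Om N s M T : R := ev N (G N s M) T.

(** Order 0 is omega_{0,1}; the terms in x^i occur at order 1 with a single further form, that is,
    in omega_{0,2}. *)
Lemma OmE N s M T : Om N s M T =
  if M is M'.+1 then
    (if M' is 0%N then if T is [:: u] then upN B phi V N s u else 0 else 0) + ev N (W M') (s :: T)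
  else unitw (om s) T.
Proof.
rewrite /Om /GN; case: M => [|M] /=.
  rewrite (evND (cd B phi V) N) [X in _ + X]evN0 // addr0.
  case: T => [|u T] //=; apply: evN0 => K _; rewrite /sdN big1 // => i _; rewrite mulr0 //.
transitivity (ev N (fun K => (\sum_(i <- idxs r N)
    @nunitc C R r 1 M [::] * (pexp (wp K) (cx B phi V s i) * xword R i K)) + sdN (cd B phi V) N s (W M) K) T).
  by apply: eq_evN => K _; rewrite add0r big_split.
rewrite (evND (cd B phi V) N); congr (_ + _).
case: M => [|M] /=; last by apply: evN0 => K _; rewrite big1 // => i _; rewrite mul0r.
case: T => [|u [|v T]] /=.
- by rewrite big1 // => i _; rewrite /xword /= !mulr0.
- rewrite /sdN /upN; apply: eq_big_seq => j hj; rewrite wpar_nil pexp_false wpar_cons wpar_nil addbF.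
  congr (_ * _); rewrite (bigD1_seq j) ?uniq_idxs //= big1 => [|i /negbTE ij].
    by rewrite /xword eqxx mul1r mulr1 addr0.
  by rewrite /xword eqseq_cons eq_sym ij !mulr0.
- apply: evN0 => K _; rewrite /sdN big1 // => i _; rewrite big1 ?mulr0 // => j _.
  by rewrite big1 ?mulr0 // => k _; rewrite /xword eqseq_cons andbF !mulr0.
Qed.

(* The image in the correlators of [QNv], the coefficient of a pair of modes in
   a constraint. *)
Definition qOm N s u (v : C) M T : R :=
  (if M is M'.+1 then Om N u M' (s :: T) else 0) + fcv (Om N s) (Om N u) M T
  + (v * ((M == 2%N) && nilp T)%:R)%:A.

Lemma ev_nh2 N v M T : ev N (fun I => v *: nh2 R M I) T = (v * ((M == 2%N) && nilp T)%:R)%:A.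
Proof.
rewrite (evNZ (cd B phi V) N) -scalerA; congr (_ *: _).
case: M => [|[|[|M]]]; try by rewrite scale0r evN0.
case: T => [|u' T] /=; first by rewrite scale1r.
by rewrite scale0r evN0 // => K' _; apply: big1 => i _; rewrite mulr0.
Qed.

Lemma evN_QNv N s u v M T : ev N (QNv t tau B phi V W N s u v M) T = qOm N s u v M T.
Proof.
rewrite /QNv /QN /qOm (evND (cd B phi V) N) (evND (cd B phi V) N).
rewrite (evN_nconv hcd _ _ _ _ (gwhom_GN t_even tau_odd B_even phi_odd V_even Wev N s)); congr (_ + _ + _).
  by case: M => [|M] //; apply: evN0.
exact: ev_nh2.
Qed.

Lemma ev_sum N (l : seq int) (k : int -> C) (f : int -> nfock) M T :
  ev N (fun K => \sum_(j <- l) k j *: f j M K) T = \sum_(j <- l) k j *: ev N (f j M) T.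
Proof. exact: (evN_sum (cd B phi V) N l k (fun j K => f j M K)). Qed.

Lemma G_relation a n0 (n : nat) :
  (forall m I, oGtilde t tau B phi V a n0 (toZ (nexp ip W)) m I = 0) ->
  exists K0 : nat, forall K : nat, (K0 <= K)%N -> exists N0 : nat, forall N, (N0 <= N)%N ->
  forall M T, (M <= n)%N -> (size T <= n)%N ->
  \sum_(j <- irange K) kJ C j *: qOm N (mode a false j) (mode a true (- (2 * n0 + 1 + j)))
     (- vv C (mode a false (- j)) (mode a true (2 * n0 + 1 + j))) M T = 0.
Proof.
move=> hG.
have [K0 hK] := Gtilde_relation t_even tau_odd t0 mero B_even phi_odd V_even V_00 B_sym V_antisym
  Wev W0 Wsym Wfin n hG.
exists K0 => K /hK[N0 hN]; exists N0 => N /hN {}hN M T Mn Tn.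
under eq_bigr => j _ do rewrite -evN_QNv.
by rewrite -(ev_sum N (irange K) _ (fun j => QNv t tau B phi V W N (mode a false j)
  (mode a true (- (2 * n0 + 1 + j))) (- vv C (mode a false (- j)) (mode a true (2 * n0 + 1 + j)))))
  evN0 // => I hI; apply: hN => //; rewrite hI.
Qed.

Lemma L_relation a n0 (n : nat) :
  (forall m I, oLtilde t tau B phi V a n0 (toZ (nexp ip W)) m I = 0) ->
  exists K0 : nat, forall K : nat, (K0 <= K)%N -> exists N0 : nat, forall N, (N0 <= N)%N ->
  forall M T, (M <= n)%N -> (size T <= n)%N ->
  2^-1 *: (\sum_(j <- irange K) kJ C j *: qOm N (mode a false j) (mode a false (- (2 * n0 + j)))
     (- vv C (mode a false (- j)) (mode a false (2 * n0 + j))) M T)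
  + 2^-1 *: (\sum_(j <- irange K) kG C n0 j *: qOm N (mode a true j) (mode a true (- (2 * n0 + j)))
     (- vv C (mode a true (- j)) (mode a true (2 * n0 + j))) M T)
  + (((n0 == 0)%:R / 4) * ((M == 2%N) && nilp T)%:R)%:A = 0.
Proof.
move=> hL.
have [K0 hK] := Ltilde_relation t_even tau_odd t0 mero B_even phi_odd V_even V_00 B_sym V_antisym
  Wev W0 Wsym Wfin n hL.
exists K0 => K /hK[N0 hN]; exists N0 => N /hN {}hN M T Mn Tn.
under eq_bigr => j _ do rewrite -evN_QNv.
under [X in _ + 2^-1 *: X]eq_bigr => j _ do rewrite -evN_QNv.
rewrite -(ev_nh2 N).
rewrite -(ev_sum N (irange K) _ (fun j => QNv t tau B phi V W N (mode a false j)
  (mode a false (- (2 * n0 + j))) (- vv C (mode a false (- j)) (mode a false (2 * n0 + j)))))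
 -(ev_sum N (irange K) _ (fun j => QNv t tau B phi V W N (mode a true j)
  (mode a true (- (2 * n0 + j))) (- vv C (mode a true (- j)) (mode a true (2 * n0 + j))))).
rewrite -!(evNZ (cd B phi V) N) -!(evND (cd B phi V) N) evN0 // => I hI.
by apply: hN => //; rewrite hI.
Qed.

End Correlators.

(** * The exponential series defining Z *)

Section FockExponential.
Variables (C : numClosedFieldType) (R : supalg C) (r : nat).

Local Notation word := (seq (idx r)).
Local Notation fock := (int -> word -> R).
Local Notation nfock := (nat -> word -> R).
Local Notation ip := (@ipar r).
Local Notation wp := (wpar (@ipar r)).
Local Notation ncv := (@nconv C R (idx r) ip).

Definition ofock_mul (f g : fock) : fock := fun m I =>
  \sum_(j \in [set: int]) \sum_(b : (size I).-tuple bool)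
    (let I1 := mask b I in let I2 := mask (map negb b) I in
     (-1) ^+ shuffle_sign ip b I * pexp (wp I2) (f j I1) * g (m - j) I2).

Definition ofock_exp (f : fock) : fock := fun m I =>
  \sum_(n \in [set: nat]) (n`!%:R)^-1 *: iter n (ofock_mul f) (ovac R (r:=r)) m I.

Definition ologZ (F : nat -> word -> R) : fock := fun m I =>
  match m with
  | Posz m => if (0 < size I <= m.+2)%N then F (m.+2 - size I)%N I else 0
  | Negz _ => 0
  end.

(** The exponent of hbar is M = h - 2 + n with h = 2g, whence the index [M.+2 - size I]. *)
Definition nlogZ (F : nat -> word -> R) : nfock := fun M I =>
  if (0 < size I <= M.+2)%N then F (M.+2 - size I)%N I else 0.

Lemma ologZE F : ologZ F = toZ (nlogZ F).
Proof. by apply: funext => -[m|m]; apply: funext. Qed.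

Lemma ofock_mul_toZ (X Y : nfock) : ofock_mul (toZ X) (toZ Y) = toZ (ncv X Y).
Proof.
apply: funext => m; apply: funext => I; rewrite /ofock_mul.
rewrite -[LHS]/(\sum_(j \in [set: int]) wconv ip (toZ X j) (toZ Y (m - j)) I).
case: m => [M|M] /=; last first.
  apply: fsbig1 => -[j|j] _; last exact: wconv_eq0l.
  by rewrite wconv_eq0r //= (_ : Negz M - j%:Z = Negz (M + j)) //; lia.
rewrite (@fsum_seq _ _ (map Posz (iota 0 M.+1))).
- rewrite big_map /nconv -[iota 0 M.+1]/(index_iota 0 M.+1) big_mkord; apply: eq_bigr => j _ /=.
  by rewrite (_ : M%:Z - j%:Z = (M - j)%N) //; have := ltn_ord j; lia.
- by rewrite map_inj_uniq ?iota_uniq // => x y [].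
case=> [j|j]; last by move=> _; exact: wconv_eq0l.
rewrite mem_map; last by move=> x y [].
rewrite mem_iota /= add0n ltnS -ltnNge => jM.
by rewrite wconv_eq0r //= (_ : M%:Z - j%:Z = Negz (j - M).-1) //; lia.
Qed.

Lemma ovac_toZ : ovac R (r:=r) = toZ (@nunit C R (idx r)).
Proof.
apply: funext => -[[|m]|m]; apply: funext => I; rewrite /ovac //=; by case: I.
Qed.

Lemma ofock_exp_toZ (W : nfock) : @gwhom C R (idx r) ip false W -> (forall M, W M [::] = 0) ->
  ofock_exp (toZ W) = toZ (nexp ip W).
Proof.
move=> Wev W0; apply: funext => m; apply: funext => I; rewrite /ofock_exp.
have E n : iter n (ofock_mul (toZ W)) (ovac R (r:=r)) = toZ (npow ip W n).
  elim: n => [|n IH] /=; first exact: ovac_toZ.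
  by rewrite IH ofock_mul_toZ.
under eq_fsbigr => n _ do rewrite E.
case: m => [M|M] /=; last by apply: fsbig1 => n _; rewrite scaler0.
rewrite (@fsum_seq _ _ (iota 0 (size I).+1)) ?iota_uniq //.
  by rewrite -[iota 0 _]/(index_iota 0 (size I).+1) big_mkord.
move=> n; rewrite mem_iota /= add0n ltnS -ltnNge => h.
by rewrite (npow_low Wev W0) // scaler0.
Qed.

Section LogPartitionFunction.
Variable F : nat -> word -> R.
Hypotheses (Fev : forall h I, hpar (wp I) (F h I))
  (Fsym : forall h I1 i j I2, F h (I1 ++ [:: i, j & I2]) =
    (-1) ^+ (ip i && ip j) * F h (I1 ++ [:: j, i & I2]))
  (Ffin : forall h n, exists N, forall I, size I = n ->
    F h I != 0 -> all (fun i => imode i <= N)%N I).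

Lemma Ffin_uniform k : exists N : nat, forall h I, (h <= k)%N -> (size I <= k)%N ->
  ~~ all (fun i => imode i <= N)%N I -> F h I = 0.
Proof.
have [f hf] := choice (fun hn : nat * nat => Ffin hn.1 hn.2).
exists (\max_(hn : 'I_k.+1 * 'I_k.+1) f (val hn.1, val hn.2)) => h I hk Ik.
apply: contraNeq => nz; have /allP hI := hf (h, size I) I erefl nz.
apply/allP => i /hI /leq_trans; apply.
have hk' : (h < k.+1)%N by []. have Ik' : (size I < k.+1)%N by [].
exact: (leq_bigmax (F := fun hn : 'I_k.+1 * 'I_k.+1 => f (val hn.1, val hn.2)) (Ordinal hk', Ordinal Ik')).
Qed.

Lemma nlogZ_even : @gwhom C R (idx r) ip false (nlogZ F).
Proof. by move=> M I; rewrite /nlogZ; case: ifP => _; [apply: Fev|apply: hpar0]. Qed.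

Lemma nlogZ_nil M : nlogZ F M [::] = 0.
Proof. by []. Qed.

Lemma nlogZ_sym M I1 i j I2 : nlogZ F M (I1 ++ [:: i, j & I2]) =
  (-1) ^+ (ip i && ip j) * nlogZ F M (I1 ++ [:: j, i & I2]).
Proof. by rewrite /nlogZ !size_cat /=; case: ifP => _; [exact: Fsym|rewrite mulr0]. Qed.

Lemma nlogZ_fin k : exists N : nat, forall M I, (M <= k)%N -> (size I <= k)%N ->
  ~~ all (fun i => imode i <= N)%N I -> nlogZ F M I = 0.
Proof.
have [N hN] := Ffin_uniform k.+2; exists N => M I Mk Ik hI; rewrite /nlogZ; case: ifP => // _.
by apply: hN => //; lia.
Qed.

End LogPartitionFunction.

(** The derivative of Z is that of W times Z, and Z can be cancelled. *)
Lemma nexp_inj_annih (W : nfock) i : @gwhom C R (idx r) ip false W -> (forall M, W M [::] = 0) ->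
  (forall M I, nexp ip W M (i :: I) = 0) ->
  forall M I, W M (i :: I) = 0.
Proof.
move=> Wev W0 h M I.
apply: (@nconv_inj _ _ _ ip (fun M => sder i (W M)) (nexp ip W) (maxn M (size I)) (nexp_nil ip W)) => [M' I' _ _||].
- by rewrite -(nexp_cons Wev W0) h.
- by rewrite leq_maxl.
- by rewrite leq_maxr.
Qed.

End FockExponential.
(** * The Casimir *)

Section TwoPointFunctions.
Variables (C : numClosedFieldType) (R : supalg C) (r : nat).

Definition obifun := nat -> bool -> bool -> int -> int -> R.

Definition oDstar1 (g : obifun) : obifun := fun d e1 e2 k l =>
  if e1 then
    k%:~R *: g d false e2 k l
      - (if d is d'.+1 then d'%:R *: g d' false e2 (k - 1) l else 0)
  else g d true e2 k l.

Definition orestrict2 (c1 c2 : C) (g : obifun) (e : bool) (m : int) : R :=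
  \sum_(ee : bool * bool | (ee.1 + ee.2 == e :> nat)%N)
    \sum_(dk \in [set: nat * int])
      (let: (d, k) := dk in let l : int := m + d%:Z - k in
       (c1 ^ (k + ee.1%:Z) * c2 ^ (l + ee.2%:Z) / (c1 - c2) ^+ d)
         *: g d ee.1 ee.2 k l).

Definition ocasimir (g : obifun) (e : bool) (m : int) : R :=
  2^-1 *: (orestrict2 1 (-1) (oDstar1 g) e m - orestrict2 (-1) 1 (oDstar1 g) e m).

Definition oexpand (g : obifun) (e1 e2 : bool) (k l : int) : R :=
  \sum_(dj \in [set: nat * nat])
    (let: (d, j) := dj in
     ((-1) ^+ d * 'C((d + j).-1, j)%:R) *:
       g d e1 e2 (k - j%:Z) (l + d%:Z + j%:Z)).

Definition oBR : obifun := fun d e1 e2 k l =>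
  if [&& d == 2%N, e1, e2, k == 1 & l == 1] then -1
  else if [&& d == 1%N, ~~ e1, ~~ e2 & (k, l) \in [:: (1, 0); (0, 1)]]
       then - (2^-1)%:A
  else 0.

Definition obifun_of (w : oneform r -> oneform r -> R) (a b : 'I_r) : obifun :=
  fun d e1 e2 k l =>
    if d == 0%N then (-1) ^+ e1 * w (a, ~~ e1, k) (b, ~~ e2, l) else 0.

Definition osigma_pull (f : bool -> int -> R) (e : bool) (m : int) : R :=
  (-1) ^+ (~~ e) *: ((-1 : C) ^ m *: f e m).

Definition ois_Ophi (j : nat) (n : int) (f : bool -> int -> R) : Prop :=
  exists h : bool -> nat -> R, forall e m,
    f e m = \sum_(i \in [set i : nat | m = j%:Z + e%:Z + 2 * (n + i%:Z)])
              (sqrtC 2 ^+ (j + e)) *: h e i.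

(** The powers of sqrt 2 are invertible and distinct i give distinct exponents, so being of this
    form is a condition on vanishing only. *)
Lemma ois_Ophi_van j n (f : bool -> int -> R) : (forall (e : bool) (m : int),
    (forall i : nat, m <> j%:Z + e%:Z + 2 * (n + i%:Z)) -> f e m = 0) -> ois_Ophi j n f.
Proof.
move=> h; exists (fun (e : bool) i => (sqrtC 2 ^+ (j + e))^-1 *: f e (j%:Z + e%:Z + 2 * (n + i%:Z))) => e m.
have s2 : sqrtC 2 ^+ (j + e) != 0 :> C by rewrite expf_neq0 // sqrtC_eq0 pnatr_eq0.
have [[i mi]|nomi] := pselect (exists i : nat, m = j%:Z + e%:Z + 2 * (n + i%:Z)); last first.
  rewrite h => [|i mi]; last by apply: nomi; exists i.
  by rewrite fsbig1 // => i /= mi; case: nomi; exists i.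
rewrite (_ : [set _ | _] = [set i]); last first.
  by apply/seteqP; split=> x /=; [rewrite mi; lia|move->].
by rewrite fsbig_set1 scalerA mulfV // scale1r mi.
Qed.

Lemma sum_ee (f : bool -> bool -> R) (e : bool) :
  \sum_(ee : bool * bool | (ee.1 + ee.2 == e :> nat)%N) f ee.1 ee.2 =
  if e then f true false + f false true else f false false.
Proof.
rewrite big_mkcond -(pair_big predT predT (fun x y : bool => if (x + y == e :> nat)%N then f x y else 0)) /=.
by rewrite !big_bool /=; case: e; rewrite /= ?addr0 ?add0r.
Qed.

Definition rsum (c1 c2 : C) (g : obifun) (m : int) (s : seq (nat * int)) (e1 e2 : bool) : R :=
  \sum_(dk <- s) (c1 ^ (dk.2 + e1%:Z) * c2 ^ (m + dk.1%:Z - dk.2 + e2%:Z) / (c1 - c2) ^+ dk.1)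
    *: g dk.1 e1 e2 dk.2 (m + dk.1%:Z - dk.2).

Lemma orestrict2E c1 c2 g e m (s : seq (nat * int)) : uniq s ->
  (forall d e1 e2 k, (d, k) \notin s -> g d e1 e2 k (m + d%:Z - k) = 0) ->
  orestrict2 c1 c2 g e m = if e then rsum c1 c2 g m s true false + rsum c1 c2 g m s false true
    else rsum c1 c2 g m s false false.
Proof.
move=> us hs; rewrite -(sum_ee (rsum c1 c2 g m s)).
apply: eq_bigr => -[e1 e2] _; rewrite (fsum_seq us) => [|[d k] /hs h].
  by apply: eq_bigr => -[d k] _.
by rewrite /= h scaler0.
Qed.

Lemma casimirD (g g' : obifun) e m (s s' : seq (nat * int)) :
  (forall d e1 e2 k, (d, k) \notin s -> oDstar1 g d e1 e2 k (m + d%:Z - k) = 0) ->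
  (forall d e1 e2 k, (d, k) \notin s' -> oDstar1 g' d e1 e2 k (m + d%:Z - k) = 0) ->
  ocasimir (fun d e1 e2 k l => g d e1 e2 k l + g' d e1 e2 k l) e m = ocasimir g e m + ocasimir g' e m.
Proof.
move=> hg hg'; rewrite /ocasimir -scalerDr addrACA -opprD.
pose S := undup (s ++ s').
have D d e1 e2 k l : oDstar1 (fun d e1 e2 k l => g d e1 e2 k l + g' d e1 e2 k l) d e1 e2 k l =
    oDstar1 g d e1 e2 k l + oDstar1 g' d e1 e2 k l.
  by rewrite /oDstar1; case: e1 => //; case: d => [|d]; rewrite ?subr0 scalerDr // scalerDr opprD addrACA.
have h1 d e1 e2 k : (d, k) \notin S -> oDstar1 g d e1 e2 k (m + d%:Z - k) = 0.
  by rewrite mem_undup mem_cat negb_or => /andP[/hg].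
have h2 d e1 e2 k : (d, k) \notin S -> oDstar1 g' d e1 e2 k (m + d%:Z - k) = 0.
  by rewrite mem_undup mem_cat negb_or => /andP[_ /hg'].
have h3 d e1 e2 k : (d, k) \notin S ->
    oDstar1 (fun d e1 e2 k l => g d e1 e2 k l + g' d e1 e2 k l) d e1 e2 k (m + d%:Z - k) = 0.
  by move=> h; rewrite D h1 // h2 // addr0.
have E c1 c2 e1 e2 : rsum c1 c2 (oDstar1 (fun d e1 e2 k l => g d e1 e2 k l + g' d e1 e2 k l)) m S e1 e2 =
    rsum c1 c2 (oDstar1 g) m S e1 e2 + rsum c1 c2 (oDstar1 g') m S e1 e2.
  by rewrite -big_split; apply: eq_bigr => dk _; rewrite D scalerDr.
rewrite !(orestrict2E _ _ _ (undup_uniq _) h1) !(orestrict2E _ _ _ (undup_uniq _) h2).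
rewrite !(orestrict2E _ _ _ (undup_uniq _) h3) !E; congr (_ *: (_ - _)); case: (e) => //; exact: addrACA.
Qed.

(** In D* B^R the derivative z_1 d/dz_1 gives (1, 1) when it hits the numerator of the simple pole,
    and (2, 2) and (2, 1) when it hits the denominator; removing theta_1 from the double pole gives
    (2, 1) again. *)
Lemma BR_support m d e1 e2 k : (d, k) \notin [:: (1%N, 1 : int); (2%N, 2 : int); (2%N, 1 : int)] ->
  oDstar1 oBR d e1 e2 k (m + d%:Z - k) = 0.
Proof.
rewrite !inE !xpair_eqE !negb_or /oDstar1 /oBR => h.
case: e1 => /=; last first.
  case: ifP => [/and4P[/eqP dE _ /eqP kE _]|_]; last by rewrite andbF.
  by move: h; rewrite dE kE.
rewrite andbF /=; case: d h => [|[|[|d]]] /= h; rewrite ?scaler0 ?scale0r ?subr0 //.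
- case: ifP => [/andP[_]|_]; last by rewrite scaler0.
  rewrite !inE !xpair_eqE; case/orP => /andP[/eqP k0 _]; move: h; rewrite k0 //.
  by rewrite mulr0z scale0r.
- case: ifP => [/andP[_]|_]; last by rewrite scaler0 subr0.
  rewrite !inE !xpair_eqE; case/orP => /andP[/eqP k0 _]; move: h.
    by rewrite (_ : k = 2) //; lia.
  by rewrite (_ : k = 1) //; lia.
- by rewrite andbF scaler0 subr0.
Qed.

(** B^R has degree 0 in z and is even in theta, so only theta z^0 can occur. The constant is the one
    matched by hbar^2/4 in L_{a,0}. *)
Lemma casimir_BR e m : ocasimir oBR e m = - ((e && (m == 0))%:R / 2)%:A.
Proof.
rewrite /ocasimir !(orestrict2E _ _ _ _ (@BR_support m)) // /rsum !big_cons !big_nil /oDstar1 /oBR /=.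
have M1 : ((1 : int, m + 1 - 1 : int) \in [:: (1, 0); (0, 1)]) = (m == 0).
  by rewrite !inE !xpair_eqE; lia.
have M2 : ((2 - 1 : int, m + 2 - 2 : int) \in [:: (1, 0); (0, 1)]) = (m == 0).
  by rewrite !inE !xpair_eqE; lia.
have M3 : ((1 - 1 : int, m + 2 - 1 : int) \in [:: (1, 0); (0, 1)]) = (m == 0).
  by rewrite !inE !xpair_eqE; lia.
have M4 : (m + 2 - 1 == 1) = (m == 0) by lia.
rewrite M1 M2 M3 M4 !scaler0 !exp1rz; case: e => /=; last by rewrite !addr0 subrr scaler0 mul0r scale0r oppr0.
have [->|_] := eqVneq m 0; last by rewrite /= !(scaler0, addr0, subr0, mul0r, scale0r, oppr0).
have E z n : z = n%:Z -> (-1 : C) ^ z = (-1) ^+ n by move->.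
rewrite ?(E (0 + 1%Z - 1 + 0%Z) 0%N) // ?(E (0 + 2%Z - 2 + 0%Z) 0%N) // ?(E (0 + 2%Z - 1 + 0%Z) 1%N) //.
rewrite ?(E (0 + 2%Z - 1 + 1%Z) 2%N) // ?(E (1 + 1%Z) 2%N) // ?(E (2 + 1%Z) 3%N) // ?(E (1 + 0%Z) 1%N) //.
rewrite !addr0 ?add0r ?sub0r ?subr0 ?scale1r ?scalerN ?opprK.
rewrite !scalerA !(=^~ scalerDl, =^~ scaleNr) scalerA.
have -> : (-1 - 1 : C) = - 2 by ring.
congr (_ *: _); rewrite mulr1n /= sqrrN; by field.
Qed.

Lemma BR_0 e1 e2 k l : oBR 0 e1 e2 k l = 0.
Proof. by []. Qed.

Lemma BR_1 e1 e2 k l : oBR 1 e1 e2 k l =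
  - ([&& ~~ e1, ~~ e2 & ((k == 1) && (l == 0)) || ((k == 0) && (l == 1))]%:R / 2)%:A.
Proof.
rewrite /oBR /= !inE !xpair_eqE; case: ifP => _; first by rewrite mul1r.
by rewrite mul0r scale0r oppr0.
Qed.

Lemma BR_2 e1 e2 k l : oBR 2 e1 e2 k l = - ([&& e1, e2, k == 1 & l == 1]%:R)%:A.
Proof. by rewrite /oBR /=; case: ifP => _; rewrite ?scale1r // scale0r oppr0. Qed.

Lemma BR_3 d e1 e2 k l : oBR d.+3 e1 e2 k l = 0.
Proof. by []. Qed.

(** The geometric expansions of the simple and of the double pole of B^R for |z_1| < |z_2| add up to
    [sing]; in particular the simple pole gives 1/2 at k = 0 and 1/2 + 1/2 at k > 0. *)
Lemma expand_w w (a b : 'I_r) e1 e2 k l : oexpand (fun d e1 e2 k l =>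
   (a == b)%:R * oBR d e1 e2 k l + obifun_of w a b d e1 e2 k l) e1 e2 k l =
   ((-1) ^+ e1) * ((sing C (a, ~~ e1, k) (b, ~~ e2, l))%:A + w (a, ~~ e1, k) (b, ~~ e2, l)).
Proof.
have nat_nb n : ((- (n%:Z) == 1) = false) * ((n.+2%:Z == 1) = false) by split; lia.
(* The contributing pairs (d, j): the regular part; the simple pole with numerator z_1, where j = k
   - 1, or z_2, where j = k; the double pole, where j = k - 1. *)
rewrite /oexpand (@fsum_seq _ _ (if k is Posz n then if n is n'.+1 then
   [:: (0%N, 0%N); (1%N, n'); (1%N, n); (2%N, n')] else [:: (0%N, 0%N); (1%N, 0%N)] else [:: (0%N, 0%N)])).
- have sg : sing C (a, ~~ e1, k) (b, ~~ e2, l) =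
      ((a == b) && (e1 == e2))%:R * ((k + l == 0)%:R *
        if e1 then (if 0 < k then k%:~R else 0) else (if 0 < k then 1 else if k == 0 then 2^-1 else 0)).
    rewrite /sing /= xpair_eqE (inj_eq negb_inj); case: ((a == b) && (e1 == e2)); rewrite ?mul0r //= mul1r.
    rewrite (_ : (k == - l) = (k + l == 0)); last by lia.
    by case: (k + l == 0); rewrite ?mul0r // mul1r; case: (e1).
  case: k sg => [[|n]|n] -> /=; rewrite !big_cons big_nil /= !subr0 !addr0 ?BR_0 ?BR_1 ?BR_2
    ?bin0 ?add0n ?binn ?add1n ?binSn ?mulr0 ?add0r ?expr0 ?mulr1 ?scale1r ?expr1 ?mulr0
    ?sqrrN ?expr1n ?mul1r ?mulrDr.
  + rewrite addrC /obifun_of /=; congr (_ + _); rewrite (_ : (l + 1%Z == 1) = (l == 0)); last by lia.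
    case: (a == b); case: (e1); case: (e2); case: (l == 0) => /=; rewrite ?mul1r ?mul0r ?mulr0 ?scale0r ?oppr0 ?mulr0 ?scaler0 //.
    by rewrite scaleN1r opprK.
  + rewrite addrC /obifun_of /=; congr (_ + _).
    rewrite (_ : n.+1%:Z - n%:Z = 1); last by lia. rewrite subrr.
    rewrite (_ : (l + 1%Z + n%:Z == 0) = (n.+1%:Z + l == 0)); last by lia.
    rewrite (_ : (l + 1%Z + n.+1%:Z == 1) = (n.+1%:Z + l == 0)); last by lia.
    rewrite (_ : (l + 2%Z + n%:Z == 1) = (n.+1%:Z + l == 0)); last by lia.
    case: (a == b); case: (e1); case: (e2); case: (n.+1%:Z + l == 0) => /=;
      rewrite ?mul1r ?mul0r ?mulr0 ?scale0r ?oppr0 ?mulr0 ?scaler0 ?addr0 ?add0r ?addr0 //.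
    * by rewrite scalerN scalerA mulr1 expr1 mulN1r.
    * by rewrite !scaleN1r !opprK -scalerDl; congr (_ *: _); field.
  + by rewrite /obifun_of /=; case: (e1); rewrite !mulr0 scale0r mulr0 add0r.
- by case: k => [[|n]|n] //=; rewrite !inE !xpair_eqE; lia.
case=> [[|[|[|d]]] j] hd.
- rewrite bin_small ?mulr0 ?scale0r //; case: j hd => // hd.
  by case: k hd => [[|n]|n].
- rewrite BR_1 /obifun_of /= addr0 (_ : [&& _, _ & _] = false) ?mul0r ?scale0r ?oppr0 ?mulr0 ?scaler0 //.
  by case: k hd => [[|n]|n]; rewrite !inE !xpair_eqE; case: (e1); case: (e2) => //=; lia.
- rewrite BR_2 /obifun_of /= addr0 (_ : [&& _, _, _ & _] = false) ?mul0r ?scale0r ?oppr0 ?mulr0 ?scaler0 //.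
  by case: k hd => [[|n]|n]; rewrite !inE !xpair_eqE; case: (e1); case: (e2) => //=; lia.
- by rewrite BR_3 /obifun_of /= addr0 mulr0 scaler0.
Qed.

Lemma bifun_of_support w a m K :
  (forall e1 e2 k, (K < `|k|)%N -> w (a, e1, k) (a, e2, m - k) = 0) ->
  forall d e1 e2 k, (d, k) \notin [seq (0%N, k) | k <- irange K] ->
  oDstar1 (obifun_of w a a) d e1 e2 k (m + d%:Z - k) = 0.
Proof.
move=> hw d e1 e2 k h; case: d h => [|[|d]] h; rewrite /oDstar1 /obifun_of /=.
- have hk : (K < `|k|)%N.
    by rewrite ltnNge -mem_irange; move: h; apply: contra; apply: map_f.
  by rewrite /= (_ : m + 0%Z - k = m - k) ?addr0 // !hw // !mulr0 scaler0 subr0; case: e1.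
- by rewrite scale0r scaler0 subr0; case: e1.
- by rewrite !scaler0 subr0; case: e1.
Qed.

(** At (z, -z) a monomial acquires the sign of its second exponent and at (-z, z) that of its first;
    a theta evaluated at the reflected point contributes one more sign. This turns the difference of
    the restrictions into a sum of signs when theta is present. *)
Lemma casimir_w w a e m K :
  (forall e1 e2 k, (K < `|k|)%N -> w (a, e1, k) (a, e2, m - k) = 0) ->
  ocasimir (obifun_of w a a) e m = \sum_(k <- irange K)
    if e then (2^-1 * ((-1) ^ k + (-1) ^ (m - k))) *: (k%:~R *: w (a, true, k) (a, true, m - k)
                                                 + w (a, false, k) (a, false, m - k))
    else (2^-1 * ((-1) ^ k - (-1) ^ (m - k))) *: w (a, false, k) (a, true, m - k).
Proof.
move=> hw; pose s := [seq (0%N, k) | k <- irange K].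
have us : uniq s by rewrite map_inj_uniq ?uniq_irange // => x y [].
have hs := bifun_of_support hw.
have E c1 c2 e1 e2 : rsum c1 c2 (oDstar1 (obifun_of w a a)) m s e1 e2 = \sum_(k <- irange K)
    (c1 ^ (k + e1%:Z) * c2 ^ (m - k + e2%:Z)) *: (if e1 then k%:~R *: w (a, true, k) (a, ~~ e2, m - k)
      else - w (a, false, k) (a, ~~ e2, m - k)).
  rewrite /rsum big_map; apply: eq_bigr => k _; rewrite expr0 divr1 /= addr0 /oDstar1 /obifun_of /=.
  by case: e1; rewrite ?mul1r ?subr0 // expr1 mulN1r.
rewrite /ocasimir !(orestrict2E _ _ _ us hs) !E.
case: e {hs} => /=.
  rewrite opprD addrACA -!sumrB -big_split /= scaler_sumr; apply: eq_bigr => k _.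
  have P n : (-1 : C) ^ (n + 1) = - (-1) ^ n by rewrite expfzDr ?oppr_eq0 ?oner_eq0 // expr1z mulrN1.
  rewrite !exp1rz !P !addr0 !mul1r !mulr1; move: (k%:~R *: w (a, true, k) (a, true, m - k)) (w (a, false, k) (a, false, m - k)) => x y.
  rewrite !scalerN !scaleNr !opprK; move: ((-1 : C) ^ k) ((-1 : C) ^ (m - k)) => c d.
  by rewrite -!scalerDl -scalerDr scalerA [d + c]addrC.
rewrite -sumrB scaler_sumr; apply: eq_bigr => k _.
rewrite !exp1rz !addr0 !mul1r !mulr1 !scalerN opprK addrC -scalerBl scalerA.
by rewrite ?scalerN.
Qed.

End TwoPointFunctions.
(** * Correlators and loop equations *)

Section MultiDifferentials.
Variables (C : numClosedFieldType) (R : supalg C) (r : nat).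

Local Notation word := (seq (idx r)).
Local Notation nfock := (nat -> word -> R).
Local Notation ip := (@ipar r).
Local Notation wp := (wpar (@ipar r)).
Local Notation fp := (@fpar r).
Local Notation wf := (wpar (@fpar r)).
Local Notation fwcv := (@wconv C R (oneform r) fp).

Implicit Types (I : word) (s u : oneform r) (T S : seq (oneform r)) (a b : 'I_r).

Definition otensor (w1 w2 : seq (oneform r) -> R) s1 s2 T : R :=
  \sum_(b : (size T).-tuple bool)
    (let TI := mask b T in let TJ := mask (map negb b) T in
     (-1) ^+ (shuffle_sign (@fpar r) b T (+) (wpar (@fpar r) TI && fpar s2))
     * pexp (fpar s2 (+) wpar (@fpar r) TJ) (w1 (s1 :: TI))
     * w2 (s2 :: TJ)).

(** The explicit sign of [s2] passing [TI] cancels against part of the sign of [w1] passing [s2];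
    only the exchange sign of the two forms remains. *)
Lemma otensorE (w1 w2 : seq (oneform r) -> R) s1 s2 T : (forall S, hpar (wf S) (w1 S)) ->
  otensor w1 w2 s1 s2 T =
  (-1) ^+ (fp s1 && fp s2) * fwcv (fun K => w1 (s1 :: K)) (fun K => w2 (s2 :: K)) T.
Proof.
move=> h1; rewrite /otensor /wconv mulr_sumr; apply: eq_bigr => b _ /=.
set TI := mask b T; set TJ := mask _ T.
rewrite addbC -pexp_addb (hpar_pexpE (fp s2) (hpar_pexp _ (h1 _))) wpar_cons !mulrA -!signr_addb.
congr (_ ^+ (nat_of_bool _) * _ * _).
by case: (shuffle_sign _ _ _); case: (wf TI); case: (fp s1); case: (fp s2).
Qed.

Variables (t tau : 'I_r -> int -> R) (B phi V : 'I_r -> 'I_r -> nat -> nat -> R).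
Variable F : nat -> word -> R.

Fixpoint odxi_prod (I : word) S : R :=
  match I, S with
  | [::], [::] => 1
  | i :: I', x :: s' =>
      pexp (wpar (@fpar r) s') (odxi B phi V i x) * odxi_prod I' s'
  | _, _ => 0
  end.

Definition oomegaF (g : nat) S : R :=
  \sum_(I \in [set I : seq (idx r) | size I = size S])
     odxi_prod I S * F g.*2 I.

Definition oomega02 a b : obifun R := fun d e1 e2 k l =>
  (a == b)%:R * oBR R d e1 e2 k l
  + obifun_of (fun s1 s2 => oBreg B phi V s1 s2 + oomegaF 0 [:: s1; s2]) a b d e1 e2 k l.

Definition oomega01 s : R :=
  let: (a, e, k) := s in if e then tau a k else t a k.

Definition oomega (g : nat) S : R :=
  match g, S with
  | 0%N, [:: s] => oomega01 s
  | 0%N, [:: (a, e1, k); (b, e2, l)] =>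
      (-1) ^+ (~~ e1) * oexpand (oomega02 a b) (~~ e1) (~~ e2) k l
  | _, _ => oomegaF g S
  end.

Definition oomega_pair (g : nat) a T : obifun R :=
  if (g == 0%N) && nilp T then oomega02 a a
  else obifun_of (fun s1 s2 => oomega g [:: s1, s2 & T]) a a.

Definition oE1 a (g : nat) T (e : bool) (m : int) : R :=
  let w := fun e m => oomega g ((a, ~~ e, m) :: T) in
  w e m + osigma_pull w e m.

Definition oE2 a (g : nat) T (e : bool) (m : int) : R :=
  (if g is g'.+1 then ocasimir (oomega_pair g' a T) e m else 0)
  + ocasimir (obifun_of (fun s1 s2 =>
      \sum_(g1 < g.+1) otensor (oomega g1) (oomega (g - g1)) s1 s2 T) a a) e m.

Hypotheses (B_even : forall a b k l, hpar false (B a b k l))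
  (phi_odd : forall a b k l, hpar true (phi a b k l))
  (V_even : forall a b k l, hpar false (V a b k l))
  (V_00 : forall a b, V a b 0 0 = 0)
  (B_sym : forall a b k l, B a b k l = B b a l k)
  (V_antisym : forall a b k l, V a b k l = - V b a l k).
Hypotheses (Fev : forall h I, hpar (wp I) (F h I))
  (Fsym : forall h I1 i j I2, F h (I1 ++ [:: i, j & I2]) =
    (-1) ^+ (ip i && ip j) * F h (I1 ++ [:: j, i & I2]))
  (Ffin : forall h n, exists N, forall I, size I = n ->
    F h I != 0 -> all (fun i => imode i <= N)%N I).

Local Notation ev := (evN (cd B phi V)).

Lemma hpar_odxi_prod I S : hpar (wp I (+) wf S) (odxi_prod I S).
Proof.
elim: S I => [|s S IH] [|i I] /=; try exact: hpar0; first exact: hpar1.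
rewrite !wpar_cons (_ : _ (+) _ = (ip i (+) fp s) (+) (wp I (+) wf S)).
  by apply: hparM (IH I); rewrite (odxiE _ phi_odd V_even V_00); apply/hpar_pexp/hcd.
by case: (ip i); case: (fp s); case: (wp I); case: (wf S).
Qed.

Fixpoint words (l : seq (idx r)) n : seq word :=
  if n is n'.+1 then [seq i :: J | i <- l, J <- words l n'] else [:: [::]].

Lemma mem_words l n I : (I \in words l n) = (size I == n) && all (mem l) I.
Proof.
elim: n I => [|n IH] I; first by rewrite inE; case: I.
apply/allpairsP/idP => [[[i J] [/= hi]]|].
  by rewrite IH => /andP[/eqP <- hJ] -> /=; rewrite eqxx hi hJ.
by case: I => // i J /= /andP[hJ /andP[hi aJ]]; exists (i, J); rewrite IH aJ andbT.
Qed.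

Lemma uniq_words l n : uniq l -> uniq (words l n).
Proof.
by move=> ul; elim: n => //= n IH; apply: allpairs_uniq => // -[i I] [j J] _ _ [-> ->].
Qed.

Lemma ev_dxi_prod N (f : word -> R) S :
  (forall I, size I = size S -> ~~ all (fun i => imode i <= N)%N I -> f I = 0) ->
  \sum_(I \in [set I : word | size I = size S]) odxi_prod I S * f I = ev N f S.
Proof.
move=> hf.
have mw I : all (mem (idxs r N)) I = all (fun i => imode i <= N)%N I.
  by apply: eq_all => i; apply: mem_idxs.
have wS I : I \in words (idxs r N) (size S) -> size I = size S.
  by rewrite mem_words => /andP[/eqP].
rewrite (@fsbigE _ _ _ _ _ (words (idxs r N) (size S))) //; last first.
- move=> I /= IS; rewrite mem_words IS eqxx mw => h; by rewrite hf ?mulr0.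
- exact/uniq_words/uniq_idxs.
rewrite big_mkcond big_seq (eq_bigr (fun I => odxi_prod I S * f I)) => [|I /wS IS]; last first.
  by rewrite ifT // inE.
rewrite -big_seq {hf wS mw}; elim: S f => [|s S IH] f /=; first by rewrite big_seq1 mul1r.
rewrite big_allpairs_dep -IH exchange_big; apply: eq_bigr => I _ /=.
rewrite mulr_sumr; apply: eq_bigr => i _; rewrite (odxiE _ phi_odd V_even V_00) mulrA; congr (_ * _).
(* [odxi_prod I S] has the combined parity of the variables [I] and the forms [S]; crossing it
   trades the sign of the forms for that of the variables. *)
by rewrite (supcomm _ (hpar_odxi_prod I S)) pexp_addb addbAC addbb addFb.
Qed.

Lemma oomegaF_ev g n : exists N0 : nat, forall N, (N0 <= N)%N -> forall S, size S = n ->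
  oomegaF g S = ev N (F g.*2) S.
Proof.
have [N0 hN0] := Ffin g.*2 n; exists N0 => N hN S Sn; apply: ev_dxi_prod => I IS.
by apply: contraNeq => /(hN0 I (etrans IS Sn)); apply: sub_all => i /leq_trans; apply.
Qed.

Lemma odxi_far i s : s.2 < - (imode i)%:Z -> odxi B phi V i s = 0.
Proof.
have z (b : bool) : b = false -> b%:R = 0 :> R by move->.
case: s => [[b e] [m|m]] /= h; first by exfalso; lia.
case: i h => [[a k]|[a [|k]]] /= h; rewrite ?scaler0 addr0; case: e => //; rewrite z //;
  by rewrite (_ : (_ == _ :> int) = false) ?andbF //; apply/negbTE/eqP; lia.
Qed.

Lemma ev_far N (f : word -> R) S : has (fun s => s.2 < - N%:Z) S -> ev N f S = 0.
Proof.
elim: S f => [|s S IH] f //= /orP[sN|]; last exact: IH.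
apply: evN0 => K _; rewrite /sdN big_seq big1 // => i; rewrite mem_idxs => iN.
by rewrite -(odxiE _ phi_odd V_even V_00) odxi_far ?pexp0 ?mul0r //; lia.
Qed.

Lemma oomegaF_far g n : exists N0 : nat, forall S, size S = n ->
  has (fun s => s.2 < - N0%:Z) S -> oomegaF g S = 0.
Proof.
have [N0 hN0] := oomegaF_ev g n; exists N0 => S Sn hS.
by rewrite (hN0 N0) // ev_far.
Qed.

Lemma hpar_oomegaF g S : hpar (wf S) (oomegaF g S).
Proof.
have [N0 hN0] := oomegaF_ev g (size S); rewrite (hN0 N0) //.
by apply: (whom_evN (hcd B_even phi_odd V_even) N0 (e := false)) => I; apply: Fev.
Qed.

Lemma oomegaF_swap g s u T : oomegaF g [:: s, u & T] = (-1) ^+ (fp s && fp u) * oomegaF g [:: u, s & T].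
Proof.
have [N0 hN0] := oomegaF_ev g (size T).+2; rewrite !(hN0 N0) //=.
rewrite (sdN_swap (hcd B_even phi_odd V_even)); last by move=> i j K; exact: (Fsym _ [::]).
by rewrite evN_sign andbC.
Qed.

Lemma oomega_02E s u : oomega 0 [:: s; u] =
  (sing C s u)%:A + (oBreg B phi V s u + oomegaF 0 [:: s; u]).
Proof.
case: s u => [[a e1] k] [[b e2] l]; rewrite /oomega /oomega02 expand_w !negbK mulrA -signr_addb addbb.
by rewrite mul1r.
Qed.

Hypothesis Fhalf : forall h I, odd h -> F h I = 0.

Local Notation W := (nlogZ F).
Local Notation om_N := (Om t tau B phi V W).

(** A correlator with |T| + 1 entries sits at order M = 2g + |T|; any other order belongs to a
    half-integral genus, where F vanishes, or to no term of log Z. *)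
Lemma Om_eq0 N s M T : (forall g : nat, M <> (g.*2 + size T)%N) -> om_N N s M T = 0.
Proof.
move=> hM; rewrite OmE; case: M hM => [|M] hM.
  by case: T hM => // /(_ 0%N).
have -> : (if M is 0%N then if T is [:: u] then upN B phi V N s u else 0 else 0) = 0.
  by case: M hM => // hM; case: T hM => [|u [|v T]] // /(_ 0%N).
rewrite add0r evN0 // => I /= IT; rewrite /nlogZ; case: ifP => // /andP[_ hI].
rewrite Fhalf //; apply/negPn/negP => ev.
apply: (hM (M.+2 - size I)./2); move: (odd_double_half (M.+2 - size I)); rewrite (negbTE ev) add0n => ->.
by rewrite IT; move: hI; rewrite IT /=; lia.
Qed.

Lemma oomega_gen g S : (0 < g)%N || (2 < size S)%N -> oomega g S = oomegaF g S.
Proof. by case: g S => [|g] [|[[a e] k] [|[[b e'] l] [|u T]]]. Qed.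

(** omega_{0,1} is the constant term, and in omega_{0,2} the terms in x^i supply [sing] and [oBreg];
    everything else comes from W. *)
Lemma oomega_Om g n : exists N0 : nat, forall N, (N0 <= N)%N -> forall s T, size T = n ->
  (`|s.2| < N)%N -> oomega g (s :: T) = om_N N s (g.*2 + n) T.
Proof.
have [N0 hN0] := oomegaF_ev g n.+1; exists N0 => N hN s T Tn sN; rewrite OmE.
have evE M : (M.+1 = g.*2 + n)%N -> ev N (W M) (s :: T) = oomegaF g (s :: T).
  move=> hM; rewrite (hN0 N) //= ?Tn //; apply: (@eq_evN _ _ _ _ _ _ _ (s :: T)) => I /= IT.
  by rewrite /nlogZ IT Tn ifT; [congr (F _ _); lia|lia].
have [|] := boolP ((0 < g)%N || (1 < n)%N) => h.
  case E : (g.*2 + n)%N => [|M]; first by exfalso; lia.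
  rewrite evE ?E // oomega_gen /= ?Tn //.
  case: M E => [|M] E; last by rewrite add0r.
  by exfalso; lia.
have g0 : g = 0%N by lia. have {h} n1 : (n < 2)%N by lia. rewrite g0 in evE *.
case: T n Tn n1 evE {hN0 hN} => [|u [|v T]] n <- // _ evE.
- by case: s sN {evE} => [[a e] k].
- rewrite -[RHS]/(upN B phi V N s u + ev N (W 0%N) [:: s; u]) (evE 0%N) // (upE _ phi_odd V_even V_00 V_antisym) //.
  by rewrite -/(oomega 0 [:: s; u]) oomega_02E addrA.
Qed.

Hypotheses (t_even : forall a k, hpar false (t a k)) (tau_odd : forall a k, hpar true (tau a k)).
Hypothesis mero : exists N : int, forall a k, k < N -> t a k = 0 /\ tau a k = 0.

Lemma hpar_oBreg s u : hpar (wf [:: s; u]) (oBreg B phi V s u).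
Proof.
have h0 (x : bool) : hpar x (0 : R) by exact: hpar0.
rewrite !wpar_cons wpar_nil addbF; case: s u => [[a e1] [k|k]] [[b e2] [l|l]]; rewrite /fpar /=; try exact: h0.
case: e1; case: e2 => /=; last by case: ifP.
- exact: hparZ.
- by case: ifP => _ //; apply: hparZ.
- by case: ifP => _ //; apply: hparZ.
Qed.

Lemma hpar_oomega g S : hpar (wf S) (oomega g S).
Proof.
have [h|] := boolP ((0 < g)%N || (2 < size S)%N); first by rewrite oomega_gen //; exact: hpar_oomegaF.
rewrite negb_or -eqn0Ngt => /andP[/eqP-> ]; case: S => [|s [|u [|v T]]] // _.
- exact: hpar_oomegaF.
- by rewrite wpar_cons wpar_nil addbF; case: s => [[a e] k]; case: e; [apply: tau_odd|apply: t_even].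
rewrite oomega_02E; apply: hparD; last by apply: hparD (hpar_oomegaF _ _); apply: hpar_oBreg.
rewrite /sing; case: ifP => [/andP[/eqP su _]|_]; last by rewrite scale0r; apply: hpar0.
by rewrite !wpar_cons wpar_nil /fpar su addbF addbb; apply/hparZ/hpar1.
Qed.

Lemma oomega_far g n : exists N0 : nat, forall s T, size T = n -> s.2 < - N0%:Z -> oomega g (s :: T) = 0.
Proof.
have [N0 hN0] := oomegaF_far g n.+1; have [N1 hN1] := mero; exists (maxn N0 `|N1|) => s T Tn sN.
have hF : oomegaF g (s :: T) = 0.
  by apply: hN0 => /=; rewrite ?Tn //; apply/orP; left; lia.
have [h|] := boolP ((0 < g)%N || (1 < n)%N); first by rewrite oomega_gen /= ?Tn.
rewrite negb_or -eqn0Ngt => /andP[/eqP g0 n1]; rewrite g0 in hF *.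
case: T n Tn n1 hF {hN0} => [|u [|v T]] n <- // _ hF.
  case: s sN {hF} => [[a e] k] /= kN; have [] := hN1 a k; first by lia.
  by case: e.
rewrite oomega_02E hF addr0 /sing.
case: s sN {hF} => [[a e] [k|k]] /= kN; first by exfalso; lia.
by case: e; case: ifP => _; rewrite scale0r addr0; case: u => [[]].
Qed.

Hypotheses (t0 : forall a, t a 0 = 0).

(** For omega_{0,2} the part B^R is left out: at z_2 = -z_1 its expansion for |z_1| < |z_2| cannot
    be restricted term by term. *)
Definition opw (g : nat) T s u : R := if g is g'.+1 then
    if (g' == 0%N) && nilp T then oBreg B phi V s u + oomegaF 0 [:: s; u] else oomega g' [:: s, u & T]
  else 0.

(* The bidifferential whose Casimir is E^2, without B^R. *)
Definition oP (g : nat) T s u : R :=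
  opw g T s u + \sum_(g1 < g.+1) otensor (oomega g1) (oomega (g - g1)) s u T.

Lemma oBreg_swap s u : oBreg B phi V s u = (-1) ^+ (fp s && fp u) * oBreg B phi V u s.
Proof.
case: s u => [[a e1] [k|k]] [[b e2] [l|l]]; rewrite /fpar /= ?mulr0 //; try by case: e1; case: e2; rewrite ?mulr0.
case: e1; case: e2 => /=; rewrite ?mul1r //.
  by rewrite mulN1r -scalerN -V_antisym addrAC.
by rewrite andbC B_sym.
Qed.

Lemma oomega_swap g s u T : (0 < g)%N || (0 < size T)%N ->
  oomega g [:: s, u & T] = (-1) ^+ (fp s && fp u) * oomega g [:: u, s & T].
Proof. by move=> h; rewrite !oomega_gen //= oomegaF_swap. Qed.

Lemma opw_swap g T s u : opw g T s u = (-1) ^+ (fp s && fp u) * opw g T u s.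
Proof.
case: g => [|g]; first by rewrite mulr0.
rewrite /opw; case: ifP => [_|h]; first by rewrite oBreg_swap oomegaF_swap mulrDr.
by apply: oomega_swap; move: h; case: g => [|g]; case: T.
Qed.

Lemma whom_oomega g s : @whom C R _ fp (fp s) (fun K => oomega g (s :: K)).
Proof. by move=> K; have := hpar_oomega g (s :: K); rewrite wpar_cons. Qed.

(** Reversing the splitting of the genus and commuting the two factors exchanges the points in the
    quadratic terms. *)
Lemma oP_swap g T s u : oP g T s u = (-1) ^+ (fp s && fp u) * oP g T u s.
Proof.
rewrite /oP mulrDr opw_swap; congr (_ + _).
rewrite mulr_sumr (reindex_inj rev_ord_inj) /=; apply: eq_bigr => j _.
rewrite !otensorE; try exact: hpar_oomega.
rewrite (wconvC _ (whom_oomega _ s) (whom_oomega _ u)) subSS subKn; last by rewrite -ltnS.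
by rewrite (andbC (fp u)).
Qed.

(** Both series are supported at M = 2h + |K|, so a nonzero summand of the Cauchy product in hbar is
    given by a splitting of the genus. *)
Lemma nconv_graded (X Y : nat -> seq (oneform r) -> R) g T :
  (forall M K, (forall h, M <> h.*2 + size K)%N -> X M K = 0) ->
  (forall M K, (forall h, M <> h.*2 + size K)%N -> Y M K = 0) ->
  nconv fp X Y (g.*2 + size T) T = \sum_(h < g.+1)
    fwcv (fun K => X (h.*2 + size K)%N K) (fun K => Y ((g - h).*2 + size K)%N K) T.
Proof.
move=> hX hY; rewrite /nconv /wconv exchange_big [RHS]exchange_big /=; apply: eq_bigr => b _.
set I := mask b T; set J := mask _ T.
have IJ : (size I + size J = size T)%N.
  rewrite !size_mask ?size_map ?size_tuple // count_map.
  by rewrite -[RHS](size_tuple b) -(count_predC id).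
pose f j := (-1) ^+ shuffle_sign fp b T * pexp (wf J) (X j I) * Y (g.*2 + size T - j)%N J.
have f0 j : (j <= g.*2 + size T)%N -> (forall h, (h <= g)%N -> j <> h.*2 + size I)%N -> f j = 0.
  move=> jM hj; rewrite /f; have [[h jE]|nj] := pselect (exists h, j = h.*2 + size I)%N; last first.
    by rewrite hX ?pexp0 ?mulr0 ?mul0r // => h jE; apply: nj; exists h.
  have gh : (g < h)%N by rewrite ltnNge; apply/negP => /hj.
  have [[h' jE']|nj] := pselect (exists h', g.*2 + size T - j = h'.*2 + size J)%N; last first.
    by rewrite hY ?mulr0 // => h' jE'; apply: nj; exists h'.
  by exfalso; lia.
rewrite -[LHS]/(\sum_(j < (g.*2 + size T).+1) f j) (eq_bigr (fun j : 'I__ => \sum_(h < g.+1)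
    (nat_of_ord j == h.*2 + size I)%N%:R * f (h.*2 + size I)%N)) => [|j _]; last first.
  have [[h [hg jE]]|nj] := pselect (exists h, (h <= g)%N /\ nat_of_ord j = h.*2 + size I)%N; last first.
    rewrite f0 ?big1 // => [h _||h hg jE]; [|by rewrite -ltnS|by apply: nj; exists h].
    case: eqP => [jE|]; last by rewrite mul0r.
    by exfalso; apply: nj; exists h; split => //; rewrite -ltnS.
  have hg' : (h < g.+1)%N by [].
  rewrite (bigD1 (Ordinal hg')) //= -jE eqxx mul1r big1 ?addr0 // => h' /eqP hh'.
  case: eqP => [jE'|]; last by rewrite mul0r.
  by exfalso; apply: hh'; apply: val_inj => /=; lia.
rewrite exchange_big; apply: eq_bigr => h _ /=.
have hM : (h.*2 + size I < (g.*2 + size T).+1)%N by have := ltn_ord h; lia.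
rewrite (bigD1 (Ordinal hM)) //= eqxx mul1r big1 ?addr0 => [|j /eqP jh]; last first.
  by case: eqP => [jE|]; rewrite ?mul0r //; exfalso; apply: jh; apply: val_inj.
rewrite /f; congr (_ * Y _ _); have := ltn_ord h; lia.
Qed.

Lemma oomega_Om_uniform k : exists N0 : nat, forall N, (N0 <= N)%N -> forall g s T, (g <= k)%N ->
  (size T <= k)%N -> (`|s.2| < N)%N -> oomega g (s :: T) = om_N N s (g.*2 + size T) T.
Proof.
have [f hf] := choice (fun gn : nat * nat => oomega_Om gn.1 gn.2).
exists (\max_(gn : 'I_k.+1 * 'I_k.+1) f (val gn.1, val gn.2)) => N hN g s T gk Tk sN.
apply: (hf (g, size T)) => //; apply: leq_trans hN.
have gk' : (g < k.+1)%N by []. have Tk' : (size T < k.+1)%N by [].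
exact: (leq_bigmax (F := fun hn : 'I_k.+1 * 'I_k.+1 => f (val hn.1, val hn.2)) (Ordinal gk', Ordinal Tk')).
Qed.

Lemma oomega_far_uniform k : exists N0 : nat, forall g s T, (g <= k)%N -> (size T <= k)%N ->
  s.2 < - N0%:Z -> oomega g (s :: T) = 0.
Proof.
have [f hf] := choice (fun gn : nat * nat => oomega_far gn.1 gn.2).
exists (\max_(gn : 'I_k.+1 * 'I_k.+1) f (val gn.1, val gn.2)) => g s T gk Tk sN.
apply: (hf (g, size T)) => //; apply: (lt_le_trans sN); rewrite lerN2 lez_nat.
have gk' : (g < k.+1)%N by []. have Tk' : (size T < k.+1)%N by [].
exact: (leq_bigmax (F := fun hn : 'I_k.+1 * 'I_k.+1 => f (val hn.1, val hn.2)) (Ordinal gk', Ordinal Tk')).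
Qed.

(** The order of the pole in the first point is bounded, and [oP_swap] carries the bound over to the
    second. *)
Lemma oP_far g n : exists N0 : nat, forall s u T, size T = n -> s.2 < - N0%:Z \/ u.2 < - N0%:Z ->
  oP g T s u = 0.
Proof.
have [N1 h1] := oomega_far_uniform (g + n).+1; have [N2 h2] := oomegaF_far 0 2.
have far s u T : size T = n -> s.2 < - (maxn N1 N2)%:Z -> oP g T s u = 0.
  move=> Tn sN; have sN1 : s.2 < - N1%:Z by lia. have sN2 : s.2 < - N2%:Z by lia.
  rewrite /oP big1 ?addr0 => [|j _]; last first.
    rewrite otensorE ?wconv_eq0l ?mulr0 // => [K hK|S]; last exact: hpar_oomega.
    by apply: h1 => //; have := ltn_ord j; move: hK; lia.
  rewrite /opw; case: g {h1} (h1) => // g' h1'; case: ifP => _; last first.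
    by apply: h1' => //=; lia.
  rewrite h2 //= ?sN2 //.
  by case: s sN1 {sN sN2} => [[a e] [k|k]] /= sN1; [exfalso; lia|rewrite addr0; case: u => [[]]].
exists (maxn N1 N2) => s u T Tn [|uN]; first exact: far.
by rewrite oP_swap far ?mulr0.
Qed.

Local Notation qO := (qOm t tau B phi V W).

(** For g = 1 and empty T the constant [- sing C u s] of normal ordering removes the expansion of
    B^R from omega_{0,2}. The sign on the right exchanges the two points. *)
Lemma qOm_oP g n : exists N0 : nat, forall N, (N0 <= N)%N -> forall s u T, size T = n ->
  (`|s.2| < N)%N -> (`|u.2| < N)%N ->
  qO N s u (- sing C u s) (g.*2 + n) T = (-1) ^+ (fp s && fp u) * oP g T s u.
Proof.
have [N0 hN0] := oomega_Om_uniform (g + n).+1; exists N0 => N hN s u T Tn sN uN.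
rewrite /qOm -Tn nconv_graded; last 2 first.
- by move=> M K h; apply: Om_eq0.
- by move=> M K h; apply: Om_eq0.
rewrite addrAC /oP mulrDr; congr (_ + _); last first.
  rewrite mulr_sumr; apply: eq_bigr => j _; rewrite otensorE; last exact: hpar_oomega.
  rewrite mulrA -signr_addb addbb mul1r; apply: eq_wconv => K hK.
    by rewrite (hN0 N) //; have := ltn_ord j; lia.
  by rewrite (hN0 N) //; have := ltn_ord j; lia.
rewrite /opw; case: g hN0 => [|g] hN0.
  rewrite mulr0 add0n; case: T Tn => [|x [|y [|z T]]] _ //=; rewrite ?andbF mulr0 scale0r addr0 //;
    by apply: Om_eq0 => h /=; lia.
rewrite doubleS !addSn -addnS -[(size T).+1]/(size (s :: T)) -(hN0 N) //=; try lia.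
case: ifP => [/andP[/eqP -> ]|h].
  case: T Tn => // _ _; rewrite (_ : (_ == _) && _ = true) // mulr1 oomega_02E scaleNr addrAC addrN add0r.
  by rewrite (oBreg_swap s) (oomegaF_swap 0 s) -mulrDr mulrA -signr_addb addbb mul1r.
rewrite (_ : (_ == _) && _ = false) ?mulr0 ?scale0r ?addr0; last first.
  by apply/negbTE/negP => /andP[gT Tnil]; move: h; rewrite Tnil; move: gT; case: (T) Tnil => // _; lia.
rewrite [X in _ = _ * X](oomega_swap s) ?mulrA -?signr_addb ?addbb ?mul1r //.
by move: h; case: (g); case: (T).
Qed.

(** What normal ordering subtracts is thereby the expansion of B^R, with the form of the inner mode
    as first point. *)
Lemma vv_sing a e e' (j l : int) :
  vv C (mode a e (- j)) (mode a e' l) = sing C (mode a e' (- l)) (mode a e j).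
Proof.
have inlE (x y : 'I_r * nat) : (inl x == inl y :> idx r) = (x == y) by [].
have inrE (x y : 'I_r * nat) : (inr x == inr y :> idx r) = (x == y) by [].
rewrite /vv /sing /osc_i /osc_d /osc_x /mode /= xpair_eqE eqxx /= eqr_opp abszN.
case: e; case: e' => //=; rewrite ?mul0r // ?inlE ?inrE xpair_eqE eqxx /=.
- have [->|lj] := eqVneq l j.
    rewrite !eqxx mul1r oppr_eq0 oppr_gt0 oppr_ge0.
    by case: (ltrgtP j 0) => h; rewrite ?mul1r ?mul0r.
  rewrite (inj_eq oppr_inj) (negbTE lj) oppr_ge0; case: (ltrgtP l 0) => h; rewrite ?mulr0 //.
    case: eqP => jl; rewrite ?mul0r // (_ : (j <= 0) = false) ?mul0r ?mulr0 //; lia.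
  case: eqP => jl; rewrite ?mul0r //; move: lj; rewrite h; lia.
- have [->|lj] := eqVneq l j.
    rewrite !eqxx mul1r oppr_gt0; case: (ltrgtP j 0) => h; rewrite ?mul1r ?mul0r //.
    by rewrite -[- j]gez0_abs ?abszN //; lia.
  rewrite (inj_eq oppr_inj) (negbTE lj) oppr_gt0; case: (ltrgtP l 0) => h; rewrite ?mulr0 //.
  case: eqP => jl; rewrite ?mul0r // (_ : (j < 0) = false) ?mul0r ?mulr0 //; lia.
Qed.

Lemma sgn_even (m k : int) : (-1 : C) ^ (2 * m - k) = (-1) ^ k.
Proof.
have nz : (-1 : C) != 0 by rewrite oppr_eq0 oner_eq0.
have s2 : (-1 : C) ^ (2 : int) = 1 by rewrite -[_ ^ _]/((-1) ^+ 2) sqrrN expr1n.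
by rewrite expfzDr // -exprz_exp s2 exp1rz mul1r -exprz_inv invrN1.
Qed.

Lemma sgn_odd (m k : int) : (-1 : C) ^ (2 * m + 1 - k) = - (-1) ^ k.
Proof.
have nz : (-1 : C) != 0 by rewrite oppr_eq0 oner_eq0.
by rewrite addrAC expfzDr // sgn_even expr1z mulrN1.
Qed.

(** The two exponents add up to m, so if one is large in absolute value then one of them is very
    negative. *)
Lemma oP_support g T a m : exists K0 : nat, forall K, (K0 <= K)%N ->
  forall e1 e2 (k : int), (K < `|k|)%N -> oP g T (a, e1, k) (a, e2, m - k) = 0.
Proof.
have [N0 hN0] := oP_far g (size T); exists (N0 + `|m|)%N => K hK e1 e2 k hk.
by apply: hN0 => //=; lia.
Qed.

(** B^R enters the Casimir only through omega_{0,2}, for g = 1 and empty T, with the value of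
    [casimir_BR]. The pieces are separated only after each is shown to have finite support. *)
Lemma oE2E a g T e m : oE2 a g T e m =
  ocasimir (obifun_of (oP g T) a a) e m - ([&& g == 1%N, nilp T, e & m == 0]%:R / 2)%:A.
Proof.
have ext (w w' : oneform r -> oneform r -> R) : (forall s u, w s u = w' s u) -> w = w'.
  by move=> h; apply: funext => s; apply: funext.
rewrite /oE2; case: g => [|g].
  rewrite add0r mul0r scale0r subr0; congr (ocasimir (obifun_of _ a a) e m); apply: ext => s u.
  by rewrite /oP /= add0r.
pose wt s u := \sum_(g1 < g.+2) otensor (oomega g1) (oomega (g.+1 - g1)) s u T.
have [N1 h1] := oomega_far_uniform (g + size T).+2.
have tfar s u : s.2 < - N1%:Z \/ u.2 < - N1%:Z -> wt s u = 0.
  move=> h; rewrite /wt big1 // => j _; rewrite otensorE; last exact: hpar_oomega.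
  case: h => h.
    by rewrite wconv_eq0l ?mulr0 // => K hK; apply: h1 => //; have := ltn_ord j; lia.
  by rewrite wconv_eq0r ?mulr0 // => K hK; apply: h1 => //; lia.
have [N2 h2] := oP_far g.+1 (size T).
have pfar s u : s.2 < - N2%:Z \/ u.2 < - N2%:Z -> oP g.+1 T s u = 0 by exact: h2.
pose K := (N1 + N2 + `|m|)%N.
have tK e1 e2 k : (K < `|k|)%N -> wt (a, e1, k) (a, e2, m - k) = 0 by move=> hk; apply: tfar => /=; lia.
have wK e1 e2 k : (K < `|k|)%N -> opw g.+1 T (a, e1, k) (a, e2, m - k) = 0.
  move=> hk; have := pfar (a, e1, k) (a, e2, m - k) ltac:(rewrite /=; lia).
  by rewrite /oP -/(wt _ _) tK // addr0.
have PE : ocasimir (obifun_of (oP g.+1 T) a a) e m =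
    ocasimir (obifun_of (opw g.+1 T) a a) e m + ocasimir (obifun_of wt a a) e m.
  rewrite -(casimirD _ (bifun_of_support wK) (bifun_of_support tK)).
  congr (ocasimir _ e m); do 5! apply: funext => ?.
  by rewrite /obifun_of; case: eqP => _; rewrite ?addr0 // -mulrDr.
rewrite PE addrAC; congr (_ + _); rewrite /oomega_pair /opw eqSS.
case: ifP => [h|h]; last first.
  by rewrite (_ : [&& _, _, _ & _] = false) ?mul0r ?scale0r ?subr0 // andbA h.
rewrite andbA h /= -casimir_BR.
have wK' e1 e2 k : (K < `|k|)%N ->
    (fun s u => oBreg B phi V s u + oomegaF 0 [:: s; u]) (a, e1, k) (a, e2, m - k) = 0.
  by move=> /wK => /(_ e1 e2); rewrite /opw h.
rewrite addrC -(casimirD _ (@BR_support _ _ m) (bifun_of_support wK')).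
congr (ocasimir _ e m); do 5! apply: funext => ?.
by rewrite /oomega02 eqxx mul1r.
Qed.

(** The summands of [casimir_w] vanish one by one; the constant of B^R sits at theta z^0, which has
    the opposite parity. *)
Lemma oE2_even a g T e (m : int) : oE2 a g T e (2 * m + e%:Z) = 0.
Proof.
have [K0 hK0] := oP_support g T a (2 * m + e%:Z).
rewrite oE2E (casimir_w _ (hK0 K0 (leqnn _))) (_ : [&& _, _, _ & _] = false); last first.
  by case: (e); rewrite /= ?andbF // (_ : _ == 0 = false) ?andbF //; apply/negbTE/eqP; lia.
rewrite mul0r scale0r subr0; apply: big1 => k _; case: (e).
  by rewrite sgn_odd subrr mulr0 scale0r.
by rewrite addr0 sgn_even subrr mulr0 scale0r.
Qed.

(** Without theta the Casimir combines one bosonic with one fermionic form, as G does. For odd m the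
    sign in [casimir_w] is (-1)^k, the opposite of [kJ]. *)
Lemma oE2_G a g T n0 : (forall m I, oGtilde t tau B phi V a n0 (toZ (nexp ip W)) m I = 0) ->
  oE2 a g T false (- (2 * n0 + 1)) = 0.
Proof.
move=> hG; set m := - _.
have [K1 hK1] := oP_support g T a m; have [N1 hN1] := qOm_oP g (size T).
have [K2 hK2] := G_relation t_even tau_odd t0 mero B_even phi_odd V_even V_00 B_sym V_antisym
  (nlogZ_even Fev) (nlogZ_nil F) (nlogZ_sym Fsym) (nlogZ_fin Ffin) (g.*2 + size T) hG.
pose K := maxn K1 K2; have [N2 hN2] := hK2 K (leq_maxr _ _).
pose N := maxn (maxn N1 N2) (K + `|m|).+1.
have := hN2 N ltac:(lia) (g.*2 + size T)%N T ltac:(lia) ltac:(lia).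
rewrite oE2E (casimir_w _ (hK1 K (leq_maxl _ _))) !andbF mul0r scale0r subr0 => rel.
apply: oppr_inj; rewrite oppr0 -[RHS]rel -sumrN; apply: eq_big_seq => j; rewrite mem_irange => jK.
rewrite (_ : - (2 * n0 + 1 + j) = m - j); last by rewrite /m; lia.
rewrite vv_sing (_ : - (2 * n0 + 1 + j) = m - j); last by rewrite /m; lia.
rewrite hN1 //=; try by rewrite /N; lia.
rewrite mul1r (_ : m = 2 * (- n0 - 1) + 1); last by rewrite /m; lia.
rewrite sgn_odd opprK -scaleNr /kJ -[j - 1]addrC expfzDr ?oppr_eq0 ?oner_eq0 //.
by congr (_ *: _); rewrite exprN1 invrN1; field.
Qed.

(** The reflection of k to 2m - k preserves (-1)^k and, by [oP_swap] on two odd forms, negates the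
    coefficient. This removes the summand n from the weight j + n of [kG], as the Casimir has the
    weight j. *)
Lemma oP_alternating g T a m K :
  (forall e1 e2 k, (K < `|k|)%N -> oP g T (a, e1, k) (a, e2, 2 * m - k) = 0) ->
  \sum_(k <- irange K) (-1) ^ k *: oP g T (a, true, k) (a, true, 2 * m - k) = 0.
Proof.
move=> hK; pose f k : R := (-1) ^ k *: oP g T (a, true, k) (a, true, 2 * m - k).
have f0 k : k \notin irange K -> f k = 0.
  by rewrite mem_irange -ltnNge => /hK h; rewrite /f h scaler0.
have fN k : f (2 * m - k) = - f k.
  by rewrite /f sgn_even opprB addrCA subrr addr0 oP_swap /= expr1 mulN1r scalerN.
have S1 := fsum_seq (uniq_irange K) f0.
(* The reflection does not preserve [irange K] in general, so the comparison goes through the sum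
   over all integers. *)
have S2 : \sum_(k \in [set: int]) f k = - \sum_(k <- irange K) f k.
  rewrite (@fsum_seq _ _ [seq 2 * m - k | k <- irange K]).
  - by rewrite big_map -sumrN; apply: eq_bigr => k _.
  - by rewrite map_inj_uniq ?uniq_irange // => x y /addrI/oppr_inj.
  move=> k hk; rewrite -[k](subKr (2 * m)) fN f0 ?oppr0 //.
  by apply: contra hk => hk; apply/mapP; exists (2 * m - k); rewrite ?subKr.
have /eqP : \sum_(k <- irange K) f k = - \sum_(k <- irange K) f k by rewrite -[LHS]S1 S2.
rewrite -subr_eq0 opprK -mulr2n -scaler_nat scaler_eq0 pnatr_eq0 /=.
by move/eqP.
Qed.

Lemma oE2_L a g T n0 : (forall m I, oLtilde t tau B phi V a n0 (toZ (nexp ip W)) m I = 0) ->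
  oE2 a g T true (- (2 * n0)) = 0.
Proof.
move=> hL; have -> : - (2 * n0) = 2 * - n0 by lia.
have [K1 hK1] := oP_support g T a (2 * - n0); have [N1 hN1] := qOm_oP g (size T).
have [K2 hK2] := L_relation t_even tau_odd t0 mero B_even phi_odd V_even V_00 B_sym V_antisym
  (nlogZ_even Fev) (nlogZ_nil F) (nlogZ_sym Fsym) (nlogZ_fin Ffin) (g.*2 + size T) hL.
pose K := maxn K1 K2; have [N2 hN2] := hK2 K (leq_maxr _ _).
pose N := maxn (maxn N1 N2) (K + `|2 * - n0|).+1.
have := hN2 N ltac:(lia) (g.*2 + size T)%N T ltac:(lia) ltac:(lia).
have hK := hK1 K (leq_maxl _ _).
have q e (j : int) : j \in irange K -> qO N (mode a e j) (mode a e (- (2 * n0 + j)))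
    (- vv C (mode a e (- j)) (mode a e (2 * n0 + j))) (g.*2 + size T) T =
    (-1) ^+ e *: oP g T (a, e, j) (a, e, 2 * - n0 - j).
  rewrite mem_irange => jK; have jE : - (2 * n0 + j) = 2 * - n0 - j by lia.
  rewrite vv_sing jE hN1 //=; try by rewrite /N; lia.
  by rewrite andbb scale_sign.
rewrite (eq_big_seq (fun j => kJ C j *: ((-1) ^+ false *: oP g T (a, false, j) (a, false, 2 * - n0 - j)))) => [|j hj]; last first.
  by rewrite q.
rewrite [X in _ + 2^-1 *: X](eq_big_seq (fun j => kG C n0 j *: ((-1) ^+ true *: oP g T (a, true, j) (a, true, 2 * - n0 - j)))) => [|j hj]; last first.
  by rewrite q.
set P := fun e j => oP g T (a, e, j) (a, e, 2 * - n0 - j).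
pose SJ := \sum_(j <- irange K) (-1 : C) ^ j *: P false j.
pose SG := \sum_(j <- irange K) (-1 : C) ^ j *: (j%:~R *: P true j).
have -> : \sum_(j <- irange K) kJ C j *: ((-1) ^+ false *: P false j) = - SJ.
  rewrite -sumrN; apply: eq_bigr => j _.
  by rewrite /kJ addrC expfzDr ?oppr_eq0 ?oner_eq0 // exprN1 invrN1 mulN1r scale1r scaleNr.
have -> : \sum_(j <- irange K) kG C n0 j *: ((-1) ^+ true *: P true j) = - SG.
  have := oP_alternating hK; rewrite -/(P true _) => /(congr1 (fun x => - (n0%:~R *: x) - SG)).
  rewrite scaler0 oppr0 add0r => <-; rewrite scaler_sumr -opprD -big_split -sumrN /=.
  apply: eq_bigr => j _; rewrite /kG expr1 scaleN1r scalerN; congr (- _).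
  by rewrite !scalerA -scalerDl; congr (_ *: _); rewrite intrD; ring.
rewrite oE2E (casimir_w _ hK) => rel.
have -> : \sum_(k <- irange K) (2^-1 * ((-1) ^ k + (-1) ^ (2 * - n0 - k))) *:
    (k%:~R *: oP g T (a, true, k) (a, true, 2 * - n0 - k) +
      oP g T (a, false, k) (a, false, 2 * - n0 - k)) = SG + SJ.
  rewrite -big_split; apply: eq_bigr => k _; rewrite sgn_even /= -scalerDr; congr (_ *: _).
  by field.
(* Multiplication by -2 undoes the factors 1/2 of L and the signs found above, and turns hbar^2/4
   into the -1/2 of [casimir_BR]. *)
have := congr1 (fun x => (-2 : C) *: x) rel; rewrite scaler0 => <-.
have h2 : -2 / 2 = -1 :> C by field.
rewrite !scalerDr !scalerN !scalerA h2 !scaleN1r !opprK (addrC SJ) -scaleNr; congr (_ + _ *: _).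
(* With T empty, order 2 in hbar means g = 1. *)
rewrite (_ : [&& _, _, _ & _] = (n0 == 0) && ((g.*2 + size T == 2)%N && nilp T)); last first.
  rewrite (_ : (2 * - n0 == 0) = (n0 == 0)); last by lia.
  by rewrite /nilp; case: (n0 == 0); case: (size T) => [|k] /=; rewrite ?andbF ?andbT //; lia.
by rewrite -[in LHS]mulnb natrM; field.
Qed.

Lemma odxi_neg i a e (k : nat) : odxi B phi V i (a, e, Negz k) = (i == osc_i (a, e, Negz k))%:R.
Proof.
rewrite (odxiE _ phi_odd V_even V_00) /cd dPhiE (_ : oddx _ _ _ _ _ = 0) ?addr0; last first.
  by case: e; case: i.
by rewrite [RHS]natr_alg /osc_d /fneg; case: e => /=; rewrite mul1r.
Qed.

Lemma oomegaF_cons_eq0 g s T : (0 < g)%N || (0 < size T)%N ->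
  (forall i K, (1 < g.*2 + size (i :: K))%N -> odxi B phi V i s != 0 -> F g.*2 (i :: K) = 0) ->
  oomegaF g (s :: T) = 0.
Proof.
move=> gT h; have [N hN] := oomegaF_ev g (size T).+1; rewrite (hN N) //=.
apply: evN0 => K KT; apply: big1 => i _; rewrite -(odxiE _ phi_odd V_even V_00).
have [->|nz] := eqVneq (odxi B phi V i s) 0; first by rewrite pexp0 mul0r.
by rewrite h ?mulr0 //= KT; lia.
Qed.

(** * The first loop equation *)

Section FirstLoopEquation.
Variable a : 'I_r.
Hypotheses (W_J : forall j M K, W M (inl (a, j.*2.+1) :: K) = 0)
  (W_Gamma : forall j M K, W M (inr (a, j.*2.+1) :: K) = 0).

Lemma F_W h i K : (forall M, W M (i :: K) = 0) -> (1 < h + size (i :: K))%N -> F h (i :: K) = 0.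
Proof.
move=> hW hK; have := hW (h + (size K).+1 - 2)%N; rewrite /nlogZ /= ifT; last by move: hK => /=; lia.
by move=> <-; congr (F _ _); move: hK => /=; lia.
Qed.

(** A negative power occurs in a single basis form d xi_{-i}, and for this parity i is an index
    covered by [W_J] or [W_Gamma]. No basis form contains [dz] z^(-1), and the expansion of B^R for
    |z_1| < |z_2| has none of these terms. *)
Lemma oomega_low g T (e : bool) (m : int) : (0 < g)%N || (0 < size T)%N -> m <= 0 ->
  m = 2 * (m %/ 2)%Z + (e : nat)%:Z -> oomega g ((a, e, m) :: T) = 0.
Proof.
move=> gT m0 mE.
have hF : oomegaF g ((a, e, m) :: T) = 0.
  apply: oomegaF_cons_eq0 => // i K hK nz; apply: (F_W _ hK) => M.
  case: m m0 mE nz => [m|m] m0 mE nz.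
    have {m0} m0 : m = 0%N by lia. rewrite m0 in mE nz.
    have {mE} e0 : e = false by move: mE; case: (e).
    by move: nz; rewrite e0 /=; case: i {hK} => [[b k]|[b [|k]]]; rewrite /= ?andbF ?scaler0 ?addr0 ?eqxx.
  move: nz; rewrite odxi_neg; have [-> _|_] := eqVneq i (osc_i (a, e, Negz m)); last by rewrite eqxx.
  rewrite /osc_i /=; case: e mE => /= mE.
    have -> : m.+1 = (m./2).*2.+1 by lia.
    exact: W_Gamma.
  have -> : m = (m./2).*2.+1 by lia.
  exact: W_J.
have [h|] := boolP ((0 < g)%N || (1 < size T)%N); first by rewrite oomega_gen.
rewrite negb_or -eqn0Ngt => /andP[/eqP g0 T1]; rewrite g0 in hF gT *.
case: T T1 gT hF => [|u [|v T]] // _ _ hF; rewrite oomega_02E hF addr0.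
have -> : sing C (a, e, m) u = 0.
  rewrite /sing /=; case: ifP => // _; case: (e) mE => mE; rewrite ?ifF //; lia.
case: m m0 mE {hF} => [m|m] m0 mE; last by case: u => [[]] *; rewrite scale0r addr0.
have {m0} m0 : m = 0%N by lia. rewrite m0 in mE *.
have {mE} -> : e = false by move: mE; case: (e).
by rewrite scale0r add0r /=; case: u => [[b []] [l|l]].
Qed.

Hypothesis omega01_sigma : forall e m, m < 1 ->
  oomega01 (a, ~~ e, m) + osigma_pull (fun e m => oomega01 (a, ~~ e, m)) e m = 0.

(** The pullback by sigma cancels the coefficients of one parity. The others have to vanish for m at
    most 0, by [oomega_low] or, for omega_{0,1}, by assumption. *)
Lemma oE1_eq0 g T (e : bool) (m : int) : (forall i : nat, m <> 1 + (e : nat)%:Z + 2 * i%:Z) -> oE1 a g T e m = 0.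
Proof.
move=> hm; have [k mk] : exists k : int, m = 2 * k + (e : nat)%:Z \/ m = 2 * k + (~~ e : nat)%:Z.
  by exists (m %/ 2)%Z; case: (e); lia.
case: mk => mk.
  rewrite /oE1 /osigma_pull scalerA -[X in X + _]scale1r -scalerDl.
  rewrite (_ : 1 + _ = 0) ?scale0r // mk -[_ + _%:Z]subr0; case: (e) => /=.
    by rewrite sgn_odd mul1r subrr.
  by rewrite (addr0 (2 * k)) sgn_even expr1 mulr1 subrr.
have m0 : m <= 0.
  case: (lerP m 0) => // m1; exfalso; case: (e) mk hm => mk hm.
    by apply: (hm `|k - 1|%N) => /=; lia.
  by apply: (hm `|k|%N) => /=; lia.
have [gT|] := boolP ((0 < g)%N || (0 < size T)%N).
  rewrite /oE1 /osigma_pull oomega_low // ?scaler0 ?addr0 //; case: (e) mk; lia.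
rewrite negb_or -!eqn0Ngt size_eq0 => /andP[/eqP -> /eqP ->].
apply: omega01_sigma; lia.
Qed.

End FirstLoopEquation.

End MultiDifferentials.

(** * Both loop equations over an abstract super algebra *)

Section LoopEquations.
Variables (C : numClosedFieldType) (R : supalg C) (r : nat).

Local Notation word := (seq (idx r)).
Local Notation ip := (@ipar r).
Local Notation wp := (wpar (@ipar r)).

Implicit Types (I : word) (T : seq (oneform r)) (a b : 'I_r).

Variables (t tau : 'I_r -> int -> R) (B phi V : 'I_r -> 'I_r -> nat -> nat -> R) (sp : 'I_r -> int).
Variable F : nat -> word -> R.
Hypotheses (t_even : forall a k, hpar false (t a k)) (tau_odd : forall a k, hpar true (tau a k)).
Hypothesis t0 : forall a, t a 0 = 0.
Hypothesis mero : exists N : int, forall a k, k < N -> t a k = 0 /\ tau a k = 0.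
Hypothesis sp13 : forall a, sp a = 1 \/ sp a = 3.
Hypothesis omega01_sigma : forall a e m, m < 1 ->
  oomega01 t tau (a, ~~ e, m) + osigma_pull (fun e m => oomega01 t tau (a, ~~ e, m)) e m = 0.
Hypotheses (B_even : forall a b k l, hpar false (B a b k l))
  (phi_odd : forall a b k l, hpar true (phi a b k l))
  (V_even : forall a b k l, hpar false (V a b k l))
  (V_00 : forall a b, V a b 0 0 = 0)
  (B_sym : forall a b k l, B a b k l = B b a l k)
  (V_antisym : forall a b k l, V a b k l = - V b a l k).
Hypotheses (Fev : forall h I, hpar (wp I) (F h I))
  (Fsym : forall h I1 i j I2, F h (I1 ++ [:: i, j & I2]) =
    (-1) ^+ (ip i && ip j) * F h (I1 ++ [:: j, i & I2]))
  (Ffin : forall h n, exists N, forall I, size I = n ->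
    F h I != 0 -> all (fun i => imode i <= N)%N I)
  (Fhalf : forall h I, odd h -> F h I = 0).

Definition oannihilates (X : (int -> word -> R) -> int -> word -> R) (f : int -> word -> R) : Prop :=
  forall m I, X f m I = 0.

Hypotheses (Z_J : forall a (j : nat), (1 <= j)%N ->
    oannihilates (oJ a (2 * j%:Z)) (ofock_exp (ologZ F)))
  (Z_Gamma : forall a (j : nat), (1 <= j)%N ->
    oannihilates (oGamma a (2 * j%:Z - 1)) (ofock_exp (ologZ F)))
  (Z_L : forall a (j : nat) (n : int), (1 <= j)%N ->
    2 * n = 2 * j%:Z - sp a - 1 ->
    oannihilates (oLtilde t tau B phi V a n) (ofock_exp (ologZ F)))
  (Z_G : forall a (j : nat) (n : int), (1 <= j)%N ->
    2 * n + 1 = 2 * j%:Z - sp a ->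
    oannihilates (oGtilde t tau B phi V a n) (ofock_exp (ologZ F))).

Definition oloopE (i : nat) := if i == 1%N then oE1 t tau B phi V F else oE2 t tau B phi V F.

Lemma ZE : ofock_exp (ologZ F) = toZ (nexp ip (nlogZ F)).
Proof. by rewrite ologZE (ofock_exp_toZ (nlogZ_even Fev) (nlogZ_nil F)). Qed.

Lemma W_J0 a j M K : nlogZ F M (inl (a, j.*2.+1) :: K) = 0.
Proof.
apply: (nexp_inj_annih (nlogZ_even Fev) (nlogZ_nil F)) => M' I.
have := Z_J a (ltn0Sn j) (M'.+1) I; rewrite ZE (_ : 2 * j.+1%:Z = j.*2.+2) //; last by lia.
by rewrite /= /ohbar (_ : M'.+1%:Z - 1 = M') //; lia.
Qed.

Lemma W_Gamma0 a j M K : nlogZ F M (inr (a, j.*2.+1) :: K) = 0.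
Proof.
apply: (nexp_inj_annih (nlogZ_even Fev) (nlogZ_nil F)) => M' I.
have := Z_Gamma a (ltn0Sn j) (M'.+1) I; rewrite ZE (_ : 2 * j.+1%:Z - 1 = j.*2.+1) //; last by lia.
by rewrite /= /ohbar (_ : M'.+1%:Z - 1 = M') //; lia.
Qed.

Theorem loop_equations g (i : nat) a T : i = 1%N \/ i = 2%N ->
  ois_Ophi (i.*2.-1)%N (((sp a - 3) * (i%:Z - 1)) %/ 2)%Z (oloopE i a g T).
Proof.
case=> ->; apply: ois_Ophi_van => e m hm.
  have E1 := oE1_eq0 B_even phi_odd V_even V_00 Ffin (W_J0 a) (W_Gamma0 a) (omega01_sigma a) g T.
  by apply: E1 => k mk; apply: (hm k) => /=; rewrite mk; lia.
have E2 := oE2_even B_even phi_odd V_even V_00 B_sym V_antisym Fev Fsym Ffin t_even tau_odd mero a g T e.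
have [k [->|mk]] : exists k : int, m = 2 * k + (e : nat)%:Z \/ m = 2 * k + 1 + (e : nat)%:Z.
  by exists ((m - (e : nat)%:Z) %/ 2)%Z; lia.
  exact: E2.
(* [dphi]^3 x^((s-3)/2) starts at z^s, and phi brings one more power of z along with theta. *)
have {hm} mlt : m < (e : nat)%:Z + sp a.
  rewrite ltNge; apply/negP => le; have := hm `|((m - (e : nat)%:Z - sp a) %/ 2)%Z|%N.
  by case: (sp13 a) le => -> /= le; apply; lia.
case: e mk mlt {E2} => /= mk mlt.
  rewrite (_ : m = - (2 * - (k + 1))); last by lia.
  apply: (oE2_L B_even phi_odd V_even V_00 B_sym V_antisym Fev Fsym Ffin Fhalf t_even tau_odd mero t0).
  (* The j-th constraint has 2n = 2j - s - 1, so m = s + 1 - 2j, and j >= 1 is the bound m < s +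
     1. *)
  rewrite -ZE; apply: (@Z_L a `|((sp a + 1 - m) %/ 2)%Z|%N); have [] := sp13 a => sa; rewrite sa in mlt *; lia.
rewrite (_ : m = - (2 * - (k + 1) + 1)); last by lia.
apply: (oE2_G B_even phi_odd V_even V_00 B_sym V_antisym Fev Fsym Ffin Fhalf t_even tau_odd mero t0).
(* Here m = s - 2j, and j >= 1 is the bound m < s. *)
rewrite -ZE; apply: (@Z_G a `|((sp a - m) %/ 2)%Z|%N); have [] := sp13 a => sa; rewrite sa in mlt *; lia.
Qed.

End LoopEquations.

(** * Specialisation to superpolynomials *)

Section Instance.
Variables (C : numClosedFieldType) (p q r : nat) (D : spectral_data C p q r).

Let S := superpoly_supalg C p q.
Let t : 'I_r -> int -> S := sd_t D.
Let tau : 'I_r -> int -> S := sd_tau D.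
Let B : 'I_r -> 'I_r -> nat -> nat -> S := sd_B D.
Let phi : 'I_r -> 'I_r -> nat -> nat -> S := sd_phi D.
Let V : 'I_r -> 'I_r -> nat -> nat -> S := sd_V D.
Local Notation fck := (int -> seq (idx r) -> S).

Lemma Jop_supalg a k : @Jop C p q r a k = oJ (R := S) a k.
Proof. by []. Qed.

Lemma Gammaop_supalg a k : @Gammaop C p q r a k = oGamma (R := S) a k.
Proof. by []. Qed.

(** A template with the operators as parameters, so that the two versions are identified parameter
    by parameter instead of by converting the whole expression. *)
Let Lgen (J G : 'I_r -> int -> fck -> fck) (N : (fck -> fck) -> (fck -> fck) -> fck -> fck)
    (h : int -> fck -> fck) (a : 'I_r) (n : int) (f : fck) m I : S :=
  2^-1 *: (\sum_(j \in [set: int]) (-1) ^ (j - 1) *: N (J a (- j)) (J a (2 * n + j)) f m I)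
  + 2^-1 *: (\sum_(j \in [set: int])
     ((-1) ^ j * (j + n)%:~R) *: N (G a (- j)) (G a (2 * n + j)) f m I)
  + ((n == 0)%:R / 4) *: h 2 f m I.

Lemma Lop_supalg a n : @Lop C p q r a n = oLop (R := S) a n.
Proof.
have nE : @nord C p q r = @onord C S r by [].
have hE : @hbar C p q r = @ohbar C S r by [].
have JE : @Jop C p q r = @oJ C S r by [].
have GE : @Gammaop C p q r = @oGamma C S r by [].
transitivity (Lgen (@Jop C p q r) (@Gammaop C p q r) (@nord C p q r) (@hbar C p q r) a n).
  reflexivity.
rewrite nE hE JE GE. reflexivity.
Qed.

Lemma Gop_supalg a n : @Gop C p q r a n = oGop (R := S) a n.
Proof. by []. Qed.

Lemma logT_supalg : logT D = ologT (R := S) t tau.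
Proof. by []. Qed.

Lemma logPhi_supalg : logPhi D = ologPhi (R := S) B phi V.
Proof. by []. Qed.

Lemma exp_conj_supalg A X : @exp_conj C p q r A X = oexp_conj (R := S) A X.
Proof. by []. Qed.

Lemma Ltilde_supalg a n : Ltilde D a n = oLtilde (R := S) t tau B phi V a n.
Proof. by rewrite /Ltilde !exp_conj_supalg logPhi_supalg logT_supalg Lop_supalg. Qed.

Lemma Gtilde_supalg a n : Gtilde D a n = oGtilde (R := S) t tau B phi V a n.
Proof. by rewrite /Gtilde !exp_conj_supalg logPhi_supalg logT_supalg Gop_supalg. Qed.

Lemma fock_exp_supalg F : fock_exp (@logZ C p q r F) = ofock_exp (R := S) (ologZ (R := S) F).
Proof. by []. Qed.

Variable F : nat -> seq (idx r) -> superpoly C p q.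

Lemma omega_supalg : omega D F = oomega (R := S) t tau B phi V F.
Proof. by []. Qed.

Lemma E1_supalg : E1 D F = oE1 (R := S) t tau B phi V F.
Proof. by []. Qed.

Lemma omega_pair_supalg : omega_pair D F = oomega_pair (R := S) t tau B phi V F.
Proof. by []. Qed.

Let E2gen (cas : bifun C p q -> bool -> int -> S) (pr : nat -> 'I_r -> seq (oneform r) -> bifun C p q)
    (om : nat -> seq (oneform r) -> S)
    (tn : (seq (oneform r) -> S) -> (seq (oneform r) -> S) -> oneform r -> oneform r -> seq (oneform r) -> S)
    (bf : (oneform r -> oneform r -> S) -> 'I_r -> 'I_r -> bifun C p q)
    (a : 'I_r) (g : nat) (T : seq (oneform r)) (e : bool) (m : int) : S :=
  (if g is g'.+1 then cas (pr g' a T) e m else 0)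
  + cas (bf (fun s1 s2 => \sum_(g1 < g.+1) tn (om g1) (om (g - g1)%N) s1 s2 T) a a) e m.

Lemma E2_supalg : E2 D F = oE2 (R := S) t tau B phi V F.
Proof.
have cE : @casimir C p q = ocasimir (R := S) by [].
have tE : @tensor C p q r = @otensor C S r by [].
have bE : @bifun_of C p q r = @obifun_of C S r by [].
transitivity (E2gen (@casimir C p q) (omega_pair D F) (omega D F) (@tensor C p q r) (@bifun_of C p q r)).
  by [].
by rewrite cE tE bE omega_pair_supalg omega_supalg.
Qed.

Lemma is_Ophi_supalg j n f : @is_Ophi C p q j n f = ois_Ophi (R := S) j n f.
Proof. by []. Qed.

End Instance.

Theorem theorem5p9 (K : realType) (p q r : nat)
    (D : spectral_data (complex K) p q r)
    (hD : is_local_super_spectral_curve D)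
    (F : nat -> seq (idx r) -> superpoly (complex K) p q)
    (hF : is_partition_function D F)
    (hF_half : forall (h : nat) (I : seq (idx r)), odd h -> F h I = 0)
    (g n i : nat) (hi : i = 1%N \/ i = 2%N) (a : 'I_r)
    (T : n.-tuple (oneform r)) :
  is_Ophi (i.*2.-1)%N (((sd_s D a - 3) * (i%:Z - 1)) %/ 2)%Z
    (loopE D F i a g T).
Proof.
case: hD => te to t0 mero _ _ s13 sig _ Be po Ve _ _ _ V0 Bs Va.
case: hF => Fe Fs Ff ZJ ZG ZL ZGG.
pose S := superpoly_supalg (complex K) p q.
have ZJ' b j : (1 <= j)%N -> oannihilates (oJ (R := S) b (2 * j%:Z)) (ofock_exp (ologZ (R := S) F)).
  by move=> /(ZJ b); rewrite fock_exp_supalg Jop_supalg.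
have ZG' b j : (1 <= j)%N -> oannihilates (oGamma (R := S) b (2 * j%:Z - 1)) (ofock_exp (ologZ (R := S) F)).
  by move=> /(ZG b); rewrite fock_exp_supalg Gammaop_supalg.
have ZL' b j l : (1 <= j)%N -> 2 * l = 2 * j%:Z - sd_s D b - 1 ->
    oannihilates (oLtilde (R := S) (sd_t D) (sd_tau D) (sd_B D) (sd_phi D) (sd_V D) b l) (ofock_exp (ologZ (R := S) F)).
  by move=> j1 /(ZL b j l j1); rewrite fock_exp_supalg Ltilde_supalg.
have ZGG' b j l : (1 <= j)%N -> 2 * l + 1 = 2 * j%:Z - sd_s D b ->
    oannihilates (oGtilde (R := S) (sd_t D) (sd_tau D) (sd_B D) (sd_phi D) (sd_V D) b l) (ofock_exp (ologZ (R := S) F)).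
  by move=> j1 /(ZGG b j l j1); rewrite fock_exp_supalg Gtilde_supalg.
have := @loop_equations (complex K) S r (sd_t D) (sd_tau D) (sd_B D) (sd_phi D) (sd_V D) (sd_s D) F
  te to t0 mero s13 sig Be po Ve V0 Bs Va Fe Fs Ff hF_half ZJ' ZG' ZL' ZGG' g i a T hi.
by rewrite -is_Ophi_supalg /loopE /oloopE E1_supalg E2_supalg.
Qed.
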